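(* Let $g,d\ge 1$ be integers and let $p(x)=\sum_{|\alpha|=d}P_\alpha x^\alpha$ be a noncommutative homogeneous polynomial of degree $d$ in $g$ noncommutative variables $x=(x_1,\dots,x_g)$, with coefficients $P_\alpha=P_{\alpha_1,\dots,\alpha_d}\in\mathbb{C}$. Suppose that $P_\alpha=P_{\tilde\alpha}$ for any index tuples $\alpha,\tilde\alpha\in\{1,\dots,g\}^d$ such that $\mathbb{1}_j^{\alpha}=\mathbb{1}_j^{\tilde\alpha}$ for all $1\le j\le g$. Then $p$ has a noncommutative Waring decomposition with complex coefficients, i.e. there exist $t\in\mathbb{N}$ and $A_j^{(s)}\in\mathbb{C}$ such that $$p(x)=\sum_{s=1}^t\left(A_1^{(s)}x_1+\cdots+A_g^{(s)}x_g\right)^d .$$ Moreover, for a generic noncommutative homogeneous polynomial $\sum_{|\alpha|=d}P_\alpha x^\alpha$ of degree $d$ in $g$ variables over $\mathbb{C}$ satisfying $P_\alpha=P_{\tilde\alpha}$ for all index tuples $\alpha,\tilde\alpha\in\{1,\dots,g\}^d$ with $\mathbb{1}_j^{\alpha}=\mathbb{1}_j^{\tilde\alpha}$ for all $1\le j\le g$, the number of terms needed (the smallest possible $t$ over all such complex decompositions) is $$\left\lceil \frac{1}{g}\binom{g+d-1}{d}\right\rceil ,$$ except in the following cases: (i) $d=2$, where $g$ terms are needed; (ii) $(d,g)\in\{(3,5),(4,3),(4,4),(4,5)\}$, where $\left\lceil \frac{1}{g}\binom{g+d-1}{d}\right\rceil+1$ terms are needed.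
   Context: Noncommutative polynomials in $x_1,\dots,x_g$ are elements of the free associative algebra on $x_1,\dots,x_g$. For an index tuple $\alpha=(\alpha_1,\dots,\alpha_d)$ with $\alpha_i\in\{1,\dots,g\}$, write $|\alpha|=d$ and $x^\alpha=x_{\alpha_1}x_{\alpha_2}\cdots x_{\alpha_d}$. The integer $\mathbb{1}_j^\alpha$ denotes the number of positions $i$ with $\alpha_i=j$ (the superscript is not a power). ''Generic'' means that the set of exceptions is contained in a proper closed algebraic subvariety (the zero set of a nontrivial system of polynomial equations in the coefficients) of the complex vector space of polynomials under consideration, here the space of noncommutative homogeneous degree $d$ polynomials $\sum_{|\alpha|=d}P_\alpha x^\alpha$ satisfying $P_\alpha=P_{\tilde\alpha}$ whenever $\mathbb{1}_j^{\alpha}=\mathbb{1}_j^{\tilde\alpha}$ for all $j$. *)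

(* Defs.v *)
From mathcomp Require Import all_boot all_order all_algebra.
From mathcomp Require Import monalg mpoly complex.
From mathcomp Require Import reals.

Set Implicit Arguments.
Unset Strict Implicit.
Unset Printing Implicit Defensive.

Local Open Scope ring_scope.

(* [{malg F[{fmonom 'I_g}]}] is the monoid algebra of the free monoid on g
   letters, i.e. the free associative algebra on x_1, ..., x_g. *)
Notation ncpoly F g := (malg {fmonom 'I_g} F).

Definition ncvar (F : fieldType) (g : nat) (j : 'I_g) : ncpoly F g :=
  << fmu j >>.

Definition ncmonom (F : fieldType) (g d : nat) (alpha : d.-tuple 'I_g) :
    ncpoly F g :=
  \prod_(i < d) ncvar F (tnth alpha i).

Definition nchom (F : fieldType) (g d : nat)
    (P : {ffun d.-tuple 'I_g -> F}) : ncpoly F g :=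
  \sum_(alpha : d.-tuple 'I_g) P alpha *: ncmonom F alpha.

Definition sym_coef (F : fieldType) (g d : nat)
    (P : {ffun d.-tuple 'I_g -> F}) : Prop :=
  forall alpha beta : d.-tuple 'I_g,
    (forall j : 'I_g, count_mem j alpha = count_mem j beta) ->
    P alpha = P beta.

Definition waring_decomp (F : fieldType) (g d : nat)
    (p : ncpoly F g) (t : nat) : Prop :=
  exists A : 'I_t -> 'I_g -> F,
    p = \sum_(s < t) (\sum_(j < g) A s j *: ncvar F j) ^+ d.

Definition waring_rank_is (F : fieldType) (g d : nat)
    (p : ncpoly F g) (t : nat) : Prop :=
  waring_decomp d p t /\
  (forall t' : nat, waring_decomp d p t' -> (t <= t')%N).

(* [mpoly n F] is written out because monalg.v reuses the notation
   [{mpoly F[n]}] for another type.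
   The value of a polynomial f in the coefficients P_alpha; the coordinates are
   numbered by the enumeration of the index tuples. *)
Definition eval_coef (F : fieldType) (g d : nat)
    (f : mpoly #|{: d.-tuple 'I_g}| F)
    (P : {ffun d.-tuple 'I_g -> F}) : F :=
  f.@[fun i => P (enum_val i)].

(* Q holds for a generic point of the space of symmetric coefficient families:
   the exceptions lie in the zero set of a system S of polynomial equations
   which is not all of that space. Properness is required relative to the
   symmetric subspace, so equations vanishing identically on it do not count. *)
Definition generic_sym (F : fieldType) (g d : nat)
    (Q : {ffun d.-tuple 'I_g -> F} -> Prop) : Prop :=
  exists S : seq (mpoly #|{: d.-tuple 'I_g}| F),
    (exists2 P, sym_coef P & exists2 f, f \in S & eval_coef f P != 0) /\
    (forall P, sym_coef P -> ~ Q P -> forall f, f \in S -> eval_coef f P = 0).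

(* The ceiling is taken in the rationals; it is nonnegative, so the absolute
   value only casts it from int to nat. *)
Definition expected_rank (g d : nat) : nat :=
  `|Num.ceil (g%:R^-1 * 'C(g + d - 1, d)%:R : rat)|%N.

Definition generic_rank (g d : nat) : nat :=
  if d == 2 then g
  else if (d, g) \in [:: (3, 5); (4, 3); (4, 4); (4, 5)]
  then (expected_rank g d).+1
  else expected_rank g d.

(* Main.v *)
Require Import Defs.
From Stdlib Require Import NArith.
From mathcomp Require Import all_boot all_order all_algebra.
From mathcomp Require Import monalg mpoly complex.
From mathcomp Require Import reals.
From mathcomp Require Import ring lra zify.
From mathcomp Require boolp.

(** A symmetric coefficient family is a linear functional on commutative forms of
   degree [d], and a sum of [d]-th powers of linear forms is a sum of [t] evaluation
   functionals; so the question is which functionals are sums of [t] evaluations.  The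
   differential of this Waring map at [t] points is onto exactly when no nonzero form is
   singular at all of them (Terracini), and over an algebraically closed field a map with
   somewhere surjective differential hits a generic target.  By the Alexander-Hirschowitz
   theorem [t] general double points impose independent conditions outside the listed
   cases; it is proved here by the differential Horace method of Chandler, with the cubic
   argument of Brambilla and Ottaviani based on linear subspaces of codimension 3, and
   finitely many explicit configurations checked modulo 101.  For the lower bounds, fewer
   than the generic number of powers satisfy a polynomial relation: by counting parameters
   in general, by a catalecticant determinant for quadrics and exceptional quartics, and
   by minors of a Koszul flattening for cubics in 5 variables.  Finally every symmetric
   family is the sum of two generic ones, hence has some decomposition. *)

(** A double point put on the hyperplane x_g = 0 leaves a double point on the trace, in one variable
    fewer, and a simple point in the residual, in one degree less. The trace conditions rarely
    divide evenly among double points; the e points that only approach the hyperplane absorb the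
    remainder. For cubics the residual forms are quadrics, on which 2 to g - 1 double points are
    never independent, so the subspaces of codimension 3 take over. For quartics, quadrics occur
    only as second residual, and enough double points must stay off the hyperplane to kill them.
    Genericity is handled along lines: on a line joining two configurations, full rank holds outside
    the zeros of one polynomial, and if it fails for the indeterminate parameter there is a solution
    over K[X] that may be taken nonzero at X = 0. Likewise, hitting a generic target means extending
    a ring homomorphism, one coordinate at a time, outside the zeros of one polynomial. The prime
    101 enters only because full rank modulo a prime implies full rank in characteristic 0. *)

Set Implicit Arguments.
Unset Strict Implicit.
Unset Printing Implicit Defensive.

Import Order.TTheory GRing.Theory Num.Theory.
Local Open Scope ring_scope.

(** * Forms and their differentials *)

(* Monomials of degree d in x_0, ..., x_(g-1), by Pascal's recursion: either x_(g-1) does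
   not occur or it can be divided out. A form is a function F : mon d g -> R. *)
Fixpoint mon (d : nat) : nat -> finType :=
  if d is d'.+1 then
    fix mond (g : nat) : finType :=
      if g is g'.+1 then (mond g' + mon d' g'.+1)%type else void
  else fun=> unit.

Definition monl d g (m : mon d.+1 g) : mon d.+1 g.+1 := inl m.
Definition monr d g (m : mon d g.+1) : mon d.+1 g.+1 := inr m.
Definition moncat (T : Type) d g (F : mon d.+1 g -> T) (G : mon d g.+1 -> T)
  (m : mon d.+1 g.+1) : T := match m with inl m' => F m' | inr m' => G m' end.

Arguments mon : simpl never.
Arguments moncat : simpl never.

Lemma monP d g (P : mon d.+1 g.+1 -> Prop) :
  (forall m, P (monl m)) -> (forall m, P (monr m)) -> forall m, P m.
Proof. by move=> Pl Pr [m|m]; [exact: Pl | exact: Pr]. Qed.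

Lemma big_mon (V : nmodType) d g (f : mon d.+1 g.+1 -> V) :
  \sum_m f m = \sum_m f (monl m) + \sum_m f (monr m).
Proof. exact: big_sumType. Qed.

Lemma big_mon0 (V : nmodType) g (f : mon 0 g -> V) : \sum_m f m = f tt.
Proof. by rewrite (big_pred1 (tt : mon 0 g)) // => -[]. Qed.

Section Evaluation.
Variable R : comNzRingType.
Implicit Types (x v : nat -> R).

Fixpoint monval (d : nat) : forall g, mon d g -> (nat -> R) -> R :=
  if d is d'.+1 return forall g, mon d g -> (nat -> R) -> R then
    fix monvald (g : nat) : mon d'.+1 g -> (nat -> R) -> R :=
      if g is g'.+1 return mon d'.+1 g -> (nat -> R) -> R then
        fun m x => match m with
                   | inl m' => monvald g' m' x
                   | inr m' => x g' * @monval d' g'.+1 m' x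
                   end
      else fun=> fun=> 0
  else fun _ _ _ => 1.

Fixpoint dmon (d : nat) : forall g, mon d g -> (nat -> R) -> (nat -> R) -> R :=
  if d is d'.+1 return forall g, mon d g -> (nat -> R) -> (nat -> R) -> R then
    fix dmond (g : nat) : mon d'.+1 g -> (nat -> R) -> (nat -> R) -> R :=
      if g is g'.+1 return mon d'.+1 g -> (nat -> R) -> (nat -> R) -> R then
        fun m x v => match m with
                   | inl m' => dmond g' m' x v
                   | inr m' => v g' * monval m' x + x g' * @dmon d' g'.+1 m' x v
                   end
      else fun _ _ _ => 0
  else fun _ _ _ _ => 0.

Arguments monval : simpl never.
Arguments dmon : simpl never.

Lemma monval0 g (m : mon 0 g) x : monval m x = 1.
Proof. by []. Qed.

Lemma monvall d g (m : mon d.+1 g) x : monval (monl m) x = monval m x.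
Proof. by []. Qed.

Lemma monvalr d g (m : mon d g.+1) x :
  monval (monr m) x = x g * monval m x.
Proof. by []. Qed.

Lemma dmon0 g (m : mon 0 g) x v : dmon m x v = 0.
Proof. by []. Qed.

Lemma dmonl d g (m : mon d.+1 g) x v : dmon (monl m) x v = dmon m x v.
Proof. by []. Qed.

Lemma dmonr d g (m : mon d g.+1) x v :
  dmon (monr m) x v = v g * monval m x + x g * dmon m x v.
Proof. by []. Qed.

Definition monE := (monval0, monvall, monvalr, dmon0, dmonl, dmonr).

Lemma mon_ind (P : forall d g, mon d g -> Prop) :
  (forall g (m : mon 0 g), P 0 g m) ->
  (forall d g (m : mon d.+1 g), P d.+1 g m -> P d.+1 g.+1 (monl m)) ->
  (forall d g (m : mon d g.+1), P d g.+1 m -> P d.+1 g.+1 (monr m)) ->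
  forall d g (m : mon d g), P d g m.
Proof.
move=> P0 Pl Pr; elim=> [|d IHd]; first exact: P0.
by elim=> [[]|g IHg [m|m]]; [exact: Pl | exact: Pr].
Qed.

Lemma monval_ext d g (m : mon d g) x y :
  (forall i, (i < g)%N -> x i = y i) -> monval m x = monval m y.
Proof.
elim/mon_ind: d g / m => [//|d g m IH|d g m IH] xy; rewrite !monE.
  by apply: IH => i ig; rewrite xy // ltnW.
by rewrite IH // xy.
Qed.

Lemma dmon_ext d g (m : mon d g) x y v w :
  (forall i, (i < g)%N -> x i = y i) -> (forall i, (i < g)%N -> v i = w i) ->
  dmon m x v = dmon m y w.
Proof.
elim/mon_ind: d g / m => [//|d g m IH|d g m IH] xy vw; rewrite !monE.
  by apply: IH => i ig; rewrite (xy, vw) // ltnW.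
by rewrite IH // xy // vw // (monval_ext m xy).
Qed.

Definition unitv (j : nat) : nat -> R := fun i => (i == j)%:R.

Lemma dmon_coord d g (m : mon d g) x v :
  dmon m x v = \sum_(j < g) v j * dmon m x (unitv j).
Proof.
elim/mon_ind: d g / m v => [g m|d g m IH|d g m IH] v;
  under [RHS]eq_bigr do rewrite !monE; rewrite !monE.
- by rewrite big1 // => j _; rewrite mulr0.
- rewrite big_ord_recr /= -IH.
  suff -> : dmon m x (unitv g) = 0 by rewrite mulr0 addr0.
  by rewrite IH big1 // => i _; rewrite /unitv ltn_eqF ?mul0r.
- rewrite IH; under [RHS]eq_bigr do rewrite mulrDr.
  rewrite big_split /= mulr_sumr; congr (_ + _); last first.
    by apply: eq_bigr => j _; rewrite mulrCA.
  rewrite big_ord_recr /= /unitv eqxx mul1r big1 ?add0r // => i _.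
  by rewrite gtn_eqF ?mul0r ?mulr0.
Qed.

Lemma dmon_euler d g (m : mon d g) x : dmon m x x = d%:R * monval m x.
Proof.
elim/mon_ind: d g / m => [g m|d g m IH|d g m IH] //; rewrite !monE ?mul0r //.
by rewrite IH -natr1 mulrDl mul1r addrC mulrCA.
Qed.

Definition ev d g (F : mon d g -> R) x := \sum_m F m * monval m x.
Definition D d g (F : mon d g -> R) x v := \sum_m F m * dmon m x v.

Lemma evS d g (F : mon d.+1 g.+1 -> R) x :
  ev F x = ev (fun m => F (monl m)) x + x g * ev (fun m => F (monr m)) x.
Proof.
rewrite /ev big_mon; congr (_ + _); rewrite mulr_sumr.
by apply: eq_bigr => m _; rewrite mulrCA.
Qed.

Lemma DS d g (F : mon d.+1 g.+1 -> R) x v :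
  D F x v = D (fun m => F (monl m)) x v +
            (v g * ev (fun m => F (monr m)) x + x g * D (fun m => F (monr m)) x v).
Proof.
rewrite /D /ev big_mon; congr (_ + _); rewrite !mulr_sumr -big_split /=.
by apply: eq_bigr => m _; rewrite mulrDr; congr (_ + _); rewrite mulrCA.
Qed.

Lemma ev_ext d g (F G : mon d g -> R) x y : F =1 G ->
  (forall i, (i < g)%N -> x i = y i) -> ev F x = ev G y.
Proof. by move=> FG xy; apply: eq_bigr => m _; rewrite FG (monval_ext m xy). Qed.

Lemma D_ext d g (F G : mon d g -> R) x y v w : F =1 G ->
  (forall i, (i < g)%N -> x i = y i) -> (forall i, (i < g)%N -> v i = w i) ->
  D F x v = D G y w.
Proof. by move=> FG xy vw; apply: eq_bigr => m _; rewrite FG (dmon_ext m xy vw). Qed.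

Lemma D_coord d g (F : mon d g -> R) x v :
  D F x v = \sum_(j < g) v j * D F x (unitv j).
Proof.
rewrite /D; under eq_bigr do rewrite dmon_coord mulr_sumr.
rewrite exchange_big; apply: eq_bigr => j _; rewrite mulr_sumr.
by apply: eq_bigr => m _; rewrite mulrCA.
Qed.

Lemma D_euler d g (F : mon d g -> R) x : D F x x = d%:R * ev F x.
Proof.
rewrite mulr_sumr; apply: eq_bigr => m _.
by rewrite dmon_euler mulrCA.
Qed.

Lemma ev_eq0 d g (F : mon d g -> R) x : F =1 (fun=> 0) -> ev F x = 0.
Proof. by move=> F0; rewrite /ev big1 // => m _; rewrite F0 mul0r. Qed.

Lemma D_eq0 d g (F : mon d g -> R) x v : F =1 (fun=> 0) -> D F x v = 0.
Proof. by move=> F0; rewrite /D big1 // => m _; rewrite F0 mul0r. Qed.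

Lemma evZ d g a (F : mon d g -> R) x : ev (fun m => a * F m) x = a * ev F x.
Proof. by rewrite /ev mulr_sumr; apply: eq_bigr => m _; rewrite mulrA. Qed.

Lemma DZ d g a (F : mon d g -> R) x v : D (fun m => a * F m) x v = a * D F x v.
Proof. by rewrite /D mulr_sumr; apply: eq_bigr => m _; rewrite mulrA. Qed.

(* The pair (f, df) is a form of degree d together with its differential. *)
Definition formfun d g (f : (nat -> R) -> R) (df : (nat -> R) -> (nat -> R) -> R) :=
  exists F : mon d g -> R, (forall x, ev F x = f x) /\ (forall x v, D F x v = df x v).

Lemma formfunD d g f1 df1 f2 df2 : formfun d g f1 df1 -> formfun d g f2 df2 ->
  formfun d g (fun x => f1 x + f2 x) (fun x v => df1 x v + df2 x v).
Proof.
case=> F1 [e1 d1] [F2 [e2 d2]]; exists (fun m => F1 m + F2 m).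
by split=> [x|x v]; rewrite -(e1, d1) -(e2, d2) -big_split; apply: eq_bigr => m _;
  rewrite mulrDl.
Qed.

Lemma formfunZ d g a f df : formfun d g f df ->
  formfun d g (fun x => a * f x) (fun x v => a * df x v).
Proof.
by case=> F [e1 d1]; exists (fun m => a * F m); split=> *; rewrite (evZ, DZ) (e1, d1).
Qed.

Lemma formfun_eq d g f df f' df' : f =1 f' -> df =2 df' ->
  formfun d g f df -> formfun d g f' df'.
Proof.
by move=> ff dd [F [e1 d1]]; exists F; split=> *; rewrite (e1, d1) (ff, dd).
Qed.

Lemma formfun0 d g : formfun d g (fun=> 0) (fun _ _ => 0).
Proof. by exists (fun=> 0); split=> *; rewrite (ev_eq0, D_eq0). Qed.

Lemma formfun_sum d g (I : Type) (r : seq I) f df :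
  (forall i, formfun d g (f i) (df i)) ->
  formfun d g (fun x => \sum_(i <- r) f i x) (fun x v => \sum_(i <- r) df i x v).
Proof.
move=> ff; elim: r => [|i r IH].
  by apply: formfun_eq (formfun0 d g) => [x|x v]; rewrite big_nil.
apply: formfun_eq (formfunD (ff i) IH) => [x|x v]; by rewrite big_cons.
Qed.

Lemma formfunX_ev d g i (F : mon d g -> R) : (i < g)%N ->
  formfun d.+1 g (fun x => x i * ev F x) (fun x v => v i * ev F x + x i * D F x v).
Proof.
elim: d g F => [|d IHd]; elim=> // g IHg F.
- rewrite ltnS leq_eqVlt => /predU1P[-> | ig].
    exists (moncat (fun=> 0) F).
    split=> [x|x v]; first by rewrite evS (@ev_eq0 _ _ (fun m => 0)) // add0r.
    by rewrite DS (@D_eq0 _ _ (fun m => 0)) // add0r.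
  have [F' [eF dF]] := IHg (fun m => F m) ig.
  exists (moncat F' (fun=> 0)).
  split=> [x|x v].
    by rewrite evS (@ev_eq0 _ _ (fun m => 0)) // mulr0 addr0 eF.
  rewrite DS (@D_eq0 _ _ (fun m => 0)) // (@ev_eq0 _ _ (fun m => 0)) //.
  by rewrite !mulr0 !addr0 dF.
- rewrite ltnS leq_eqVlt => /predU1P[-> | ig].
    exists (moncat (fun=> 0) F).
    split=> [x|x v]; first by rewrite evS (@ev_eq0 _ _ (fun m => 0)) // add0r.
    by rewrite DS (@D_eq0 _ _ (fun m => 0)) // add0r.
  have [F1 [e1 d1]] := IHg (fun m => F (monl m)) ig.
  have [F2 [e2 d2]] := IHd g.+1 (fun m => F (monr m)) (ltnW ig : i < g.+1)%N.
  exists (moncat F1 F2).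
  split=> [x|x v]; first by rewrite evS e1 e2 (evS F); ring.
  by rewrite DS d1 e2 d2 (evS F) (DS F); ring.
Qed.

Lemma formfunX d g i f df : (i < g)%N -> formfun d g f df ->
  formfun d.+1 g (fun x => x i * f x) (fun x v => v i * f x + x i * df x v).
Proof.
move=> ig [F [eF dF]]; apply: formfun_eq (formfunX_ev F ig) => [x|x v].
  by rewrite eF.
by rewrite eF dF.
Qed.

Definition lin (g : nat) (a : nat -> nat -> R) (x : nat -> R) : nat -> R :=
  fun j => \sum_(i < g) a j i * x i.

(** Serves both changes of coordinates and restrictions to linear subspaces. Each monomial is built
    up by multiplying by one linear form at a time, so no formula for the new coefficients is
    needed. *)
Lemma formfun_lin g g' a d (F : mon d g -> R) :
  formfun d g' (fun x => ev F (lin g' a x)) (fun x v => D F (lin g' a x) (lin g' a v)).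
Proof.
apply: formfun_sum => m.
suff ffm : formfun d g' (fun x => monval m (lin g' a x))
                        (fun x v => dmon m (lin g' a x) (lin g' a v)).
  exact: formfunZ ffm.
elim/mon_ind: d g / m {F} => [g m||d g m IH] //=.
- by exists (fun=> 1); rewrite /ev /D; split=> *; rewrite big_mon0 !monE ?mulr0 ?mulr1.
- have ff i : formfun d.+1 g' (fun x => a g i * (if (i < g')%N then x i else 0) * monval m (lin g' a x))
      (fun x v => a g i * (if (i < g')%N then v i else 0) * monval m (lin g' a x)
        + a g i * (if (i < g')%N then x i else 0) * dmon m (lin g' a x) (lin g' a v)).
    case: (ltnP i g') => ig.
      apply: formfun_eq (formfunZ (a g i) (formfunX ig IH)) => [x|x v]; by ring.
    by apply: formfun_eq (formfun0 _ _) => [x|x v]; ring.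
  apply: formfun_eq (formfun_sum (index_enum 'I_g') (fun i : 'I_g' => ff i)) => [x|x v].
    rewrite monvalr [lin g' a x g]/lin mulr_suml.
    by apply: eq_bigr => i _; rewrite ltn_ord.
  rewrite dmonr [lin g' a x g]/lin [lin g' a v g]/lin !mulr_suml -big_split /=.
  by apply: eq_bigr => i _; rewrite !ltn_ord.
Qed.

End Evaluation.

Section Morphism.
Variables (R S : comNzRingType) (phi : {rmorphism R -> S}).

Lemma monval_rmorph d g (m : mon d g) x : phi (monval m x) = monval m (phi \o x).
Proof.
by elim/mon_ind: d g / m => [g m|d g m IH|d g m IH];
  rewrite !monE ?rmorph1 ?rmorphM ?IH.
Qed.

Lemma dmon_rmorph d g (m : mon d g) x v :
  phi (dmon m x v) = dmon m (phi \o x) (phi \o v).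
Proof.
elim/mon_ind: d g / m => [g m|d g m IH|d g m IH]; rewrite !monE ?rmorph0 //.
by rewrite rmorphD !rmorphM IH monval_rmorph.
Qed.

Lemma ev_rmorph d g (F : mon d g -> R) x : phi (ev F x) = ev (phi \o F) (phi \o x).
Proof.
by rewrite rmorph_sum; apply: eq_bigr => m _; rewrite rmorphM monval_rmorph.
Qed.

Lemma D_rmorph d g (F : mon d g -> R) x v :
  phi (D F x v) = D (phi \o F) (phi \o x) (phi \o v).
Proof.
by rewrite rmorph_sum; apply: eq_bigr => m _; rewrite rmorphM dmon_rmorph.
Qed.

End Morphism.

(** * Kernels of polynomial matrices and their specialisation *)

Section Limit.
Variable K : numFieldType.

Lemma fracE (R : idomainType) (x : {fraction R}) :
  exists a b : R, b != 0 /\ FracField.tofrac b * x = FracField.tofrac a.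
Proof.
elim/quotW: x => r; exists \n_r, \d_r; split; first exact: denom_ratioP.
rewrite -[r in X in X = _]Ratio_numden !piE.
apply/eqmodP => /=; rewrite FracField.equivfE /=.
by rewrite !numden_Ratio ?mul1r ?mulr1 ?oner_eq0 ?denom_ratioP // mulrC.
Qed.

Lemma clear_denominators (R : idomainType) (I : finType) (f : I -> {fraction R}) :
  exists2 b : R, b != 0 & exists a : I -> R,
    forall i, FracField.tofrac b * f i = FracField.tofrac (a i).
Proof.
have /fin_all_exists2[b b0 /fin_all_exists[a ba]] : forall i, exists2 b : R, b != 0 &
    exists a, FracField.tofrac b * f i = FracField.tofrac a.
  by move=> i; have [a [b [b0 e]]] := fracE (f i); exists b => //; exists a.
exists (\prod_i b i); first by apply/prodf_neq0.
exists (fun i => (\prod_(j | j != i) b j) * a i) => i.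
by rewrite (bigD1 i) //= [b i * _]mulrC !rmorphM /= -mulrA ba.
Qed.

(** As long as all entries of the kernel vector vanish at 0, it can be divided by ['X]; the size of
    one nonzero entry bounds the number of divisions. *)
Lemma poly_kernel_at0 (I : finType) (rows : seq (I -> {poly K})) (F : I -> {poly K}) i :
  F i != 0 -> all (fun r => \sum_i F i * r i == 0) rows ->
  exists2 G : I -> {poly K}, (exists j, (G j).[0] != 0) &
    all (fun r => \sum_i G i * r i == 0) rows.
Proof.
have [n] := ubnP (size (F i)); elim: n F => // n IH F szF Fi0 FA.
have [j Fj|F0] := pickP (fun j => (F j).[0] != 0); first by exists F => //; exists j.
have FX j : exists q, F j = q * 'X.
  have /factor_theorem[q ->] : root (F j) 0 by rewrite /root -[_ == 0]negbK F0.
  by exists q; rewrite subr0.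
have [G FG] := fin_all_exists FX.
apply: (IH G).
- move: szF; rewrite FG size_mulX ?ltnS //.
  by apply: contraNneq Fi0 => G0; rewrite FG G0 mul0r.
- by apply: contraNneq Fi0 => G0; rewrite FG G0 mul0r.
- apply: sub_all FA => r /eqP e.
  have : (\sum_j G j * r j) * 'X = 0.
    by apply: etrans e; rewrite mulr_suml; apply: eq_bigr => k _; rewrite FG mulrAC.
  by move/eqP; rewrite mulf_eq0 polyX_eq0 orbF.
Qed.

(** The rows form a matrix over the field of fractions. If it has full rank, clearing denominators
    in a left inverse produces [p], and the left inverse survives at every t with p(t) nonzero.
    Otherwise a kernel vector is cleared of denominators and then handed to [poly_kernel_at0]. *)
Lemma limit_dichotomy (I : finType) (rows : seq (I -> {poly K})) :
  (exists2 p : {poly K}, p != 0 & forall t, p.[t] != 0 -> forall f : I -> K,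
     all (fun r => \sum_i f i * (r i).[t] == 0) rows -> f =1 (fun=> 0)) \/
  (exists2 F : I -> {poly K}, (exists i, (F i).[0] != 0) &
     all (fun r => \sum_i F i * r i == 0) rows).
Proof.
pose A := \matrix_(i < size rows, j < #|I|)
  FracField.tofrac (nth (fun=> 0) rows i (enum_val j)).
have [/row_fullP[B BA]|] := boolP (row_full A).
  left; have [b b0 [a ba]] := clear_denominators (fun ij => B ij.1 ij.2).
  exists b => // t bt f /all_nthP fr i.
  have /(congr1 (fun M : 'M_ _ => M (enum_rank i)))E := BA.
  have Ei j : \sum_k a (enum_rank i, k) * nth (fun=> 0) rows k j = b *+ (i == j).
    apply/eqP; rewrite -tofrac_eq; apply/eqP.
    rewrite rmorph_sum rmorphMn /= -[_ *+ _]mulr_natr.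
    have /(congr1 (fun g => FracField.tofrac b * g (enum_rank j))) := E.
    rewrite !mxE (inj_eq enum_rank_inj) => <-; rewrite mulr_sumr.
    by apply: eq_bigr => k _; rewrite rmorphM /= -ba !mxE enum_rankK mulrA.
  apply/eqP; rewrite -(mulrI_eq0 _ (mulfI bt)); apply/eqP.
  transitivity (\sum_j f j * (b *+ (i == j)).[t]).
    rewrite (bigD1 i) //= eqxx mulrC big1 ?addr0 // => j ji.
    by rewrite eq_sym (negPf ji) mulr0n horner0 mulr0.
  under eq_bigr do rewrite -Ei horner_sum mulr_sumr.
  rewrite exchange_big big1 // => k _.
  have /eqP fk := fr (fun=> 0) k (ltn_ord k).
  transitivity ((a (enum_rank i, k)).[t] * 0); last by rewrite mulr0.
  rewrite -[in RHS]fk mulr_sumr.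
  by apply: eq_bigr => j _; rewrite hornerM mulrCA.
rewrite -cokermx_eq0 => /eqP/matrixP C0; right.
have [[i j] Cij] : exists ij, cokermx A ij.1 ij.2 != 0.
  apply/existsP; apply: contraT; rewrite negb_exists => /forallP H.
  by case: C0 => i j; rewrite [RHS]mxE; apply/eqP; have := H (i, j); rewrite negbK.
have [b b0 [a ba]] := clear_denominators (fun i => cokermx A i j).
apply: (@poly_kernel_at0 _ _ (fun i => a (enum_rank i)) (enum_val i)).
  apply: contraNneq Cij => /eqP.
  by rewrite -tofrac_eq0 -ba mulf_eq0 tofrac_eq0 (negPf b0) /= enum_valK.
apply/(all_nthP (fun=> 0)) => k kr.
have /matrixP/(_ (Ordinal kr) j) := mulmx_coker A.
rewrite mxE [RHS]mxE => /(congr1 (fun x => FracField.tofrac b * x)).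
rewrite mulr0 mulr_sumr => e.
rewrite -tofrac_eq0 rmorph_sum (reindex (@enum_val I predT)) /=; last first.
  by apply: onW_bij; exact: enum_val_bij.
apply/eqP; apply: etrans e; apply: eq_bigr => l _.
by rewrite [A _ _]mxE rmorphM /= enum_valK -ba -mulrA; congr (_ * _); exact: mulrC.
Qed.

End Limit.

Section AlmostAll.
Variable K : numFieldType.
Implicit Types (P Q : K -> Prop) (p : {poly K}).

(** Contains a nonempty open subset of the line: stable under intersection, and inhabited because
    the field is infinite. *)
Definition almost_all P := exists2 p, p != 0 & forall t, p.[t] != 0 -> P t.

Lemma poly_nonroot p : p != 0 -> exists t, p.[t] != 0.
Proof.
move=> p0; pose s : seq K := [seq i%:R | i <- iota 0 (size p)].
have us : uniq s.
  by rewrite map_inj_in_uniq ?iota_uniq // => i j _ _ /eqP; rewrite eqr_nat => /eqP.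
have : ~~ all (root p) s.
  by apply: contraL (leqnn (size p)) => /(max_poly_roots p0)/(_ us);
    rewrite size_map size_iota ltnn.
by case/allPn => t _; exists t.
Qed.

Lemma poly_zero p : (forall t, p.[t] = 0) -> p = 0.
Proof.
move=> p0; apply/eqP; apply: contraT => /poly_nonroot[t].
by rewrite p0 eqxx.
Qed.

Lemma almost_all_ex P : almost_all P -> exists t, P t.
Proof. by case=> p /poly_nonroot[t pt] Pp; exists t; exact: Pp. Qed.

Lemma almost_all_and P Q : almost_all P -> almost_all Q ->
  almost_all (fun t => P t /\ Q t).
Proof.
case=> p p0 Pp [q q0 Qq]; exists (p * q); first by rewrite mulf_neq0.
by move=> t; rewrite hornerM mulf_eq0 negb_or => /andP[/Pp ? /Qq].
Qed.

Lemma almost_all_sub P Q : (forall t, P t -> Q t) -> almost_all P -> almost_all Q.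
Proof. by move=> PQ [p p0 Pp]; exists p => // t /Pp /PQ. Qed.

Lemma almost_allT P : (forall t, P t) -> almost_all P.
Proof. by move=> PT; exists 1; rewrite ?oner_neq0. Qed.

Lemma almost_all_flip P : almost_all P -> almost_all (fun t => P (1 - t)).
Proof.
case=> p p0 Pp; exists (p \Po (1 - 'X)).
  rewrite -size_poly_eq0 size_comp_poly2 ?size_poly_eq0 //.
  by rewrite -opprB size_polyN -polyC1 size_XsubC.
by move=> t; rewrite horner_comp !hornerE => /Pp.
Qed.

End AlmostAll.

(** * Double points, linear subspaces and systems of conditions *)

Section Sections.
Variable R : comNzRingType.

Definition dbl d g (F : mon d g -> R) x := ev F x = 0 /\ forall v, D F x v = 0.

(** The derivative across the hyperplane x_(g-1) = 0 is left free: for x on the hyperplane this is a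
    double point of the restricted form. *)
Definition hdbl d g (F : mon d g -> R) x :=
  ev F x = 0 /\ forall v, v g.-1 = 0 -> D F x v = 0.

(* The monomial m involves one of the variables listed in B. *)
Definition meets (B : seq nat) d g (m : mon d g) : bool :=
  monval m (fun i => (i \notin B)%:R : int) == 0.

Lemma meets0 B g (m : mon 0 g) : meets B m = false.
Proof. by []. Qed.

Lemma meetsl B d g (m : mon d.+1 g) : meets B (monl m) = meets B m.
Proof. by []. Qed.

Lemma meetsr B d g (m : mon d g.+1) : meets B (monr m) = (g \in B) || meets B m.
Proof. by rewrite /meets monE mulf_eq0; case: (g \in B). Qed.

Lemma meets_monval B d g (m : mon d g) (x : nat -> R) :
  (forall j, j \in B -> x j = 0) -> meets B m -> monval m x = 0.
Proof.
move=> xB; elim/mon_ind: d g / m => [g m|d g m IH|d g m IH] //.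
rewrite meetsr !monE => /orP[/xB -> | /IH ->]; by rewrite ?mul0r ?mulr0.
Qed.

(** Membership in the ideal generated by the x_j with j in B, read off the coefficients; by
    [vanishes_ev] and [vanishesP] it amounts to vanishing on the subspace where these x_j are 0. *)
Definition vanishes B d g (F : mon d g -> R) := forall m, ~~ meets B m -> F m = 0.

Lemma vanishes_ev B d g (F : mon d g -> R) x :
  vanishes B F -> (forall j, j \in B -> x j = 0) -> ev F x = 0.
Proof.
move=> FB xB; apply: big1 => m _; have [mB|/FB ->] := boolP (meets B m).
  by rewrite (meets_monval xB) ?mulr0.
by rewrite mul0r.
Qed.

Lemma hdblP d g (F : mon d g -> R) x : (0 < g)%N ->
  hdbl F x <-> ev F x = 0 /\ forall j, (j < g.-1)%N -> D F x (unitv R j) = 0.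
Proof.
case: g F => // g F _.
split=> -[e h]; split=> //; first by move=> j jg; apply: h; rewrite /unitv /= gtn_eqF.
move=> v /= vg.
rewrite D_coord big_ord_recr /= vg mul0r addr0 big1 // => j _.
by rewrite h ?mulr0.
Qed.

Lemma dblP d g (F : mon d g -> R) x :
  dbl F x <-> ev F x = 0 /\ forall j, (j < g)%N -> D F x (unitv R j) = 0.
Proof.
split=> -[e h]; split=> // v.
by rewrite D_coord big1 // => j _; rewrite h ?mulr0.
Qed.

End Sections.

Lemma vanishesP (K : numFieldType) B d g (F : mon d g -> K) :
  (forall x, (forall j, j \in B -> x j = 0) -> ev F x = 0) -> vanishes B F.
Proof.
elim: d g F => [|d IHd] g F.
  move=> /(_ (fun=> 0))/(_ (fun _ _ => erefl)); rewrite /ev big_mon0 monE mulr1.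
  by move=> e [] _.
elim: g F => [F _ []|g IHg F FB]; apply: monP => m.
  rewrite meetsl => mB; apply: (IHg (fun m => F (monl m))) mB => x xB.
  pose y i := if i == g then 0 else x i.
  have /FB : forall j, j \in B -> y j = 0 by move=> j /xB; rewrite /y; case: eqP.
  rewrite evS /y eqxx mul0r addr0 => e; apply: etrans e.
  by apply: ev_ext => // i ig; rewrite ltn_eqF.
rewrite meetsr negb_or => /andP[gB mB].
apply: (IHd _ (fun m => F (monr m))) mB => x xB.
(* Only the product of x_g with the value of the second half of F is known to vanish. Shifting x_g
   by an indeterminate makes that factor a nonzero polynomial, which can be cancelled. *)
pose X i : {poly K} := (x i)%:P + (i == g)%:R *: 'X.
pose Fr m := (F (monr m))%:P.
have hX t : (horner_eval t \o X) =1 (fun i => x i + (i == g)%:R * t).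
  by move=> i; rewrite /= /X /horner_eval !hornerE.
have Fl0 t : (x g + t) * ev (fun m => F (monr m)) (fun i => x i + (i == g)%:R * t) = 0.
  have e1 : ev (fun m => F (monl m)) (fun i => x i + (i == g)%:R * t) = 0.
    rewrite (@ev_ext _ _ _ _ (fun m => F (monl m)) _ (fun i => if i == g then 0 else x i)) //.
      have /FB : forall j, j \in B -> (fun i => if i == g then 0 else x i) j = 0.
        by move=> j /xB; case: eqP.
      by rewrite evS eqxx mul0r addr0.
    by move=> i ig; rewrite ltn_eqF // mul0r addr0.
  have /FB : forall j, j \in B -> (fun i => x i + (i == g)%:R * t) j = 0.
    move=> j jB; rewrite xB //; case: eqP => [jg|]; last by rewrite mul0r addr0.
    by rewrite jg (negPf gB) in jB.
  by rewrite evS e1 add0r eqxx mul1r.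
have : (('X + (x g)%:P) * ev Fr X) = 0.
  apply: poly_zero => t; rewrite hornerM -[(ev _ _).[t]]/(horner_eval t _) ev_rmorph.
  rewrite !hornerE addrC -[RHS](Fl0 t); congr (_ * _); apply: ev_ext => [m'|i _].
    by rewrite /= /Fr /horner_eval hornerC.
  exact: hX.
move/eqP; rewrite mulf_eq0 -size_poly_eq0 size_XaddC /= => /eqP/(congr1 (horner_eval 0)).
rewrite ev_rmorph rmorph0 => e; apply: etrans e.
apply: ev_ext => [m'|i _]; first by rewrite /= /Fr /horner_eval hornerC.
by rewrite hX mulr0 addr0.
Qed.

Lemma ev_inj (K : numFieldType) d g (F : mon d g -> K) :
  (forall x, ev F x = 0) -> F =1 (fun=> 0).
Proof.
move=> F0 m; apply: (@vanishesP _ [::] _ _ F) => [x _|]; first exact: F0.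
elim/mon_ind: d g / m {F F0} => [g m|d g m IH|d g m IH] //.
by rewrite meetsr.
Qed.

Lemma all_flatten (A : Type) (p : pred A) (ss : seq (seq A)) :
  all p (flatten ss) = all (all p) ss.
Proof. by elim: ss => //= s ss IH; rewrite all_cat IH. Qed.

(** Conditions are attached to labels instead of points, so that the same system can be imposed on
    moving configurations. *)
Record sys (T : Type) := Sys
  { dbls : seq T; hdbls : seq T; smps : seq T; blks : seq (seq nat) }.

Section Systems.
Variable T : eqType.
Implicit Type S : sys T.

Definition sat (R : comNzRingType) S d g (c : T -> nat -> R) (F : mon d g -> R) :=
  [/\ {in dbls S, forall l, dbl F (c l)}, {in hdbls S, forall l, hdbl F (c l)},
      {in smps S, forall l, ev F (c l) = 0} & {in blks S, forall B, vanishes B F}].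

Definition evrow (R : comNzRingType) d g (x : nat -> R) (m : mon d g) := monval m x.
Definition drow (R : comNzRingType) d g (x : nat -> R) j (m : mon d g) :=
  dmon m x (unitv R j).
Definition crow (R : comNzRingType) d g (m0 m : mon d g) : R := (m == m0)%:R.

Definition rows (R : comNzRingType) S d g (c : T -> nat -> R) : seq (mon d g -> R) :=
  flatten [seq evrow (c l) :: [seq drow (c l) j | j <- iota 0 g] | l <- dbls S] ++
  flatten [seq evrow (c l) :: [seq drow (c l) j | j <- iota 0 g.-1] | l <- hdbls S] ++
  [seq evrow (c l) | l <- smps S] ++
  flatten [seq [seq crow R m | m <- enum (mon d g) & ~~ meets B m] | B <- blks S].

Lemma all_rows (R : comNzRingType) S d g (c : T -> nat -> R)
    (P : (mon d g -> R) -> bool) :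
  all P (rows S d g c) =
  [&& all (fun l => P (evrow (c l)) && all (fun j => P (drow (c l) j)) (iota 0 g)) (dbls S),
      all (fun l => P (evrow (c l)) && all (fun j => P (drow (c l) j)) (iota 0 g.-1)) (hdbls S),
      all (fun l => P (evrow (c l))) (smps S) &
      all (fun B => all (fun m => P (crow R m)) [seq m <- enum (mon d g) | ~~ meets B m]) (blks S)].
Proof.
rewrite !all_cat !all_flatten !all_map; congr [&& _, _, _ & _];
  by apply: eq_all => l /=; rewrite ?all_map.
Qed.

Lemma satP (R : comNzRingType) S d g (c : T -> nat -> R) (F : mon d g -> R) :
  (0 < g)%N -> sat S c F <-> all (fun r => \sum_m F m * r m == 0) (rows S d g c).
Proof.
move=> g0; rewrite all_rows; split.
  case=> hd hh hs hb; apply/and4P; split; apply/allP => l lS.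
  - have [e /= h] := (dblP _ _).1 (hd l lS); apply/andP; split; first exact/eqP.
    by apply/allP => j; rewrite mem_iota => /h/eqP.
  - have [e /= h] := (hdblP _ _ g0).1 (hh l lS); apply/andP; split; first exact/eqP.
    by apply/allP => j; rewrite mem_iota => /h/eqP.
  - exact/eqP/hs.
  - apply/allP => m; rewrite mem_filter => /andP[/(hb _ lS) Fm _].
    rewrite (bigD1 m) //= Fm mul0r add0r big1 // => m' /negPf mm.
    by rewrite /crow mm mulr0.
case/and4P => /allP hd /allP hh /allP hs /allP hb; split=> l lS.
- have /andP[/eqP e /allP h] := hd l lS; apply/dblP; split=> // j jg.
  by apply/eqP/h; rewrite mem_iota.
- have /andP[/eqP e /allP h] := hh l lS; apply/hdblP => //; split=> // j jg.
  by apply/eqP/h; rewrite mem_iota.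
- exact/eqP/hs.
- move=> m mB; have /allP/(_ m) := hb l lS; rewrite mem_filter mB mem_enum => /(_ isT)/eqP.
  rewrite (bigD1 m) //= /crow eqxx mulr1 big1 ?addr0 // => m' /negPf ->.
  by rewrite mulr0.
Qed.

Variable K : numFieldType.

Definition nondeg S d g (c : T -> nat -> K) :=
  forall F : mon d g -> K, sat S c F -> F =1 (fun=> 0).

Lemma sat_limit S d g (C : T -> nat -> {poly K}) : (0 < g)%N ->
  almost_all (fun t => nondeg S d g (fun l i => (C l i).[t])) \/
  (exists2 F : mon d g -> {poly K}, (exists m, (F m).[0] != 0) & sat S C F).
Proof.
move=> g0; case: (limit_dichotomy (@rows _ S d g C)) => [[p p0 pt]|[F F0 FC]]; last first.
  by right; exists F => //; apply/satP.
left; exists p => // t /pt h F /satP -/(_ g0); rewrite -/(is_true _) => FS; apply: h.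
move: FS; rewrite !all_rows.
have e1 l (m : mon d g) : evrow (fun i => (C l i).[t]) m = (evrow (C l) m).[t].
  by rewrite /evrow -[RHS]/(horner_eval t _) monval_rmorph; exact: monval_ext.
have e2 l j (m : mon d g) : drow (fun i => (C l i).[t]) j m = (drow (C l) j m).[t].
  rewrite /drow -[RHS]/(horner_eval t _) dmon_rmorph; apply: dmon_ext => // i _.
  by rewrite /= /unitv rmorph_nat.
have e3 (m0 m : mon d g) : crow K m0 m = (crow _ m0 m).[t].
  by rewrite /crow -[RHS]/(horner_eval t _) rmorph_nat.
have E1 l F' : \sum_(m : mon d g) F' m * (evrow (C l) m).[t] =
               \sum_m F' m * evrow (fun i => (C l i).[t]) m.
  by apply: eq_bigr => m _; rewrite e1.
have E2 l j F' : \sum_(m : mon d g) F' m * (drow (C l) j m).[t] =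
               \sum_m F' m * drow (fun i => (C l i).[t]) j m.
  by apply: eq_bigr => m _; rewrite e2.
have E3 m0 F' : \sum_(m : mon d g) F' m * (crow _ m0 m).[t] =
               \sum_m F' m * crow K m0 m.
  by apply: eq_bigr => m _; rewrite e3.
case/and4P=> h1 h2 h3 h4; apply/and4P; split.
- by apply: sub_all h1 => l; rewrite E1 => /andP[-> h]; apply: sub_all h => j; rewrite E2.
- by apply: sub_all h2 => l; rewrite E1 => /andP[-> h]; apply: sub_all h => j; rewrite E2.
- by apply: sub_all h3 => l; rewrite E1.
- by apply: sub_all h4 => l h; apply: sub_all h => m; rewrite E3.
Qed.

Definition line (c0 c1 : T -> nat -> K) t : T -> nat -> K :=
  fun l i => c0 l i + t * (c1 l i - c0 l i).

Lemma nondeg_ext S d g (c c' : T -> nat -> K) :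
  (forall l i, c l i = c' l i) -> nondeg S d g c -> nondeg S d g c'.
Proof.
move=> cc h F [hd hh hs hb]; apply: h; split=> // l lS.
- have [e1 e2] := hd l lS; split=> [|v]; last rewrite -[RHS](e2 v).
    by rewrite -[RHS]e1; apply: ev_ext.
  exact: D_ext.
- have [e1 e2] := hh l lS; split=> [|v vg]; last rewrite -[RHS](e2 v vg).
    by rewrite -[RHS]e1; apply: ev_ext.
  exact: D_ext.
- by rewrite -[RHS](hs l lS); apply: ev_ext.
Qed.

(** Otherwise [sat_limit] gives a solution over K[X] that is nonzero at X = 0, where it solves the
    system at [c0]. *)
Lemma nondeg_line S d g c0 c1 : (0 < g)%N -> nondeg S d g c0 ->
  almost_all (fun t => nondeg S d g (line c0 c1 t)).
Proof.
move=> g0 h0; pose C l i := (c0 l i)%:P + (c1 l i - c0 l i) *: 'X.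
have CE t l i : (C l i).[t] = line c0 c1 t l i by rewrite /C /line !hornerE mulrC.
have [|[F [m Fm] FS]] := sat_limit S d C g0.
  by apply: almost_all_sub => t; apply: nondeg_ext => l i; exact: CE.
case/eqP: Fm; apply: (h0 (fun m => (F m).[0])).
have hC l i : (horner_eval 0 \o C l) i = c0 l i.
  by rewrite /= -[LHS]/((C l i).[0]) CE /line mul0r addr0.
have ev0 l : ev (fun m => (F m).[0]) (c0 l) = (ev F (C l)).[0].
  by rewrite -[RHS]/(horner_eval 0 _) ev_rmorph; apply: ev_ext => // i _; rewrite hC.
have D0 l v : D (fun m => (F m).[0]) (c0 l) v = (D F (C l) (fun i => (v i)%:P)).[0].
  rewrite -[RHS]/(horner_eval 0 _) D_rmorph; apply: D_ext => // i _; rewrite ?hC //.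
  by rewrite /= /horner_eval hornerC.
case: FS => hd hh hs hb; split.
- by move=> l /hd[e1 e2]; split=> [|v]; rewrite (ev0, D0) (e1, e2) horner0.
- move=> l /hh[e1 e2]; split=> [|v vg]; first by rewrite ev0 e1 horner0.
  by rewrite D0 e2 ?horner0 // vg.
- by move=> l /hs e; rewrite ev0 e horner0.
- by move=> B /hb h m' /h ->; rewrite horner0.
Qed.

Lemma line_flip c0 c1 t l i : line c0 c1 (1 - t) l i = line c1 c0 t l i.
Proof. by rewrite /line; ring. Qed.

Lemma nondeg_line1 S d g c0 c1 : (0 < g)%N -> nondeg S d g c1 ->
  almost_all (fun t => nondeg S d g (line c0 c1 t)).
Proof.
move=> g0 h1; apply: almost_all_sub (almost_all_flip (nondeg_line c0 g0 h1)) => t.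
by apply: nondeg_ext => l i; rewrite -line_flip; congr (line _ _ _ _ _); ring.
Qed.

End Systems.

(** * Double points *)

Section Cut.
Variables (K : numFieldType) (I : finType).
Implicit Types (f h : I -> K) (phi : (I -> K) -> K) (W : (I -> K) -> Prop).

(** Linearity, tested on the one combination that the exchange argument uses. *)
Definition functional phi :=
  forall f h a, phi (fun i => f i - a * h i) = phi f - a * phi h.

Definition subspace W := forall f h a, W f -> W h -> W (fun i => f i - a * h i).

Variables (P : Type) (rho : P -> (I -> K) -> K) (Y : P -> Prop).
Hypothesis rhoL : forall p, functional (rho p).

(* Steinitz exchange: if the last k functionals of k + 1 do not suffice, they cut W
   down to a line, which some point of Y separates from 0. *)
Lemma cut1 W (phi : nat -> (I -> K) -> K) k (p0 : P) : Y p0 -> subspace W ->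
  (forall i, functional (phi i)) ->
  (forall f, W f -> (forall p, Y p -> rho p f = 0) -> f =1 (fun=> 0)) ->
  (forall f, W f -> (forall i, (i < k)%N -> phi i f = 0) -> f =1 (fun=> 0)) ->
  exists2 p, Y p & forall f, W f -> rho p f = 0 ->
    (forall i, (i < k.-1)%N -> phi i.+1 f = 0) -> f =1 (fun=> 0).
Proof.
move=> Yp0 WL phiL sep; case: k => [|k] kill.
  by exists p0 => // f Wf _ _; apply: kill.
have [tl|/boolp.existsNP[f0 /boolp.not_implyP[Wf0 /boolp.not_implyP[f0k f0N0]]]] :=
  boolp.pselect (forall f, W f -> (forall i, (i < k)%N -> phi i.+1 f = 0) -> f =1 (fun=> 0)).
  by exists p0 => // f Wf _; apply: tl.
have phi00 : phi 0%N f0 != 0.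
  apply/eqP => f00; apply: f0N0; apply: kill => // -[|i] //.
  by rewrite ltnS => /f0k.
have [p Yp /eqP rp] : exists2 p, Y p & rho p f0 <> 0.
  apply: boolp.contrapT => /boolp.forall2NP H; apply: f0N0; apply: sep => // p Yp.
  by case: (H p) => [//|/boolp.contrapT].
exists p => // f Wf rf fk.
pose a := phi 0%N f / phi 0%N f0.
have f_eq : (fun i => f i - a * f0 i) =1 (fun=> 0).
  apply: kill; first exact: WL.
  case=> [_|i]; first by rewrite phiL /a divfK ?subrr.
  by rewrite ltnS => ik; rewrite phiL fk ?f0k // mulr0 subrr.
have rz : rho p (fun i => f i - a * f0 i) = 0.
  have -> : (fun i => f i - a * f0 i) = (fun i => f i - 1 * f i).
    by apply/boolp.funext => i; rewrite f_eq mul1r subrr.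
  by rewrite rhoL mul1r subrr.
have a0 : a = 0.
  by move/eqP: rz; rewrite rhoL rf sub0r oppr_eq0 mulf_eq0 (negPf rp) orbF => /eqP.
by move=> i; have := f_eq i; rewrite a0 mul0r subr0.
Qed.

(** The first [r1] functionals are exchanged one by one for evaluations at points of Y; after each
    application of [cut1] the space W is cut down by the point just found. *)
Lemma cut W (phi : nat -> (I -> K) -> K) r1 r2 (p0 : P) : Y p0 -> subspace W ->
  (forall i, functional (phi i)) ->
  (forall f, W f -> (forall p, Y p -> rho p f = 0) -> f =1 (fun=> 0)) ->
  (forall f, W f -> (forall i, (i < r1 + r2)%N -> phi i f = 0) -> f =1 (fun=> 0)) ->
  exists2 ps : nat -> P, (forall i, Y (ps i)) &
    forall f, W f -> (forall i, (i < r1)%N -> rho (ps i) f = 0) ->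
    (forall i, (i < r2)%N -> phi (r1 + i)%N f = 0) -> f =1 (fun=> 0).
Proof.
move=> Yp0; elim: r1 W phi => [|r1 IH] W phi WL phiL sep kill.
  by exists (fun=> p0) => // f Wf _ fk; apply: kill.
have [p Yp pk] := cut1 Yp0 WL phiL sep kill.
have [|//|||ps Yps psk] := IH (fun f => W f /\ rho p f = 0) (fun i => phi i.+1).
- by move=> f h a [Wf rf] [Wh rh]; split; [exact: WL | rewrite rhoL rf rh mulr0 subrr].
- by move=> f [Wf _]; apply: sep.
- by move=> f [Wf rf] fk; apply: pk => // i ik; apply: fk.
exists (fun i => if i is i'.+1 then ps i' else p); first by case.
move=> f Wf fps fk; apply: psk.
- by split=> //; exact: (fps 0%N).
- by move=> i ir; apply: (fps i.+1).
- by move=> i ir; rewrite -addSn; apply: fk.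
Qed.

End Cut.

Section Good.
Variable K : numFieldType.
Implicit Types (c p q : nat -> nat -> K).

Lemma functional_ev d g (x : nat -> K) : functional (fun F : mon d g -> K => ev F x).
Proof.
move=> f h a; rewrite /ev mulr_sumr -sumrB; apply: eq_bigr => m _.
by rewrite mulrBl mulrA.
Qed.

Lemma functional_D d g (x v : nat -> K) : functional (fun F : mon d g -> K => D F x v).
Proof.
move=> f h a; rewrite /D mulr_sumr -sumrB; apply: eq_bigr => m _.
by rewrite mulrBl mulrA.
Qed.

Lemma subspace_sat (T : eqType) (S : sys T) d g (c : T -> nat -> K) :
  subspace (fun F : mon d g -> K => sat S c F).
Proof.
move=> f h a [fd fh fs fb] [hd hh hs hb]; split=> l lS.
- have [e1 e2] := fd l lS; have [e3 e4] := hd l lS.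
  by split=> [|v]; rewrite (functional_ev, functional_D) ?(e1, e3) ?(e2, e4) mulr0 subrr.
- have [e1 e2] := fh l lS; have [e3 e4] := hh l lS.
  by split=> [|v vg]; rewrite (functional_ev, functional_D) ?(e1, e3) ?(e2, e4) // mulr0 subrr.
- by rewrite functional_ev (fs l lS) (hs l lS) mulr0 subrr.
- by move=> m mB; rewrite (fb l lS m mB) (hb l lS m mB) mulr0 subrr.
Qed.

(** A label is a pair of a family number and an index, so that points playing different roles share
    one configuration. *)
Definition fam (f k : nat) : seq (nat * nat) := [seq (f, i) | i <- iota 0 k].

Lemma famP f k (P : nat * nat -> Prop) :
  {in fam f k, forall l, P l} <-> forall i, (i < k)%N -> P (f, i).
Proof.
split=> [h i ik|h l].
  by apply/h/map_f; rewrite mem_iota.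
by move/mapP=> [j]; rewrite mem_iota => jk ->; exact: h.
Qed.

Lemma in_catP (T : eqType) (s1 s2 : seq T) (P : T -> Prop) :
  {in s1 ++ s2, forall l, P l} <-> {in s1, forall l, P l} /\ {in s2, forall l, P l}.
Proof.
split=> [h|[h1 h2] l].
  by split=> l ls; apply: h; rewrite mem_cat ls ?orbT.
by rewrite mem_cat => /orP[/h1|/h2].
Qed.

(* By semicontinuity, one such configuration of k double points and s simple points
   makes the general one nondegenerate too. *)
Definition good d g k s := exists p q, forall F : mon d g -> K,
  (forall i, (i < k)%N -> dbl F (p i)) -> (forall i, (i < s)%N -> ev F (q i) = 0) ->
  F =1 (fun=> 0).

Lemma good_le d g k s k' s' : (k <= k')%N -> (s <= s')%N -> good d g k s -> good d g k' s'.
Proof.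
move=> kk ss [p [q h]]; exists p, q => F hd hs; apply: h => i ik.
  by apply: hd; apply: leq_trans kk.
by apply: hs; apply: leq_trans ss.
Qed.

(** By Euler's formula the g partial derivatives at a double point already imply the vanishing
    there. These g functionals are exchanged for g evaluations by [cut]. *)
Lemma good_swap d g k s : (0 < d)%N -> good d g k.+1 s -> good d g k (g + s).
Proof.
move=> d0 [p [q h]].
pose W (F : mon d g -> K) :=
  (forall i, (i < k)%N -> dbl F (p i)) /\ (forall i, (i < s)%N -> ev F (q i) = 0).
have WL : subspace W.
  move=> f f' a [fd fs] [fd' fs']; split=> i ik.
    have [e1 e2] := fd i ik; have [e3 e4] := fd' i ik.
    by split=> [|v]; rewrite (functional_ev, functional_D) ?(e1, e3) ?(e2, e4) mulr0 subrr.
  by rewrite functional_ev fs // fs' // mulr0 subrr.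
have [|||q' _ hq'] := @cut K _ (nat -> K) (fun x (F : mon d g -> K) => ev F x) (fun=> True)
  (functional_ev (d:=d) (g:=g)) W (fun j F => D F (p k) (unitv K j)) g 0 (fun=> 0) I WL.
- by move=> i; exact: functional_D.
- by move=> f _ f0; apply: ev_inj => x; apply: f0.
- move=> F [Fd Fs]; rewrite addn0 => Fk; apply: h => // i.
  rewrite ltnS leq_eqVlt => /predU1P[->|]; last exact: Fd.
  have D0 v : D F (p k) v = 0.
    by rewrite D_coord big1 // => j _; rewrite Fk ?mulr0.
  split=> //; have /eqP := D_euler F (p k).
  by rewrite D0 eq_sym mulf_eq0 pnatr_eq0 eqn0Ngt d0 /= => /eqP.
exists p, (fun i => if (i < g)%N then q' i else q (i - g)%N) => F Fd Fs.
apply: hq' => //.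
  split=> // i si; have := Fs (g + i)%N; rewrite ltn_add2l [(g + i < g)%N]ltnNge leq_addr /= addKn.
  exact.
by move=> i ig; have := Fs i; rewrite ig; apply; rewrite ltn_addr.
Qed.

Lemma good_swapn d g k j s : (0 < d)%N -> good d g (j + k) s -> good d g k (j * g + s).
Proof.
move=> d0; elim: j s => // j IH s; rewrite addSn => /(good_swap d0)/IH.
by have -> : (j * g + (g + s) = j.+1 * g + s)%N by rewrite mulSn; lia.
Qed.

End Good.

(** * Elimination modulo 101 *)

Section Enumeration.

Fixpoint enum_mon (d : nat) : forall g, seq (mon d g) :=
  if d is d'.+1 return forall g, seq (mon d g) then
    fix enumd (g : nat) : seq (mon d'.+1 g) :=
      if g is g'.+1 return seq (mon d'.+1 g) then
        [seq monl m | m <- enumd g'] ++ [seq monr m | m <- enum_mon d' g'.+1]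
      else [::]
  else fun g => [:: (tt : mon 0 g)].

Arguments enum_mon : simpl never.

Lemma enum_monS d g : enum_mon d.+1 g.+1 =
  [seq monl m | m <- enum_mon d.+1 g] ++ [seq monr m | m <- enum_mon d g.+1].
Proof. by []. Qed.

Lemma mem_enum_mon d g (m : mon d g) : m \in enum_mon d g.
Proof.
elim/mon_ind: d g / m => [g []|d g m IH|d g m IH] //;
  by rewrite enum_monS mem_cat map_f ?orbT.
Qed.

Lemma big_enum_mon (V : nmodType) d g (f : mon d g -> V) :
  \sum_(m <- enum_mon d g) f m = \sum_m f m.
Proof.
elim: d g f => [|d IHd] g f; first by rewrite big_seq1 big_mon0.
elim: g f => [|g IHg] f; first by rewrite big_nil big1 // => -[].
by rewrite enum_monS big_cat !big_map IHg IHd big_mon.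
Qed.

End Enumeration.

Section Elimination.

Definition nbr (R : comNzRingType) (a : N) : R := (N.to_nat a)%:R.

Lemma nbrD R a b : nbr R (a + b) = nbr R a + nbr R b.
Proof. by rewrite /nbr N2Nat.inj_add natrD. Qed.

Lemma nbrM R a b : nbr R (a * b) = nbr R a * nbr R b.
Proof. by rewrite /nbr N2Nat.inj_mul natrM. Qed.

Fixpoint dot (R : comNzRingType) (v : seq R) (r : seq N) : R :=
  match v, r with
  | x :: v', a :: r' => x * nbr R a + dot v' r'
  | _, _ => 0
  end.

Variables (p : nat) (pN q : N).

Definition reduce (a : N) (r : seq N) (b : N) (s : seq N) : seq N :=
  if b is N0 then s else
  let c := N.modulo (q * b) pN in
  [seq N.modulo (a * xy.1 + c * xy.2) pN | xy <- zip s r].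

Fixpoint pivot (pre rows : seq (seq N)) : option (N * seq N * seq (seq N)) :=
  match rows with
  | [::] => None
  | [::] :: _ => None
  | (a :: r) :: rows' => if (p %| N.to_nat (N.modulo a pN))%N then pivot ((a :: r) :: pre) rows'
                         else Some (a, r, catrev pre rows')
  end.

(* Fraction-free elimination modulo p = pN, with q = p - 1 standing for -1. *)
Fixpoint eliminate (n : nat) (rows : seq (seq N)) : bool :=
  if n is n'.+1 then
    if pivot [::] rows is Some (a, r, rows') then
      eliminate n' [seq reduce a r (head 0%num s) (behead s) | s <- rows']
    else false
  else true.

Hypothesis (p_pr : prime p) (pNE : N.to_nat pN = p) (qE : (N.to_nat q).+1 = p).

Lemma nbr_p : nbr 'F_p pN = 0.
Proof. by rewrite /nbr pNE pchar_Fp_0. Qed.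

Lemma nbr_q : nbr 'F_p q = -1.
Proof.
apply/eqP; rewrite -subr_eq0 opprK; apply/eqP.
by rewrite /nbr natr1 qE pchar_Fp_0.
Qed.

Lemma nbr_mod a : nbr 'F_p (N.modulo a pN) = nbr 'F_p a.
Proof.
have pN0 : pN <> 0%num by move=> e; move: p_pr; rewrite -pNE e.
by rewrite [in RHS](N.div_mod a pN pN0) nbrD nbrM nbr_p mul0r add0r.
Qed.

Lemma dot_reduce (v : seq 'F_p) x a r b s : size r = size s ->
  x * nbr _ a + dot v r = 0 -> x * nbr _ b + dot v s = 0 -> dot v (reduce a r b s) = 0.
Proof.
case: b => [|b] rs er es; first by move: es; rewrite mulr0 add0r.
suff -> : dot v (reduce a r (Npos b) s) = nbr _ a * dot v s - nbr _ (Npos b) * dot v r.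
  have -> : nbr 'F_p a * dot v s - nbr _ (Npos b) * dot v r =
    nbr _ a * (x * nbr _ (Npos b) + dot v s) - nbr _ (Npos b) * (x * nbr _ a + dot v r).
    by ring.
  by rewrite er es !mulr0 subrr.
rewrite /reduce; move: (Npos b) rs => {er es} c.
elim: s r v => [|y s IH] [|z r] [|w v] //= => [_|_|_|[rs]];
  rewrite ?mulr0 ?subrr // IH // nbr_mod nbrD !nbrM nbr_mod nbrM nbr_q.
by ring.
Qed.

Lemma pivotP pre rows a r rows' : pivot pre rows = Some (a, r, rows') ->
  ~~ (p %| N.to_nat (N.modulo a pN))%N /\
  forall Q : seq N -> bool, all Q pre -> all Q rows -> Q (a :: r) && all Q rows'.
Proof.
elim: rows pre => //= -[//|b s] rows IH pre; case: ifP => [_|/negbT nb].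
  by move/IH=> [na h]; split=> // Q Qpre /andP[Qb]; apply: h; rewrite /= Qb.
case=> <- <- <-; split=> // Q Qpre /andP[-> Qr].
by rewrite catrevE all_cat all_rev Qpre.
Qed.

Lemma eliminateP n rows (v : seq 'F_p) : size v = n ->
  all (fun r => size r == n) rows -> eliminate n rows ->
  all (fun r => dot v r == 0) rows -> all (fun x => x == 0) v.
Proof.
elim: n rows v => [|n IH] rows v; first by case: v.
case: v => // x v [sv] szr /=; case E : pivot => [[[a r] rows']|//] el dr.
have [na /(_ _ isT) h] := pivotP E.
have /andP[sa sr] := h _ szr; have /andP[da drr] := h _ dr.
have v0 : all (fun x => x == 0) v.
  apply: IH el _ => //.
    rewrite all_map; apply: sub_all sr => s /= /eqP ss.
    by case: (head _ _) => [|b]; rewrite /reduce ?size_map ?size_zip size_behead ss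
      ?(eqP (sa : size r == n)) ?minnn.
  rewrite all_map; apply/allP => s sin /=.
  have /eqP ss := allP sr s sin; have ds := allP drr s sin.
  case: s ss ds {sin} => // b s /= [ss] /eqP ds.
  by apply/eqP; apply: (dot_reduce _ (eqP da) ds); rewrite ss; apply/eqP.
rewrite v0 andbT.
have dv0 : dot v r = 0.
  by elim: (v) (r) v0 => [|y w IHw] [|b s] //= /andP[/eqP -> /IHw ->]; rewrite mul0r addr0.
move: da => /=; rewrite dv0 addr0 mulf_eq0 => /orP[//|].
by rewrite -nbr_mod /nbr -(dvdn_pcharf (pchar_Fp p_pr)) (negPf na).
Qed.

Lemma dotE (R : comNzRingType) n (v : seq R) r : size v = n -> size r = n ->
  dot v r = \sum_(i < n) v`_i * nbr R (nth 0%num r i).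
Proof.
elim: n v r => [|n IH] [|x v] [|a r] //=; first by rewrite big_ord0.
by move=> [sv] [sr]; rewrite big_ord_recl /= (IH v r).
Qed.

(* A left inverse modulo p of an integer matrix lifts to an integer matrix whose
   product with it has determinant prime to p, hence nonzero. *)
Lemma eliminate_char0 (K : numFieldType) n rows (v : seq K) : size v = n ->
  all (fun r => size r == n) rows -> eliminate n rows ->
  all (fun r => dot v r == 0) rows -> all (fun x => x == 0) v.
Proof.
move=> sv szr el dr.
pose A : 'M[int]_(size rows, n) :=
  \matrix_(i, j) nbr int (nth 0%num (nth [::] rows i) j).
have szi (i : 'I_(size rows)) : size (nth [::] rows i) = n.
  by apply/eqP/(all_nthP [::] szr)/ltn_ord.
pose toF : {rmorphism int -> 'F_p} := intr.
have : row_full (map_mx toF A).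
  rewrite -cokermx_eq0; apply/eqP/matrixP => i j; rewrite [RHS]mxE.
  pose w := [seq cokermx (map_mx toF A) k j | k <- enum 'I_n].
  have sw : size w = n by rewrite size_map size_enum_ord.
  have wE (k : 'I_n) : w`_k = cokermx (map_mx toF A) k j.
    by rewrite (nth_map k) ?size_enum_ord // nth_ord_enum.
  rewrite -wE; have /(all_nthP 0)/(_ i) : all (fun x => x == 0) w.
    apply: (eliminateP sw szr el); apply/(all_nthP [::]) => k kr.
    rewrite (dotE sw (szi (Ordinal kr))).
    have /matrixP/(_ (Ordinal kr) j) := mulmx_coker (map_mx toF A).
    rewrite mxE [RHS]mxE => E; apply/eqP; apply: etrans E; apply: eq_bigr => l _.
    by rewrite wE [map_mx _ _ _ _]mxE [A _ _]mxE mulrC /nbr /= rmorph_nat.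
  by rewrite sw => /(_ (ltn_ord i))/eqP.
case/row_fullP=> B BA; pose B' := \matrix_(i, j) (nat_of_ord (B i j))%:Z.
have detN0 : \det (B' *m A) != 0.
  apply: contraTneq (oner_neq0 'F_p) => d0; rewrite negbK -(det1 _ n) -BA.
  have -> : B = map_mx toF B'.
    apply/matrixP => i j; rewrite !mxE /=.
    by rewrite -[LHS]natr_Zp.
  by rewrite -map_mxM det_map_mx d0 rmorph0.
pose toK : {rmorphism int -> K} := intr.
have unitBA : map_mx toK (B' *m A) \in unitmx.
  by rewrite unitmxE det_map_mx unitfE /= intr_eq0.
have Av0 : map_mx toK A *m (\col_i v`_i) = 0.
  apply/matrixP => i j; rewrite mxE [RHS]mxE.
  have /eqP := all_nthP [::] dr i (ltn_ord i); rewrite (dotE sv (szi i)) => E.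
  apply: etrans E; apply: eq_bigr => k _.
  by rewrite !mxE mulrC /nbr /= rmorph_nat.
have v0 : \col_(i < n) v`_i = 0.
  apply: (can_inj (mulKmx unitBA)); rewrite mulmx0 map_mxM -mulmxA.
  by rewrite Av0 mulmx0.
apply/(all_nthP 0) => i iv; rewrite sv in iv.
by have /matrixP/(_ (Ordinal iv) 0) := v0; rewrite !mxE => ->.
Qed.

End Elimination.

Section Check.

(** The rows of values and of partial derivatives of the monomials, computed with binary numbers in
    the order of [enum_mon], so that the elimination runs under [vm_compute]. *)
Fixpoint vrow (d : nat) : nat -> (nat -> N) -> seq N :=
  if d is d'.+1 then
    fix vrowd (g : nat) (x : nat -> N) : seq N :=
      if g is g'.+1 then vrowd g' x ++ [seq (x g' * a)%num | a <- vrow d' g'.+1 x]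
      else [::]
  else fun _ _ => [:: 1%num].

Fixpoint dvrow (d : nat) : nat -> (nat -> N) -> nat -> seq N :=
  if d is d'.+1 then
    fix dvrowd (g : nat) (x : nat -> N) (j : nat) : seq N :=
      if g is g'.+1 then dvrowd g' x j ++
        [seq (if g' == j then ab.1 + x g' * ab.2 else x g' * ab.2)%num
           | ab <- zip (vrow d' g'.+1 x) (dvrow d' g'.+1 x j)]
      else [::]
  else fun _ _ _ => [:: 0%num].

Fixpoint mrow (B : seq nat) (d : nat) : nat -> seq bool :=
  if d is d'.+1 then
    fix mrowd (g : nat) : seq bool :=
      if g is g'.+1 then mrowd g' ++ [seq (g' \in B) || b | b <- mrow B d' g'.+1]
      else [::]
  else fun _ => [:: false].

Arguments vrow : simpl never.
Arguments dvrow : simpl never.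
Arguments mrow : simpl never.

Lemma mrowE B d g : mrow B d g = [seq meets B m | m <- enum_mon d g].
Proof.
elim: d g => [|d IHd] //; elim=> // g IHg.
rewrite enum_monS map_cat -!map_comp.
rewrite -[LHS]/(mrow B d.+1 g ++ [seq (g \in B) || b | b <- mrow B d g.+1]).
rewrite IHg IHd -map_comp; congr (_ ++ _).
by apply: eq_map => m /=; rewrite meetsr.
Qed.

Lemma vrowE (R : comNzRingType) d g x :
  [seq nbr R a | a <- vrow d g x] =
  [seq monval m (fun i => nbr R (x i)) | m <- enum_mon d g].
Proof.
elim: d g => [|d IHd] //; elim=> // g IHg.
rewrite enum_monS map_cat -!map_comp.
rewrite -[vrow _ _ _]/(vrow d.+1 g x ++ [seq (x g * a)%num | a <- vrow d g.+1 x]).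
rewrite map_cat IHg; congr (_ ++ _).
transitivity [seq nbr R (x g) * a | a <- [seq nbr R a | a <- vrow d g.+1 x]].
  by rewrite -!map_comp; apply: eq_map => a /=; rewrite nbrM.
by rewrite IHd -map_comp; apply: eq_map.
Qed.

Lemma dvrowE (R : comNzRingType) d g x j :
  [seq nbr R a | a <- dvrow d g x j] =
  [seq dmon m (fun i => nbr R (x i)) (unitv R j) | m <- enum_mon d g].
Proof.
elim: d g => [|d IHd] //; elim=> // g IHg.
rewrite enum_monS map_cat -!map_comp.
rewrite -[dvrow _ _ _ _]/(dvrow d.+1 g x j ++
  [seq (if g == j then ab.1 + x g * ab.2 else x g * ab.2)%num
     | ab <- zip (vrow d g.+1 x) (dvrow d g.+1 x j)]).
rewrite map_cat IHg; congr (_ ++ _).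
have := IHd g.+1; have := vrowE R d g.+1 x; rewrite -map_comp.
elim: (enum_mon d g.+1) (vrow _ _ _) (dvrow _ _ _ _) => [|m e IH] [|a s] [|b t] //=.
move=> [am sm] [bm tm]; rewrite (IH _ _ sm tm); congr (_ :: _).
rewrite -am -bm /unitv; case: (g == j).
  by rewrite nbrD nbrM mul1r.
by rewrite nbrM mul0r add0r.
Qed.

Lemma dot_enum_mon (R : comNzRingType) d g (F h : mon d g -> R) r :
  [seq nbr R a | a <- r] = [seq h m | m <- enum_mon d g] ->
  dot [seq F m | m <- enum_mon d g] r = \sum_m F m * h m.
Proof.
rewrite -big_enum_mon; elim: (enum_mon d g) r => [|m e IH] [|a r] //=.
  by rewrite big_nil.
by move=> [am rm]; rewrite big_cons (IH _ rm) am.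
Qed.

Definition unit_rows (B : seq nat) d g : seq (seq N) :=
  let bs := mrow B d g in let n := size bs in
  [seq mkseq (fun k => if k == i then 1%num else 0%num) n | i <- iota 0 n & ~~ nth true bs i].

Definition check_rows d g (dp sp : seq (seq N)) (Bs : seq (seq nat)) :=
  flatten [seq [seq dvrow d g (nth 0%num x) j | j <- iota 0 g] | x <- dp] ++
  [seq vrow d g (nth 0%num x) | x <- sp] ++ flatten [seq unit_rows B d g | B <- Bs].

Definition check d g dp sp Bs :=
  eliminate 101 101 100 (size (mrow [::] d g)) (check_rows d g dp sp Bs).

Definition npt (K : numFieldType) (x : seq N) : nat -> K := fun i => nbr K (nth 0%num x i).

Lemma checkP (K : numFieldType) d g dp sp Bs : check d g dp sp Bs ->
  forall F : mon d g -> K, {in dp, forall x v, D F (npt K x) v = 0} ->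
    {in sp, forall x, ev F (npt K x) = 0} -> {in Bs, forall B, vanishes B F} ->
  F =1 (fun=> 0).
Proof.
move=> el F Fd Fs FB m.
have sz : size (mrow [::] d g) = size (enum_mon d g) by rewrite mrowE size_map.
have p101 : prime 101 by [].
have szv x : size (vrow d g x) = size (enum_mon d g).
  by have /(congr1 size) := vrowE K d g x; rewrite !size_map.
have szd x j : size (dvrow d g x j) = size (enum_mon d g).
  by have /(congr1 size) := dvrowE K d g x j; rewrite !size_map.
have := @eliminate_char0 101 101 100 p101 erefl erefl K _ _ [seq F m | m <- enum_mon d g] _ _ el _.
rewrite size_map sz => /(_ erefl) h.
suff /allP/(_ (F m)) : all (fun x => x == 0) [seq F m | m <- enum_mon d g].
  by rewrite map_f ?mem_enum_mon // => /(_ isT)/eqP.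
apply: h; rewrite !all_cat !all_flatten !all_map; apply/and3P; split; apply/allP => x xin /=.
- by rewrite all_map; apply/allP => j _ /=; rewrite szd.
- by rewrite szv.
- by rewrite all_map; apply/allP => j _ /=; rewrite size_mkseq mrowE size_map.
- rewrite all_map; apply/allP => j _ /=.
  by rewrite (dot_enum_mon _ (dvrowE _ _ _ _ _)) -[X in X == _]/(D F (npt K x) _) Fd.
- by rewrite (dot_enum_mon _ (vrowE _ _ _ _)) -[X in X == _]/(ev F (npt K x)) Fs.
rewrite all_map; apply/allP => i; rewrite mem_filter mem_iota mrowE size_map /= => /andP[mi ie].
have m0 : mon d g by exact: m.
rewrite (@dotE _ (size (enum_mon d g))) ?size_map ?size_iota //.
rewrite (bigD1 (Ordinal ie)) //= big1 => [|k ki].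
  rewrite nth_mkseq // eqxx /nbr mulr1 addr0 (nth_map m0) // (FB _ xin) //.
  by move: mi; rewrite (nth_map m0).
by rewrite nth_mkseq // ifN // /nbr mulr0.
Qed.

End Check.

Section Points.

(** A linear congruential generator with the classical constants of the C function [rand]; dividing
    by 2 ^ 16 discards the low bits, whose periods are short. The points need no property beyond
    passing the checks. *)
Fixpoint lcg (n : nat) (s : N) : seq N :=
  if n is n'.+1 then
    N.modulo (N.div s 65536) 101 :: lcg n' (N.modulo (s * 1103515245 + 12345) 2147483648)
  else [::].

Definition pts (seed : N) (k g : nat) (B : seq nat) : seq (seq N) :=
  let s := lcg (k * g) seed in
  mkseq (fun i => mkseq (fun j => if j \in B then 0%num else nth 0%num s (i * g + j)) g) k.

End Points.

Definition coord_pts (g : nat) : seq (seq N) :=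
  mkseq (fun i => mkseq (fun j => if j == i then 1%num else 0%num) g) g.

(** The coordinates that vanish on one of the subspaces of codimension 3. The blocks of L, M and N
    are disjoint, which puts the three subspaces in general position. *)
Definition block (b : nat) : seq nat := [:: b; b.+1; b.+2].
Notation blockL := (block 0).
Notation blockM := (block 3).
Notation blockN := (block 6).

(** * The differential Horace method *)

Section Horace.
Variable K : numFieldType.

Lemma almost_all_forall n (P : nat -> K -> Prop) :
  (forall i, (i < n)%N -> almost_all (P i)) ->
  almost_all (fun t => forall i, (i < n)%N -> P i t).
Proof.
elim: n => [|n IH] h; first exact: almost_allT.
have hn := almost_all_and (h n (ltnSn n)) (IH (fun i ilt => h i (ltnW ilt))).
apply: almost_all_sub hn => t [hn hi] i; rewrite ltnS leq_eqVlt => /predU1P[->//|].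
exact: hi.
Qed.

(** Multiplied by x_g, the form vanishes everywhere. *)
Lemma ev_off d g (F : mon d g.+1 -> K) :
  (forall x, x g != 0 -> ev F x = 0) -> F =1 (fun=> 0).
Proof.
move=> F0 m; have := @ev_inj K d.+1 g.+1 (moncat (fun=> 0) F) _ (monr m).
apply=> x; rewrite evS (@ev_eq0 _ _ _ (fun m0 => 0)) // add0r.
by have [->|/F0 e] := eqVneq (x g) 0; rewrite ?mul0r // -[RHS](mulr0 (x g)) -[in RHS]e.
Qed.

Lemma ev_hyp d g (F : mon d.+1 g.+1 -> K) :
  (forall x, x g = 0 -> ev F x = 0) -> (fun m => F (monl m)) =1 (fun=> 0).
Proof.
move=> F0; apply: ev_inj => x.
pose y i := if i == g then 0 else x i.
have yg : y g = 0 by rewrite /y eqxx.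
have := F0 y yg; rewrite evS yg mul0r addr0 => e; apply: etrans e.
by apply: ev_ext => // i ig; rewrite /y ltn_eqF.
Qed.

Lemma dbl_monr d g (F : mon d.+1 g.+1 -> K) x : x g != 0 ->
  (fun m => F (monl m)) =1 (fun=> 0) -> dbl F x -> dbl (fun m => F (monr m)) x.
Proof.
move=> xg F0 [e h]; have er : ev (fun m => F (monr m)) x = 0.
  by move/eqP: e; rewrite evS (ev_eq0 x F0) add0r mulf_eq0 (negPf xg) => /eqP.
split=> // v; move/eqP: (h v).
by rewrite DS (D_eq0 x v F0) er mulr0 !add0r mulf_eq0 (negPf xg) => /eqP.
Qed.

Lemma move_to_hyperplane g e (p : nat -> nat -> K) : (e <= g)%N ->
  exists a, [/\ forall i, (i < e)%N -> lin g.+1 a (p i) g = 0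
    & forall y : nat -> K, exists x, forall i, (i < g.+1)%N -> lin g.+1 a x i = y i].
Proof.
move=> eg; pose P := \matrix_(i < e, j < g.+1) p i j.
have [j0 [l [l0 Pl]]] : exists j0 : 'I_g.+1, exists l : 'I_g.+1 -> K,
    l j0 != 0 /\ forall i, (i < e)%N -> \sum_j l j * p i j = 0.
  have : cokermx P != 0.
    rewrite cokermx_eq0 /row_full neq_ltn; apply/orP; left.
    by rewrite (leq_ltn_trans (rank_leq_row P)).
  move=> C0; have [[j0 k] /= jk] : exists jk, cokermx P jk.1 jk.2 != 0.
    apply/existsP; apply: contraNT C0; rewrite negb_exists => /forallP H.
    by apply/eqP/matrixP => i j; rewrite [RHS]mxE; apply/eqP; have := H (i, j);
      rewrite negbK.
  exists j0, (fun j => cokermx P j k); split=> // i ie.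
  have /matrixP/(_ (Ordinal ie) k) := mulmx_coker P; rewrite mxE [RHS]mxE => E.
  by apply: etrans E; apply: eq_bigr => j _; rewrite [P _ _]mxE mulrC.
pose L j := if insub j is Some j' then l j' else 0.
have LE (j : 'I_g.+1) : L j = l j by rewrite /L valK.
(* The new coordinate g is the linear form l and the new coordinate j0 is the old x_g; the others
   stay. This is invertible because l has a nonzero coefficient at j0. *)
exists (fun i k => if i == g then L k else if i == j0 :> nat then (k == g)%:R
                   else (k == i)%:R); split=> [i ie|y].
  rewrite /lin eqxx -[RHS](Pl i ie); apply: eq_bigr => j _; by rewrite LE.
pose x' i := if i == g then y j0 else y i.
pose w := (y g - \sum_(k < g.+1 | k != j0) l k * x' k) / l j0.
exists (fun i => if i == j0 :> nat then w else x' i) => i ig; rewrite /lin.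
have pick j (z : nat -> K) : (j < g.+1)%N -> \sum_(k < g.+1) (k == j :> nat)%:R * z k = z j.
  move=> jg; rewrite (bigD1 (Ordinal jg)) //= eqxx mul1r big1 ?addr0 // => k.
  by rewrite -val_eqE /= => /negPf ->; rewrite mul0r.
have [->|ig'] := eqVneq i g.
  rewrite (bigD1 j0) //= eqxx LE /w mulrC divfK // -[RHS](subrK (\sum_(k < g.+1 | k != j0) l k * x' k)).
  congr (_ + _); apply: eq_bigr => k kj; rewrite LE.
  by rewrite -val_eqE /= in kj; rewrite (negPf kj).
have [ij|ij] := eqVneq i (j0 : nat);
  rewrite (pick _ (fun k => if k == j0 :> nat then w else x' k)) //.
  by rewrite -ij eq_sym (negPf ig') /x' eqxx -ij.
by rewrite (negPf ij) /x' (negPf ig').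
Qed.

(** At most g points of a space of dimension g + 1 lie on a common hyperplane, and a linear change
    of coordinates turns it into x_g = 0. *)
Lemma good_on_hyperplane d g e r t : (e <= g)%N -> good K d g.+1 (e + r) t ->
  exists p q : nat -> nat -> K, (forall i, (i < e)%N -> p i g = 0) /\
    forall F : mon d g.+1 -> K, (forall i, (i < e + r)%N -> dbl F (p i)) ->
      (forall i, (i < t)%N -> ev F (q i) = 0) -> F =1 (fun=> 0).
Proof.
move=> eg [p [q h]]; have [a [ap asurj]] := move_to_hyperplane p eg.
exists (fun i => lin g.+1 a (p i)), (fun i => lin g.+1 a (q i)); split=> // F Fd Fs.
have [F' [eF dF]] := formfun_lin g.+1 a F.
have F'0 : F' =1 (fun=> 0).
  apply: h => i ik; last by rewrite eF Fs.
  by have [e1 e2] := Fd i ik; split=> [|v]; rewrite (eF, dF).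
apply: ev_inj => y; have [x xy] := asurj y.
rewrite -(@ev_ext _ _ _ F F (lin g.+1 a x)) // -eF; exact: ev_eq0.
Qed.

Definition at0 d g (F : mon d g -> {poly K}) : mon d g -> K := fun m => (F m).[0].

Lemma ev_at0 d g (F : mon d g -> {poly K}) (X : nat -> {poly K}) x :
  (forall i, (i < g)%N -> (X i).[0] = x i) -> ev (at0 F) x = (ev F X).[0].
Proof.
by move=> Xx; rewrite -[RHS]/(horner_eval 0 _) ev_rmorph; apply: ev_ext => // i /Xx.
Qed.

Lemma D_at0 d g (F : mon d g -> {poly K}) (X : nat -> {poly K}) x v :
  (forall i, (i < g)%N -> (X i).[0] = x i) ->
  D (at0 F) x v = (D F X (fun i => (v i)%:P)).[0].
Proof.
move=> Xx; rewrite -[RHS]/(horner_eval 0 _) D_rmorph; apply: D_ext => // i /Xx //.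
by move=> _; rewrite /= /horner_eval hornerC.
Qed.

Lemma at0_divX d g (F : mon d g -> {poly K}) : at0 F =1 (fun=> 0) ->
  exists F' : mon d g -> {poly K}, F =1 (fun m => 'X * F' m).
Proof.
move=> F0; suff /fin_all_exists : forall m, exists q, F m = 'X * q by [].
move=> m; have /factor_theorem[q ->] : root (F m) 0 by apply/eqP; exact: F0.
by exists q; rewrite subr0 mulrC.
Qed.

(** Family 0: double points on the hyperplane. Family 1: double points approaching it. Family 2:
    double points off it. Families 3 and 4: simple points off and on it. In the trace, family 1
    counts as simple points; in the residual, family 0 becomes simple and family 1 is double only
    along the hyperplane. *)
Definition trsys u e s1 := Sys (fam 0 u) [::] (fam 1 e ++ fam 4 s1) [::].
Definition ressys u e r s2 := Sys (fam 2 r) (fam 1 e) (fam 0 u ++ fam 3 s2) [::].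
Definition totsys u e r s1 s2 :=
  Sys (fam 0 u ++ fam 1 e ++ fam 2 r) [::] (fam 3 s2 ++ fam 4 s1) [::].

(* The e double points of family 1 approach the hyperplane x_g = 0 as X tends to 0.
   If F0 + x_g G solves the whole system identically in X, then F0 vanishes to second
   order in X up to what the trace conditions see, so that the limit of G solves the
   residual system; this is the differential Horace method. *)
Lemma horace_limit d g u e r s1 s2 (c : nat * nat -> nat -> K)
    (C : nat * nat -> nat -> {poly K}) (F : mon d.+2 g.+1 -> {poly K}) :
  (forall l i, C l i = (c l i)%:P + ((l.1 == 1%N) && (i == g))%:R * 'X) ->
  (forall f i, f \in [:: 0; 1; 4]%N -> c (f, i) g = 0) ->
  (forall f i, f \in [:: 2; 3]%N -> c (f, i) g != 0) ->
  nondeg (trsys u e s1) d.+2 g c -> nondeg (ressys u e r s2) d.+1 g.+1 c ->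
  sat (totsys u e r s1 s2) C F -> at0 F =1 (fun=> 0).
Proof.
move=> CE on off tr res [] /in_catP[/famP F0 /in_catP[/famP F1 /famP F2]] _
  /in_catP[/famP F3 /famP F4] _.
pose Fl m := F (monl m); pose Fr m := F (monr m).
have C0 l i : (C l i).[0] = c l i.
  by rewrite CE hornerD hornerC hornerM hornerX mulr0 addr0.
have Cg f i : f \in [:: 0; 4]%N -> C (f, i) g = 0.
  move=> fin; rewrite CE on ?add0r; first by move: fin; rewrite !inE => /orP[] /eqP ->; rewrite mul0r.
  by move: fin; rewrite !inE => /orP[] ->; rewrite ?orbT.
have Cg1 i : C (1%N, i) g = 'X by rewrite CE on // eqxx mul1r add0r.
have DFlg X : D Fl X (unitv _ g) = 0.
  by rewrite D_coord big1 // => j _; rewrite /unitv ltn_eqF ?mul0r.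
have r0 i : (i < u)%N -> ev Fr (C (0%N, i)) = 0.
  by move/F0 => [_ /(_ (unitv _ g))]; rewrite (DS F) DFlg Cg // mul0r addr0 add0r /unitv eqxx mul1r.
have l0 i : (i < u)%N -> dbl Fl (C (0%N, i)).
  move=> iu; have [e1 e2] := F0 i iu; split=> [|v].
    by rewrite -[RHS]e1 (evS F) Cg // mul0r addr0.
  by rewrite -[RHS](e2 v) (DS F) r0 // Cg // mulr0 mul0r !addr0.
have l4 i : (i < s1)%N -> ev Fl (C (4, i)%N) = 0.
  by move=> ie; rewrite -[RHS](F4 i ie) (evS F) Cg // mul0r addr0.
have l1 i : (i < e)%N -> ev Fl (C (1%N, i)) + 'X * ev Fr (C (1%N, i)) = 0.
  by move=> ie; have [e1 _] := F1 i ie; rewrite -[RHS]e1 (evS F) Cg1.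
have l1D i v : (i < e)%N ->
    D Fl (C (1%N, i)) v + (v g * ev Fr (C (1%N, i)) + 'X * D Fr (C (1%N, i)) v) = 0.
  by move=> ie; have [_ e2] := F1 i ie; rewrite -[RHS](e2 v) (DS F) Cg1.
(* The trace system is applied twice, here to [Fl] and below to its quotient [G] by X. *)
have Fl0 : at0 Fl =1 (fun=> 0).
  apply: tr; split=> //; first (apply/famP => i iu; have [e1 e2] := l0 i iu; split=> [|v]).
  - by rewrite (ev_at0 _ (X := C (0%N, i))) ?e1 ?horner0.
  - by rewrite (D_at0 _ _ (X := C (0%N, i))) ?e2 ?horner0.
  apply/in_catP; split; apply/famP => i ie.
  - rewrite (ev_at0 _ (X := C (1%N, i))) //.
    by have /eqP := l1 i ie; rewrite addr_eq0 => /eqP ->; rewrite hornerN hornerM hornerX mul0r oppr0.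
  - by rewrite (ev_at0 _ (X := C (4, i)%N)) ?l4 ?horner0.
have [G FlG] := at0_divX Fl0.
have evG X : ev Fl X = 'X * ev G X by rewrite -evZ; exact: ev_ext.
have DG X v : D Fl X v = 'X * D G X v by rewrite -DZ; exact: D_ext.
have Xi (a : {poly K}) : 'X * a = 0 -> a = 0.
  by move/eqP; rewrite mulf_eq0 polyX_eq0 => /eqP.
have g1 i : (i < e)%N -> ev G (C (1%N, i)) + ev Fr (C (1%N, i)) = 0.
  by move=> ie; apply: Xi; rewrite mulrDr -evG l1.
(* As [Fl] does not involve x_g, the derivative across the hyperplane isolates ev Fr + X D Fr. *)
have rz1 i : (i < e)%N -> (ev Fr (C (1%N, i))).[0] = 0.
  move=> ie; have /(congr1 (fun p : {poly K} => p.[0])) := l1D i (unitv _ g) ie.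
  by rewrite DFlg add0r /unitv eqxx mul1r hornerD hornerM hornerX mul0r addr0 horner0.
have G0 : at0 G =1 (fun=> 0).
  apply: tr; split=> //; first (apply/famP => i iu; have [e1 e2] := l0 i iu; split=> [|v]).
  - by rewrite (ev_at0 _ (X := C (0%N, i))) // (Xi (ev G _)) ?horner0 // -evG.
  - by rewrite (D_at0 _ _ (X := C (0%N, i))) // (Xi (D G _ _)) ?horner0 // -DG.
  apply/in_catP; split; apply/famP => i ie.
  - rewrite (ev_at0 _ (X := C (1%N, i))) //.
    by have /eqP := g1 i ie; rewrite addr_eq0 => /eqP ->; rewrite hornerN rz1 ?oppr0.
  - by rewrite (ev_at0 _ (X := C (4, i)%N)) // (Xi (ev G _)) ?horner0 // -evG l4.
have Fr0 : at0 Fr =1 (fun=> 0).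
  apply: res; split=> //.
  - apply/famP => i ir; apply: (@dbl_monr _ _ (at0 F)) => //; first exact: off.
    have [e1 e2] := F2 i ir; split=> [|v].
      by rewrite (ev_at0 _ (X := C (2, i)%N)) ?e1 ?horner0.
    by rewrite (D_at0 _ _ (X := C (2, i)%N)) ?e2 ?horner0.
  (* Along the hyperplane the derivative condition, divided by X, reads D G + D Fr = 0; at X = 0 its
     first term disappears by [G0]. *)
  - apply/famP => i ie; split=> [|v /= vg].
      by rewrite (ev_at0 _ (X := C (1%N, i))) ?rz1.
    rewrite (D_at0 _ _ (X := C (1%N, i))) //.
    have /Xi : 'X * (D G (C (1%N, i)) (fun i => (v i)%:P) + D Fr (C (1%N, i)) (fun i => (v i)%:P)) = 0.
      by rewrite mulrDr -DG -[RHS](l1D i (fun i => (v i)%:P) ie) vg polyC0 mul0r add0r.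
    move/(congr1 (fun p : {poly K} => p.[0])); rewrite hornerD horner0.
    by rewrite -(D_at0 G v (x := c (1%N, i))) // (D_eq0 _ _ G0) add0r.
  apply/in_catP; split; apply/famP => i ie.
    by rewrite (ev_at0 _ (X := C (0%N, i))) ?r0 ?horner0.
  have e3 : ev (at0 F) (c (3, i)%N) = 0.
    by rewrite (ev_at0 _ (X := C (3, i)%N)) ?F3 ?horner0.
  move/eqP: e3; rewrite evS (ev_eq0 _ Fl0) add0r mulf_eq0 (negPf (off _ _ _)) //.
  by move/eqP.
by apply: monP => m; [exact: Fl0 | exact: Fr0].
Qed.

End Horace.

Section HoraceMethod.
Variable K : numFieldType.

(* Two systems on the same labels, each nondegenerate somewhere, are simultaneously
   nondegenerate on almost all of the line joining the two configurations. *)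
Lemma nondeg2 (T : eqType) (S1 S2 : sys T) d1 g1 d2 g2 (c1 c2 : T -> nat -> K) :
  (0 < g1)%N -> (0 < g2)%N -> nondeg S1 d1 g1 c1 -> nondeg S2 d2 g2 c2 ->
  exists t, nondeg S1 d1 g1 (line c1 c2 t) /\ nondeg S2 d2 g2 (line c1 c2 t).
Proof.
move=> g10 g20 h1 h2; apply: almost_all_ex; apply: almost_all_and.
  exact: nondeg_line.
exact: nondeg_line1.
Qed.

Lemma line_eq0 (T : eqType) (c1 c2 : T -> nat -> K) t l i :
  c1 l i = 0 -> c2 l i = 0 -> line c1 c2 t l i = 0.
Proof. by rewrite /line => -> ->; rewrite subr0 mulr0 addr0. Qed.

Lemma nondeg_local (T : eqType) (S : sys T) d g (c c' : T -> nat -> K) :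
  (forall l i, l \in dbls S ++ hdbls S ++ smps S -> (i < g)%N -> c l i = c' l i) ->
  nondeg S d g c -> nondeg S d g c'.
Proof.
move=> cc h F [hd hh hs hb]; apply: h; split=> // l lS;
  have ccl i : (i < g)%N -> c l i = c' l i by move=> ig; apply: cc; rewrite // !mem_cat lS ?orbT.
- have [e1 e2] := hd l lS; split=> [|v]; last rewrite -[RHS](e2 v).
    by rewrite -[RHS]e1; apply: ev_ext.
  exact: D_ext.
- have [e1 e2] := hh l lS; split=> [|v vg]; last rewrite -[RHS](e2 v vg).
    by rewrite -[RHS]e1; apply: ev_ext.
  exact: D_ext.
- by rewrite -[RHS](hs l lS); apply: ev_ext.
Qed.

(* The configuration of the residual scheme: the points of family 0 are found by
   cutting down the forms singular at family 2 and singular along the hyperplane at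
   family 1; restriction to the hyperplane is injective on these forms. *)
Lemma horace_residual d g u e r s2 t :
  good K d.+1 g.+1 (e + r) t -> good K d g.+1 r 0 -> (e <= g)%N ->
  (t + e <= u + s2)%N ->
  exists c : nat * nat -> nat -> K,
    [/\ forall f i, f \in [:: 0; 1; 4]%N -> c (f, i) g = 0,
        forall f i, f \in [:: 2; 3]%N -> c (f, i) g != 0
      & nondeg (ressys u e r s2) d.+1 g.+1 c].
Proof.
move=> gA gB eg tu.
have [pA [qA [pA0 hA]]] := good_on_hyperplane eg gA; have [pB [qB hB]] := gB.
pose SA := Sys (fam 1 e ++ fam 2 r) [::] (fam 3 t) [::].
pose SB := Sys (fam 2 r) [::] [::] [::].
pose cA (l : nat * nat) := if l.1 == 1%N then (if (l.2 < e)%N then pA l.2 else fun=> 0)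
  else if l.1 == 2%N then pA (e + l.2)%N else if l.1 == 3%N then qA l.2 else fun=> 0.
pose cB (l : nat * nat) := if l.1 == 2%N then pB l.2 else cA l.
have nA : nondeg SA d.+1 g.+1 cA.
  move=> F [] /in_catP[/famP F1 /famP F2] _ /famP F3 _; apply: hA => //.
  move=> i; have [ie _|ei ier] := ltnP i e; first by have := F1 i ie; rewrite /cA /= ie.
  have ier' : (i - e < r)%N by lia.
  by have := F2 _ ier'; rewrite /cA /= subnKC.
have nB : nondeg SB d g.+1 cB by move=> F [] /famP F2 _ _ _; apply: hB.
have [t1 [nA1 nB1]] := nondeg2 (ltn0Sn g) (ltn0Sn g) nA nB.
set c1 := line cA cB t1 in nA1 nB1.
have c10 i : c1 (1%N, i) g = 0.
  by apply: line_eq0; rewrite /cB /cA /=; case: ifP => // /pA0.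
(* Moving towards [c2] pushes family 2 off the hyperplane while keeping both nondegeneracies. *)
pose c2 (l : nat * nat) i := if (l.1 == 2%N) && (i == g) then 1 else c1 l i.
have [t2 [[nA2 nB2] off2]] : exists t, (nondeg SA d.+1 g.+1 (line c1 c2 t) /\
    nondeg SB d g.+1 (line c1 c2 t)) /\
    forall i, (i < r)%N -> line c1 c2 t (2, i)%N g != 0.
  apply: almost_all_ex; apply: almost_all_and.
    by apply: almost_all_and; apply: nondeg_line.
  apply: almost_all_forall => i ir; pose a := c1 (2, i)%N g.
  exists (a%:P + (1 - a) *: 'X).
    apply: contraTneq isT => /(congr1 (fun p : {poly K} => p.[1])).
    rewrite hornerD hornerC hornerZ hornerX mulr1 horner0 addrC subrK => /eqP.
    by rewrite oner_eq0.
  by move=> s; rewrite hornerD hornerC hornerZ hornerX /line /c2 !eqxx /= -/a mulrC.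
set c := line c1 c2 t2 in nA2 nB2 off2.
have c0 i : c (1%N, i) g = 0 by apply: line_eq0; rewrite /c2 /= c10.
pose W (F : mon d.+1 g.+1 -> K) := sat (Sys (fam 2 r) (fam 1 e) [::] [::]) c F.
have WL : subspace W by exact: subspace_sat.
(* On W, the t evaluations together with the e derivatives across the hyperplane restore the system
   [SA]. These t + e functionals are exchanged below for u points on the hyperplane and s2 points
   off it. *)
pose phi i (F : mon d.+1 g.+1 -> K) :=
  if (i < t)%N then ev F (c (3, i)%N) else D F (c (1, i - t)%N) (unitv K g).
have phiL i : functional (phi i).
  by rewrite /phi; case: (ltnP i t) => _; [exact: functional_ev | exact: functional_D].
have kill F : W F -> (forall i, (i < u + s2)%N -> phi i F = 0) -> F =1 (fun=> 0).
  case=> /famP F2 /famP F1 _ _ Fphi; apply: nA2; split=> //.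
    apply/in_catP; split; apply/famP => // i ie.
    have /(hdblP _ _ (ltn0Sn g))[e1 e2] := F1 i ie.
    apply/dblP; split=> // j; rewrite ltnS leq_eqVlt => /predU1P[->|/e2//].
    have := Fphi (t + i)%N; rewrite /phi [(t + i < t)%N]ltnNge leq_addr /= addKn; apply.
    by apply: leq_trans tu; rewrite ltn_add2l.
  apply/famP => i it; have := Fphi i; rewrite /phi it; apply.
  by apply: leq_trans tu; apply: leq_trans it (leq_addr _ _).
(* A form of W that vanishes on the hyperplane is x_g times a form of degree d singular at family 2,
   hence 0; this is where [gB] enters. *)
have sepH F : W F -> (forall p : nat -> K, p g = 0 -> ev F p = 0) -> F =1 (fun=> 0).
  case=> /famP F2 _ _ _ /ev_hyp Fl0; apply: monP => m; first exact: Fl0.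
  apply: (nB2 (fun m => F (monr m))); split=> //; apply/famP => i ir.
  by apply: dbl_monr => //; [exact: off2 | exact: F2].
have [ps psH kps] := cut (rho := fun p F => ev F p) (functional_ev (d:=d.+1) (g:=g.+1))
  (p0 := (fun=> 0) : nat -> K) (erefl : (fun=> 0) g = 0) WL phiL sepH kill.
pose W2 (F : mon d.+1 g.+1 -> K) := W F /\ (forall i, (i < u)%N -> ev F (ps i) = 0).
have W2L : subspace W2.
  move=> f h a [Wf fp] [Wh hp]; split=> [|i iu]; first exact: WL.
  by rewrite functional_ev fp // hp // mulr0 subrr.
have kill2 F : W2 F -> (forall i, (i < s2 + 0)%N -> phi (u + i)%N F = 0) -> F =1 (fun=> 0).
  by case=> WF Fp; rewrite addn0; apply: kps.
have sepO F : W2 F -> (forall p : nat -> K, p g != 0 -> ev F p = 0) -> F =1 (fun=> 0).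
  by move=> _; apply: ev_off.
have [qs qsO kqs] := cut (rho := fun p F => ev F p) (functional_ev (d:=d.+1) (g:=g.+1))
  (p0 := (fun=> 1) : nat -> K) (oner_neq0 K : (fun=> 1) g != 0) W2L (fun i => phiL (u + i)%N) sepO kill2.
pose cR (l : nat * nat) := if l.1 == 0%N then ps l.2 else if l.1 == 1%N then c l else
  if l.1 == 2%N then (if (l.2 < r)%N then c l else fun=> 1)
  else if l.1 == 3%N then qs l.2 else fun=> 0.
exists cR; split.
- move=> f i; rewrite !inE => /or3P[] /eqP ->; [exact: psH | exact: c0 | by []].
- move=> f i; rewrite !inE => /orP[] /eqP -> /=; last exact: qsO.
  by rewrite /cR /=; case: ifP => [/off2|_] //; rewrite oner_neq0.
move=> F [] /famP F2 /famP F1 /in_catP[/famP F0 /famP F3] _; apply: kqs => //.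
split=> //; split=> //; apply/famP => // i ir.
by have := F2 i ir; rewrite /cR /= ir.
Qed.

(** The first hypothesis is the trace, where the e approaching points count as simple. The second
    concerns the residual degree, t being the number of simple points that complete the e + r double
    points. The third, two degrees down, makes restriction to the hyperplane injective in
    [horace_residual]. *)
Theorem horace d g u e r s1 s2 t : (0 < g)%N ->
  good K d.+2 g u (e + s1) -> good K d.+1 g.+1 (e + r) t -> good K d g.+1 r 0 ->
  (e <= g)%N -> (t + e <= u + s2)%N -> good K d.+2 g.+1 (u + e + r) (s1 + s2).
Proof.
move=> g0 [pT [qT hT]] gA gB eg tu.
have [cR [on off nR]] := horace_residual gA gB eg tu.
pose cut0 (x : nat -> K) i := if (i < g)%N then x i else 0.
pose cT (l : nat * nat) := if l.1 == 0%N then cut0 (pT l.2)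
  else if l.1 == 1%N then cut0 (qT l.2) else if l.1 == 4%N then cut0 (qT (e + l.2)%N)
  else cR l.
have nT : nondeg (trsys u e s1) d.+2 g cT.
  move=> F [] /famP F0 _ /in_catP[/famP F1 /famP F4] _.
  have cutE x i : (i < g)%N -> cut0 x i = x i by rewrite /cut0 => ->.
  apply: hT => i.
    move=> /F0[e1 e2]; split=> [|v]; first by rewrite -[RHS]e1;
         apply: ev_ext => // j jg; rewrite /cT /= cutE.
    by rewrite -[RHS](e2 v); apply: D_ext => // j jg; rewrite /cT /= cutE.
  have [ie _|ei ies] := ltnP i e.
    by rewrite -[RHS](F1 i ie); apply: ev_ext => // j jg; rewrite /cT /= cutE.
  have ies' : (i - e < s1)%N by lia.
  rewrite -[RHS](F4 _ ies'); apply: ev_ext => // j jg.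
  by rewrite /cT /= cutE // subnKC.
have [t1 [nT1 nR1]] := nondeg2 g0 (ltn0Sn g) nT nR.
set c := line cT cR t1 in nT1 nR1.
have con f i : f \in [:: 0; 1; 4]%N -> c (f, i) g = 0.
  move=> ff; apply: line_eq0; last exact: on.
  by move: ff; rewrite !inE => /or3P[] /eqP -> /=; rewrite /cT /cut0 /= ltnn.
have coff f i : f \in [:: 2; 3]%N -> c (f, i) g != 0.
  move=> ff; rewrite /c /line; have -> : cT (f, i) g = cR (f, i) g.
    by move: ff; rewrite !inE => /orP[] /eqP ->.
  by rewrite subrr mulr0 addr0 off.
pose C l i := (c l i)%:P + ((l.1 == 1%N) && (i == g))%:R * 'X.
have [/almost_all_ex[t2 h2]|[F [m Fm] /(horace_limit (fun _ _ => erefl) con coff nT1 nR1) F0]] :=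
  sat_limit (totsys u e r s1 s2) d.+2 C (ltn0Sn g); last first.
  by have /eqP := F0 m; rewrite /at0 (negPf Fm).
pose c2 l i := (C l i).[t2].
exists (fun i => if (i < u)%N then c2 (0%N, i) else if (i < u + e)%N then c2 (1, i - u)%N
                 else c2 (2, i - (u + e))%N),
       (fun i => if (i < s1)%N then c2 (4, i)%N else c2 (3, i - s1)%N).
move=> F Fd Fs; apply: h2; split=> //.
  apply/in_catP; split; last (apply/in_catP; split); apply/famP => i ik.
  - have := Fd i; rewrite ik; apply; lia.
  - have := Fd (u + i)%N; rewrite [(u + i < u)%N]ltnNge leq_addr /=.
    by rewrite [(u + i < u + e)%N]ltn_add2l ik addKn; apply; lia.
  - have := Fd (u + e + i)%N; have -> : (u + e + i < u = false)%N by lia.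
    by rewrite [(u + e + i < u + e)%N]ltnNge leq_addr /= addKn; apply; lia.
apply/in_catP; split; apply/famP => i ik.
  have := Fs (s1 + i)%N; rewrite [(s1 + i < s1)%N]ltnNge leq_addr /= addKn; apply; lia.
have := Fs i; rewrite ik; apply; lia.
Qed.

End HoraceMethod.

(** * Cubics *)

Section Cubics.
Variable K : numFieldType.
Implicit Types (c : nat * nat -> nat -> K) (x v : nat -> K).

(** [ins] parametrises the subspace where the coordinates of block b vanish, and [del] reads the
    parameters back. *)
Definition ins b x : nat -> K :=
  fun j => if (j < b)%N then x j else if (j < b + 3)%N then 0 else x (j - 3)%N.
Definition del b x : nat -> K := fun j => if (j < b)%N then x j else x (j + 3)%N.

Lemma insK b x j : del b (ins b x) j = x j.
Proof.
rewrite /del /ins; case: (ltnP j b) => // bj.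
by rewrite !ifF; [congr x; lia | lia | lia].
Qed.

Lemma delK b x j : {in block b, forall i, x i = 0} -> ins b (del b x) j = x j.
Proof.
move=> xb; rewrite /del /ins; case: (ltnP j b) => // bj; case: (ltnP j (b + 3)) => jb3.
  by rewrite xb // !inE; lia.
by rewrite ifF; [congr x; lia | lia].
Qed.

Lemma ins_block b x j : j \in block b -> ins b x j = 0.
Proof. by rewrite /ins !inE => jb; rewrite ifF ?ifT //; lia. Qed.

(** F' is the restriction of F to the subspace defined by block b, written in g variables. *)
Lemma restrict_block b d g (F : mon d g.+3 -> K) : (b <= g)%N ->
  exists F' : mon d g -> K,
  [/\ forall x, {in block b, forall i, x i = 0} -> dbl F x -> dbl F' (del b x),
      forall x, {in block b, forall i, x i = 0} -> ev F x = 0 -> ev F' (del b x) = 0,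
      forall B, {in B, forall j, (j < b)%N} -> vanishes B F -> vanishes B F'
    & F' =1 (fun=> 0) -> vanishes (block b) F].
Proof.
move=> bg; pose a j i : K :=
  ((j < b)%N && (i == j) || (b + 3 <= j)%N && (i == j - 3)%N)%:R.
have insE x j : (j < g.+3)%N -> lin g a x j = ins b x j.
  move=> jg; rewrite /lin /ins /a.
  have pick k : (k < g)%N -> \sum_(i < g) (i == k :> nat)%:R * x i = x k.
    move=> kg; rewrite (bigD1 (Ordinal kg)) //= eqxx mul1r big1 ?addr0 // => i.
    by rewrite -val_eqE /= => /negPf ->; rewrite mul0r.
  case: (ltnP j b) => jb.
    rewrite -(pick j) //; last by lia.
    apply: eq_bigr => i _ /=.
    by rewrite (_ : (b + 3 <= j)%N = false) ?orbF //; lia.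
  case: (ltnP j (b + 3)) => jb3 /=.
    by rewrite big1 // => i _; rewrite mul0r.
  by rewrite -(pick (j - 3)%N) //; lia.
have [F' [eF dF]] := formfun_lin g a F.
have evF x : ev F' x = ev F (ins b x) by rewrite eF; apply: ev_ext => // i /insE.
have dvF x v : D F' x v = D F (ins b x) (ins b v).
  by rewrite dF; apply: D_ext => // i /insE.
have delE x : {in block b, forall i, x i = 0} -> ev F' (del b x) = ev F x.
  by move=> xb; rewrite evF; apply: ev_ext => // i _; exact: delK.
exists F'; split.
- move=> x xb [e1 e2]; split=> [|v]; first by rewrite delE.
  rewrite dvF -[RHS](e2 (ins b v)); apply: D_ext => // i _; exact: delK.
- by move=> x xb e; rewrite delE.
- move=> B Bb FB; apply: vanishesP => x xB; rewrite evF; apply: (vanishes_ev FB) => j jB.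
  by rewrite /ins (Bb j jB) xB.
- by move=> F0; apply: vanishesP => x xb; rewrite -delE // ev_eq0.
Qed.

(* Brambilla and Ottaviani's statements on cubics containing one, two or three linear
   subspaces of codimension 3 and singular at points lying on them or outside. *)
Definition T1 g a s := exists c, (forall i, {in blockL, forall j, c (0%N, i) j = 0}) /\
  nondeg (Sys (fam 0 a ++ fam 1 g) [::] (fam 2 s) [:: blockL]) 3 g c.

Definition T2 g := exists c, [/\ forall i, {in blockL, forall j, c (0%N, i) j = 0},
  forall i, {in blockM, forall j, c (1%N, i) j = 0} &
  nondeg (Sys (fam 0 (g - 3) ++ fam 1 (g - 3) ++ fam 2 3) [::] [::] [:: blockL; blockM]) 3 g c].

Definition T3 g := exists c, [/\ forall i, {in blockL, forall j, c (0%N, i) j = 0},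
  forall i, {in blockM, forall j, c (1%N, i) j = 0},
  forall i, {in blockN, forall j, c (2%N, i) j = 0} &
  nondeg (Sys (fam 0 3 ++ fam 1 3 ++ fam 2 3) [::] [::] [:: blockL; blockM; blockN]) 3 g c].

Lemma nondeg_del (S : sys (nat * nat)) d g b c1 c2 : (0 < g)%N ->
  nondeg S d g (fun l => del b (c1 l)) ->
  almost_all (fun t => nondeg S d g (fun l => del b (line c1 c2 t l))).
Proof.
move=> g0 /(nondeg_line (fun l => del b (c2 l)) g0); apply: almost_all_sub => t.
by apply: nondeg_ext => l i; rewrite /line /del; case: ifP.
Qed.

Lemma line_block c1 c2 t l b : {in block b, forall j, c1 l j = 0} ->
  {in block b, forall j, c2 l j = 0} -> {in block b, forall j, line c1 c2 t l j = 0}.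
Proof. by move=> h1 h2 j jb; apply: line_eq0; [exact: h1 | exact: h2]. Qed.

Lemma in_seq2 (T : eqType) (a b : T) (P : T -> Prop) :
  {in [:: a; b], forall y, P y} <-> P a /\ P b.
Proof.
split=> [h|[ha hb] x]; first by split; apply: h; rewrite !inE eqxx ?orbT.
by rewrite !inE => /orP[] /eqP ->.
Qed.

Lemma in_seq3 (T : eqType) (a b e : T) (P : T -> Prop) :
  {in [:: a; b; e], forall y, P y} <-> [/\ P a, P b & P e].
Proof.
split=> [h|[ha hb he] x]; first by split; apply: h; rewrite !inE eqxx ?orbT.
by rewrite !inE => /or3P[] /eqP ->.
Qed.

(** All but three of the points on L, all but three of those on M, and the three free points are
    specialised to N. Restriction to N gives the system of [T2] in g variables, so the form contains
    N; the points left on L and M, with the three points on N, then form the system of [T3]. *)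
Lemma T2_step g : (6 <= g)%N -> T2 g -> T3 g.+3 -> T2 g.+3.
Proof.
move=> g6 [cA [cA0 cA1 nA]] [cB [cB0 cB1 cB2 nB]].
have g0 : (0 < g)%N by lia.
pose n := (g - 3)%N.
pose c1 (l : nat * nat) := if (l.1 < 2)%N && (n <= l.2)%N then fun=> 0 else ins 6 (cA l).
pose c2 (l : nat * nat) := if (l.1 < 2)%N then (if (l.2 < n)%N then fun=> 0 else cB (l.1, l.2 - n)%N)
  else cB l.
pose sg (l : nat * nat) := if (l.1 < 2)%N then (l.1, n + l.2)%N else l.
have n1 : nondeg (Sys (fam 0 n ++ fam 1 n ++ fam 2 3) [::] [::] [:: blockL; blockM]) 3 g
    (fun l => del 6 (c1 l)).
  apply: nondeg_local nA => l i; rewrite /c1 !cats0 !mem_cat => lS _.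
  case: ifP => [l2|_]; last by rewrite insK.
  by case/or3P: lS => /mapP[j]; rewrite mem_iota => jn le; move: l2; rewrite le /=; lia.
have n2 : nondeg (Sys (fam 0 3 ++ fam 1 3 ++ fam 2 3) [::] [::] [:: blockL; blockM; blockN]) 3 g.+3
    (fun l => c2 (sg l)).
  apply: nondeg_ext nB => -[[|[|f]] k] i; rewrite /c2 /sg //=;
    by rewrite ltnNge leq_addr addKn.
have [t [nA' nB']] := almost_all_ex (almost_all_and (nondeg_del c2 g0 n1)
  (nondeg_line1 (fun l => c1 (sg l)) (ltn0Sn _) n2)).
exists (line c1 c2 t).
have ins6 b x j : (b <= 3)%N -> {in block b, forall i, x i = 0} -> j \in block b -> ins 6 x j = 0.
  by move=> b3 xb jb; rewrite /ins ifT ?xb //; move: jb; rewrite !inE; lia.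
have onL i : {in blockL, forall j, line c1 c2 t (0%N, i) j = 0}.
  apply: line_block => j jL; rewrite /c1 /c2 /=; case: ifP => // _; last exact: cB0.
  exact: ins6 (cA0 i) jL.
have onM i : {in blockM, forall j, line c1 c2 t (1%N, i) j = 0}.
  apply: line_block => j jL; rewrite /c1 /c2 /=; case: ifP => // _; last exact: cB1.
  exact: ins6 (cA1 i) jL.
split=> // F []; have -> : (g.+3 - 3 = g)%N by lia.
move=> /in_catP[/famP F0 /in_catP[/famP F1 /famP F2]] _ _ /in_seq2[FL FM].
have [F' [rd re rv rN]] := restrict_block F g6.
have onN f i : (f <= 2)%N -> ((f < 2)%N -> (i < n)%N) ->
    {in blockN, forall j, line c1 c2 t (f, i) j = 0}.
  move=> f2 fi; apply: line_block => j jN; rewrite /c1 /c2 /=.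
    by case: ltnP fi => //= _; [move/(_ isT); rewrite ltnNge => /negPf ->|]; rewrite ins_block.
  case: ltnP fi => [_ ->//|f2' _]; have -> : f = 2 by lia.
  exact: cB2.
have F'0 : F' =1 (fun=> 0).
  apply: nA'; split=> //; last first.
    by apply/in_seq2; split; apply: rv => // j; rewrite !inE; lia.
  apply/in_catP; split; last (apply/in_catP; split); apply/famP => i i_n.
  - by apply: rd; [apply: onN | apply: F0; lia].
  - by apply: rd; [apply: onN | apply: F1; lia].
  - by apply: rd; [apply: onN | apply: F2; lia].
apply: nB'; split=> //; last by apply/in_seq3; split=> //; exact: rN.
apply/in_catP; split; last (apply/in_catP; split); apply/famP => i i3.
- by apply: (F0 (n + i)%N); rewrite /n; lia.
- by apply: (F1 (n + i)%N); rewrite /n; lia.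
- exact: F2.
Qed.

End Cubics.

Section CubicChain.
Variable K : numFieldType.
Implicit Types (c : nat * nat -> nat -> K).

(** Here a points of L, g free points and all simple points are specialised to M. Restriction to M
    is the old system. A form containing M then faces the g remaining points of L, the g points now
    on M and three free ones, which is [T2]. *)
Lemma T1_step g a s : (3 <= g)%N -> T1 K g a s -> T2 K g.+3 -> T1 K g.+3 (a + g) s.
Proof.
move=> g3 [cA [cA0 nA]] [cB [cB0 cB1 nB]].
have g0 : (0 < g)%N by lia.
move: nB; have -> : (g.+3 - 3 = g)%N by lia. move=> nB.
pose c1 (l : nat * nat) := if (l.1 == 0%N) && (a <= l.2)%N || (l.1 == 1%N) && (g <= l.2)%N
  then fun=> 0 else ins 3 (cA l).
pose c2 (l : nat * nat) : nat -> K :=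
  if l.1 == 0%N then (if (l.2 < a)%N then fun=> 0 else cB (0, l.2 - a)%N)
  else if l.1 == 1%N then (if (l.2 < g)%N then cB l else cB (2, l.2 - g)%N)
  else fun=> 0.
pose sg (l : nat * nat) := if l.1 == 0%N then (0, a + l.2)%N else
  if l.1 == 1%N then l else (1, g + l.2)%N.
have n1 : nondeg (Sys (fam 0 a ++ fam 1 g) [::] (fam 2 s) [:: blockL]) 3 g
    (fun l => del 3 (c1 l)).
  apply: nondeg_local nA => l i; rewrite /c1 /= !mem_cat => lS _.
  case: ifP => [l2|_]; last by rewrite insK.
  by case/orP: lS => [/orP[]|] /mapP[j]; rewrite mem_iota => jn le; move: l2; rewrite le /=; lia.
have n2 : nondeg (Sys (fam 0 g ++ fam 1 g ++ fam 2 3) [::] [::] [:: blockL; blockM]) 3 g.+3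
    (fun l => c2 (sg l)).
  apply: nondeg_local nB => -[f k] i; rewrite !cats0 !mem_cat => lS _.
  case/or3P: lS => /mapP[j]; rewrite mem_iota => jn [-> ->]; rewrite /c2 /sg /=.
  - by rewrite ltnNge leq_addr addKn.
  - by case/andP: jn => _ ->.
  - by rewrite ltnNge leq_addr addKn.
have [t [nA' nB']] := almost_all_ex (almost_all_and (nondeg_del c2 g0 n1)
  (nondeg_line1 (fun l => c1 (sg l)) (ltn0Sn _) n2)).
exists (line c1 c2 t).
have onL i : {in blockL, forall j, line c1 c2 t (0%N, i) j = 0}.
  apply: line_block => j jL; rewrite /c1 /c2 /=; case: ifP => // _; last exact: cB0.
  by rewrite /ins ifT ?cA0 //; move: jL; rewrite !inE; lia.
split=> // F [] /in_catP[/famP F0 /famP F1] _ /famP F2 /(_ blockL (mem_head _ _)) FL.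
have [F' [rd re rv rN]] := restrict_block F g3.
have onM l : ((l.1 == 0%N) -> (l.2 < a)%N) -> ((l.1 == 1%N) -> (l.2 < g)%N) ->
    {in blockM, forall j, line c1 c2 t l j = 0}.
  case: l => f i /= f0 f1; apply: line_block => j jM; rewrite /c1 /c2 /=.
    by case: eqP f0 => /= [_ /(_ isT)|_ _]; [rewrite ltnNge => /negPf -> /=|];
      case: eqP f1 => /= [_ /(_ isT)|_ _]; [rewrite ltnNge => /negPf -> /=| |rewrite ltnNge => /negPf -> /=|];
      rewrite ins_block.
  case: eqP f0 => [_ /(_ isT) -> //|_ _].
  by case: eqP f1 => [-> /(_ isT) ->|//]; exact: cB1.
have F'0 : F' =1 (fun=> 0).
  apply: nA'; split=> //; last first.
  - by move=> B; rewrite inE => /eqP ->; apply: rv => // j; rewrite !inE; lia.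
  - by apply/famP => i i_n; apply: re; [apply: onM | apply: F2].
  apply/in_catP; split; apply/famP => i i_n.
  - by apply: rd; [apply: onM | apply: F0; lia].
  - by apply: rd; [apply: onM | apply: F1; lia].
apply: nB'; split=> //; last by apply/in_seq2; split=> //; exact: rN.
apply/in_catP; split; last (apply/in_catP; split); apply/famP => i i3.
- by apply: (F0 (a + i)%N); lia.
- by apply: (F1 i); lia.
- by apply: (F1 (g + i)%N); lia.
Qed.

(** With k double and s simple points on L, restriction to L is a cubic system in g variables; forms
    that contain L are handled by [T1]. *)
Lemma T0_step g k s s1 : (0 < g)%N -> good K 3 g k s -> T1 K g.+3 k s1 ->
  good K 3 g.+3 (k + g.+3) (s + s1).
Proof.
move=> g0 [p [q nA]] [cB [cB0 nB]].
pose c1 (l : nat * nat) := if l.1 == 0%N then ins 0 (p l.2) else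
  if l.1 == 2%N then ins 0 (q l.2) else fun=> 0.
pose c2 (l : nat * nat) : nat -> K :=
  if (l.1 < 2)%N then cB l else if l.1 == 3%N then cB (2%N, l.2) else fun=> 0.
pose sg (l : nat * nat) : nat * nat := if l.1 == 2%N then (3%N, l.2) else l.
have n1 : nondeg (Sys (fam 0 k) [::] (fam 2 s) [::]) 3 g (fun l => del 0 (c1 l)).
  move=> F [] /famP F0 _ /famP F2 _; apply: nA => i ik.
    have [e1 e2] := F0 i ik; split=> [|v].
      by rewrite -[RHS]e1; apply: ev_ext => // j _; rewrite /c1 insK.
    by rewrite -[RHS](e2 v); apply: D_ext => // j _; rewrite /c1 insK.
  by rewrite -[RHS](F2 i ik); apply: ev_ext => // j _; rewrite /c1 insK.
have n2 : nondeg (Sys (fam 0 k ++ fam 1 g.+3) [::] (fam 2 s1) [:: blockL]) 3 g.+3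
    (fun l => c2 (sg l)).
  apply: nondeg_local nB => -[f i] j; rewrite !mem_cat => lS _.
  by case/orP: lS => [/orP[]|] /mapP[j'] _ [-> ->].
have [t [nA' nB']] := almost_all_ex (almost_all_and (nondeg_del c2 g0 n1)
  (nondeg_line1 (fun l => c1 (sg l)) (ltn0Sn _) n2)).
pose c := line c1 c2 t.
exists (fun i => if (i < k)%N then c (0%N, i) else c (1, i - k)%N),
       (fun i => if (i < s)%N then c (2%N, i) else c (3, i - s)%N) => F Fd Fs.
have F0 i : (i < k)%N -> dbl F (c (0%N, i)).
  by move=> ik; have := Fd i; rewrite ik; apply; lia.
have F1 i : (i < g.+3)%N -> dbl F (c (1%N, i)).
  move=> ik; have := Fd (k + i)%N; rewrite [(k + i < k)%N]ltnNge leq_addr /= addKn; apply; lia.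
have F2 i : (i < s)%N -> ev F (c (2%N, i)) = 0.
  by move=> ik; have := Fs i; rewrite ik; apply; lia.
have F3 i : (i < s1)%N -> ev F (c (3%N, i)) = 0.
  move=> ik; have := Fs (s + i)%N; rewrite [(s + i < s)%N]ltnNge leq_addr /= addKn; apply; lia.
have [F' [rd re rv rN]] := restrict_block F (leq0n g).
have on0 i : {in blockL, forall j, c (0%N, i) j = 0}.
  by apply: line_block => j jL; [rewrite /c1 /= ins_block | exact: cB0].
have on2 i : {in blockL, forall j, c (2%N, i) j = 0}.
  by apply: line_block => j jL; rewrite /c1 /= ?ins_block.
have F'0 : F' =1 (fun=> 0).
  apply: nA'; split=> //; apply/famP => i ik.
    by apply: rd; [exact: on0 | exact: F0].
  by apply: re; [exact: on2 | exact: F2].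
apply: nB'; split=> //.
- by apply/in_catP; split; apply/famP => i ik; [exact: F0 | exact: F1].
- by apply/famP => i ik; apply: F3.
- by move=> B; rewrite inE => /eqP ->; exact: rN.
Qed.

Lemma good_check d g dp sp : (check d g dp sp [::]) -> good K d g (size dp) (size sp).
Proof.
move/(checkP (K := K)) => h.
exists (fun i => npt K (nth [::] dp i)), (fun i => npt K (nth [::] sp i)) => F Fd Fs.
apply: h => //.
  move=> x xin v; have := Fd (index x dp); rewrite index_mem => /(_ xin)[_ h'].
  by rewrite -[RHS](h' v) nth_index.
by move=> x xin; rewrite -(Fs (index x sp)) ?index_mem // nth_index.
Qed.

Lemma pts_block seed k g B i : {in B, forall j, npt K (nth [::] (pts seed k g B) i) j = 0}.
Proof.
move=> j jB; rewrite /npt.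
have [ik|ki] := ltnP i k; last first.
  by rewrite [nth [::] _ i]nth_default ?nth_nil ?size_mkseq.
have [jg|gj] := ltnP j g; last first.
  by rewrite /pts nth_mkseq // nth_default ?size_mkseq.
by rewrite /pts nth_mkseq // nth_mkseq // jB.
Qed.

Definition fams (s0 s1 s2 : seq (seq N)) (l : nat * nat) : nat -> K :=
  npt K (nth [::] (nth [::] [:: s0; s1; s2] l.1) l.2).

Lemma T1_check g a s sd0 sd1 sd2 :
  check 3 g (pts sd0 a g blockL ++ pts sd1 g g [::] ++ [::]) (pts sd2 s g [::]) [:: blockL] ->
  T1 K g a s.
Proof.
move=> ck; exists (fams (pts sd0 a g blockL) (pts sd1 g g [::]) (pts sd2 s g [::])).
split=> [i|]; first exact: pts_block.
have sz sd k B : size (pts sd k g B) = k by rewrite size_mkseq.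
move=> F [] /in_catP[/famP F0 /famP F1] _ /famP F2 FB; apply: (checkP ck) => //.
- move=> x; rewrite cats0 mem_cat => /orP[] xin v.
    have /F0[_ /(_ v)] : (index x (pts sd0 a g blockL) < a)%N.
      by rewrite -[X in (_ < X)%N](sz sd0 a blockL) index_mem.
    by rewrite /fams /= nth_index.
  have /F1[_ /(_ v)] : (index x (pts sd1 g g [::]) < g)%N.
     by rewrite -[X in (_ < X)%N](sz sd1 g [::]) index_mem.
  by rewrite /fams /= nth_index.
- move=> x xin.
  have /F2 : (index x (pts sd2 s g [::]) < s)%N by rewrite -[X in (_ < X)%N](sz sd2 s [::]) index_mem.
  by rewrite /fams /= nth_index.
Qed.

Lemma nondeg3_check g Bs k0 k1 k2 sd0 sd1 sd2 B0 B1 B2 :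
  check 3 g (pts sd0 k0 g B0 ++ pts sd1 k1 g B1 ++ pts sd2 k2 g B2) [::] Bs ->
  nondeg (Sys (fam 0 k0 ++ fam 1 k1 ++ fam 2 k2) [::] [::] Bs) 3 g
    (fams (pts sd0 k0 g B0) (pts sd1 k1 g B1) (pts sd2 k2 g B2)).
Proof.
move=> ck; have sz sd k B : size (pts sd k g B) = k by rewrite size_mkseq.
move=> F [] /in_catP[/famP F0 /in_catP[/famP F1 /famP F2]] _ _ FB; apply: (checkP ck) => //.
move=> x; rewrite !mem_cat => /or3P[] xin v.
- have /F0[_ /(_ v)] : (index x (pts sd0 k0 g B0) < k0)%N.
      by rewrite -[X in (_ < X)%N](sz sd0 k0 B0) index_mem.
  by rewrite /fams /= nth_index.
- have /F1[_ /(_ v)] : (index x (pts sd1 k1 g B1) < k1)%N.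
      by rewrite -[X in (_ < X)%N](sz sd1 k1 B1) index_mem.
  by rewrite /fams /= nth_index.
- have /F2[_ /(_ v)] : (index x (pts sd2 k2 g B2) < k2)%N.
      by rewrite -[X in (_ < X)%N](sz sd2 k2 B2) index_mem.
  by rewrite /fams /= nth_index.
Qed.

Lemma T2_check g sd0 sd1 sd2 :
  check 3 g (pts sd0 (g - 3) g blockL ++ pts sd1 (g - 3) g blockM ++ pts sd2 3 g [::]) [::]
    [:: blockL; blockM] -> T2 K g.
Proof.
move=> ck; exists (fams (pts sd0 (g - 3) g blockL) (pts sd1 (g - 3) g blockM) (pts sd2 3 g [::])).
by split=> [i|i|]; [exact: pts_block | exact: pts_block | exact: nondeg3_check].
Qed.

Lemma meets_disjoint2 (A B : seq nat) g (m : mon 1 g) :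
  (forall j, j \in A -> j \in B = false) -> meets A m -> meets B m = false.
Proof.
move=> AB; elim: g m => [[]|g IH]; apply: monP => m; first by rewrite !meetsl; exact: IH.
by rewrite !meetsr !meets0 !orbF => /AB.
Qed.

Lemma meets_disjoint3 (A B C : seq nat) g (m : mon 2 g) :
  (forall j, j \in A -> j \in B = false) -> (forall j, j \in A -> j \in C = false) ->
  (forall j, j \in B -> j \in C = false) ->
  meets A m -> meets B m -> meets C m = false.
Proof.
move=> AB AC BC; elim: g m => [[]|g IH]; apply: monP => m; first by rewrite !meetsl; exact: IH.
rewrite !meetsr => /orP[gA|mA].
  by rewrite (AB g gA) (AC g gA) /=; exact: meets_disjoint2.
case/orP => [gB|mB]; first by rewrite (BC g gB) (meets_disjoint2 AC mA).
by have := meets_disjoint2 AB mA; rewrite mB.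
Qed.

(* For g >= 9 the forms in question involve only the first 9 variables. *)
Lemma T3_stable g : T3 K 9 -> (9 <= g)%N -> T3 K g.
Proof.
case=> c [c0 c1 c2 nc] g9.
pose e (l : nat * nat) i := if (i < 9)%N then c l i else 0.
have on f b : {in block b, forall j, c f j = 0} -> {in block b, forall j, e f j = 0}.
  by move=> h j jb; rewrite /e h // if_same.
exists e; split=> [i|i|i|]; try (apply: on; done).
have {nc on} : nondeg (Sys (fam 0 3 ++ fam 1 3 ++ fam 2 3) [::] [::] [:: blockL; blockM; blockN]) 3 9 e.
  by apply: nondeg_local nc => l i _ i9; rewrite /e i9.
elim: g g9 => // g IH; rewrite leq_eqVlt => /predU1P[<- //|]; rewrite ltnS => g9 /(IH g9) {}IH.
move=> F [] Fd _ _ /in_seq3[FL FM FN].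
have eg l : e l g = 0 by rewrite /e ltnNge g9.
apply: monP => m.
  apply: (IH (fun m => F (monl m))); split=> //; last first.
    by apply/in_seq3; split=> m' mB; [apply: FL | apply: FM | apply: FN]; rewrite meetsl.
  move=> l /Fd[e1 e2]; split=> [|v]; first by rewrite -[RHS]e1 evS eg mul0r addr0.
  pose v' i := if i == g then 0 else v i.
  rewrite -[RHS](e2 v') DS eg /v' eqxx !mul0r !addr0; apply: D_ext => // i ig.
  by rewrite ltn_eqF.
have gB b : (b + 3 <= 9)%N -> meets (block b) (monr m) = meets (block b) m.
  by move=> b9; rewrite meetsr !inE; case: (meets _ m); rewrite ?orbT // orbF; lia.
have [mL|/negP mL] := boolP (meets blockL m); last by apply: FL; rewrite gB //; exact/negP.
have [mM|/negP mM] := boolP (meets blockM m); last by apply: FM; rewrite gB //; exact/negP.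
apply: FN; rewrite gB //.
by rewrite (meets_disjoint3 _ _ _ mL mM) // => j; rewrite !inE; lia.
Qed.

End CubicChain.

(** * Base cases for cubics, and quartics in six variables *)

Section BaseCases.

Lemma check_T3_9 : check 3 9
  (pts 1 3 9 blockL ++ pts 2 3 9 blockM ++ pts 3 3 9 blockN) [::] [:: blockL; blockM; blockN].
Proof. by vm_compute. Qed.

Lemma check_T2_6 : check 3 6
  (pts 1 3 6 blockL ++ pts 2 3 6 blockM ++ pts 3 3 6 [::]) [::] [:: blockL; blockM].
Proof. by vm_compute. Qed.

Lemma check_T2_7 : check 3 7
  (pts 1 4 7 blockL ++ pts 2 4 7 blockM ++ pts 3 3 7 [::]) [::] [:: blockL; blockM].
Proof. by vm_compute. Qed.

Lemma check_T2_8 : check 3 8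
  (pts 1 5 8 blockL ++ pts 2 5 8 blockM ++ pts 3 3 8 [::]) [::] [:: blockL; blockM].
Proof. by vm_compute. Qed.

Lemma check_T1_4 : check 3 4
  (pts 1 1 4 blockL ++ pts 2 4 4 [::] ++ [::]) (pts 77 0 4 [::]) [:: blockL].
Proof. by vm_compute. Qed.

Lemma check_T1_8 : check 3 8
  (pts 1 7 8 blockL ++ pts 2 8 8 [::] ++ [::]) (pts 77 0 8 [::]) [:: blockL].
Proof. by vm_compute. Qed.

Lemma check_T1_6_floor : check 3 6
  (pts 1 3 6 blockL ++ pts 2 6 6 [::] ++ [::]) (pts 77 1 6 [::]) [:: blockL].
Proof. by vm_compute. Qed.

Lemma check_T1_6_ceil : check 3 6
  (pts 1 4 6 blockL ++ pts 2 6 6 [::] ++ [::]) (pts 77 0 6 [::]) [:: blockL].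
Proof. by vm_compute. Qed.

Lemma check_T0_2 : check 3 2 (pts 1 2 2 [::]) [::] [::].
Proof. by vm_compute. Qed.

Lemma check_T0_3_floor : check 3 3 (pts 1 3 3 [::]) (pts 77 1 3 [::]) [::].
Proof. by vm_compute. Qed.

Lemma check_T0_3_ceil : check 3 3 (pts 1 4 3 [::]) [::] [::].
Proof. by vm_compute. Qed.

Lemma check_T0_4 : check 3 4 (pts 1 5 4 [::]) [::] [::].
Proof. by vm_compute. Qed.

Lemma check_T0_5_floor : check 3 5 (pts 1 6 5 [::]) (pts 77 5 5 [::]) [::].
Proof. by vm_compute. Qed.

Lemma check_T0_5_ceil : check 3 5 (pts 1 8 5 [::]) [::] [::].
Proof. by vm_compute. Qed.

Lemma check_T0_6_floor : check 3 6 (pts 1 9 6 [::]) (pts 77 2 6 [::]) [::].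
Proof. by vm_compute. Qed.

Lemma check_T0_6_ceil : check 3 6 (pts 1 10 6 [::]) [::] [::].
Proof. by vm_compute. Qed.

(** After a change of coordinates, g general points may be taken to be the coordinate points, whose
    rows are sparse. *)
Lemma check_T0_8 : check 3 8 (coord_pts 8 ++ pts 1 7 8 [::]) [::] [::].
Proof. by vm_compute. Qed.

Lemma check_quartic_6 : check 4 6 (coord_pts 6 ++ pts 1 15 6 [::]) [::] [::].
Proof. by vm_compute. Qed.

End BaseCases.

Definition exceptional (d g k : nat) : bool :=
  (d, g, k) \in [:: (3, 5, 7); (4, 3, 5); (4, 4, 9); (4, 5, 14)].

Section CubicMain.
Variable K : numFieldType.

(** The simple points express independence also when the double points alone leave forms: filling up
    the dimension with them leaves none. *)
Definition interpolates d g := forall k s,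
  ~~ exceptional d g k -> ('C(g.-1 + d, d) <= g * k + s)%N -> good K d g k s.

(** Below k0, surplus double points are traded for simple ones by [good_swapn]; above k1, adding
    points is harmless. Only k strictly between the two ends has to be excluded. *)
Lemma interpolates_ends d g k0 s0 k1 : (0 < d)%N ->
  good K d g k0 s0 -> good K d g k1 0 -> (g * k0 + s0 <= 'C(g.-1 + d, d))%N ->
  (forall k, ~~ exceptional d g k -> (k <= k0)%N || (k1 <= k)%N) -> interpolates d g.
Proof.
move=> d0 g0 g1 e0 ek k s /ek/orP[kk|kk] h; last exact: good_le kk _ g1.
have := @good_swapn K d g k (k0 - k) s0 d0; rewrite subnK // => /(_ g0).
apply: good_le => //; rewrite -(leq_add2l (g * k)); apply: leq_trans h.
by apply: leq_trans e0; rewrite addnA mulnC -mulnDl subnKC // mulnC.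
Qed.

Lemma T3_all g : (9 <= g)%N -> T3 K g.
Proof.
apply: T3_stable; exists (fams K (pts 1 3 9 blockL) (pts 2 3 9 blockM) (pts 3 3 9 blockN)).
by split=> [i|i|i|]; [exact: pts_block | exact: pts_block | exact: pts_block |
  exact: (nondeg3_check check_T3_9)].
Qed.

Lemma T2_all g : (6 <= g)%N -> T2 K g.
Proof.
elim/ltn_ind: g => g IH g6; have [g9|g9] := leqP 9 g; last first.
  have : g \in [:: 6; 7; 8]%N by rewrite !inE; lia.
  rewrite !inE => /or3P[] /eqP ->.
  - exact: (@T2_check K 6 _ _ _ check_T2_6).
  - exact: (@T2_check K 7 _ _ _ check_T2_7).
  - exact: (@T2_check K 8 _ _ _ check_T2_8).
have -> : g = (g - 3).+3 by lia.
apply: T2_step; [lia | apply: IH; lia | apply: T3_all; lia].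
Qed.

(** Along the chain the number a + g of double points differs from (g+1)(g+2)/6 by the constant (f -
    e)/6; e and f are separate because they are naturals. *)
Lemma cubic_chain g0 a0 s0 s1 e f j : (4 <= g0)%N -> T1 K g0 a0 s1 ->
  good K 3 g0 (a0 + g0) s0 -> (6 * (a0 + g0) + e = g0.+1 * g0.+2 + f)%N ->
  exists a, let g := (g0 + 3 * j)%N in
    [/\ T1 K g a s1, good K 3 g (a + g) (s0 + j * s1)
      & (6 * (a + g) + e = g.+1 * g.+2 + f)%N].
Proof.
move=> g04 t1 g1 eq0; elim: j => [|j [a [ta ga ea]]].
  by exists a0; rewrite muln0 mul0n !addn0.
pose g := (g0 + 3 * j)%N; rewrite -/g in ta ga ea.
have -> : (g0 + 3 * j.+1 = g.+3)%N by rewrite /g; lia.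
have t1' : T1 K g.+3 (a + g) s1.
  by apply: T1_step => //; [rewrite /g; lia | apply: T2_all; rewrite /g; lia].
exists (a + g)%N; split=> //; last by lia.
have -> : (s0 + j.+1 * s1 = s0 + j * s1 + s1)%N by lia.
by apply: T0_step => //; rewrite /g; lia.
Qed.

Lemma binomial3 g : (0 < g)%N -> (6 * 'C(g.-1 + 3, 3) = g * g.+1 * g.+2)%N.
Proof.
case: g => // g _; have := bin_ffact (g + 3) 3.
by rewrite mulnC => ->; rewrite addn3 !ffactnS ffactn0; lia.
Qed.

(** The critical number (g+1)(g+2)/6 is an integer unless 3 divides g, so only that residue class
    needs separate chains for floor and ceiling. The class of 2 modulo 3 starts at 8 because g = 5
    is exceptional. *)
Lemma cubic_interpolates g : (2 <= g)%N -> interpolates 3 g.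
Proof.
move=> g2; have g0 : (0 < g)%N := ltnW g2.
have [|g6] := ltnP g 6.
  move=> g6; have : g \in [:: 2; 3; 4; 5]%N by rewrite !inE; lia.
  rewrite !inE => /or4P[] /eqP ->.
  - apply: (@interpolates_ends 3 2 2 0 2) => //; last by move=> k _; lia.
    + exact: (good_check K check_T0_2).
    + exact: (good_check K check_T0_2).
  - apply: (@interpolates_ends 3 3 3 1 4) => //; last by move=> k _; lia.
    + exact: (good_check K check_T0_3_floor).
    + exact: (good_check K check_T0_3_ceil).
  - apply: (@interpolates_ends 3 4 5 0 5) => //; last by move=> k _; lia.
    + exact: (good_check K check_T0_4).
    + exact: (good_check K check_T0_4).
  - apply: (@interpolates_ends 3 5 6 5 8) => //.
    + exact: (good_check K check_T0_5_floor).
    + exact: (good_check K check_T0_5_ceil).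
    + move=> k; rewrite /exceptional !inE /= => kk.
      by have : k != 7%N; [move: kk; apply: contraNneq => -> | lia].
have [gj|[gj|gj]] : (exists j, g = 6 + 3 * j)%N \/ (exists j, g = 4 + 3 * j)%N \/
    (exists j, g = 8 + 3 * j)%N.
- have := divn_eq g 3; have : (g %% 3 < 3)%N by rewrite ltn_mod.
  case: (g %% 3)%N => [|[|[|//]]] _ ge.
  + by left; exists (g %/ 3 - 2)%N; lia.
  + by right; left; exists (g %/ 3 - 1)%N; lia.
  + by right; right; exists (g %/ 3 - 2)%N; lia.
- case: gj => j gE.
  have [a0 [_ h0 e0]] := @cubic_chain 6 3 2 1 2 0 j isT (T1_check K check_T1_6_floor)
    (good_check K check_T0_6_floor) erefl.
  have [a1 [_ h1 e1]] := @cubic_chain 6 4 0 0 0 4 j isT (T1_check K check_T1_6_ceil)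
    (good_check K check_T0_6_ceil) erefl.
  rewrite muln1 -gE in h0 e0; rewrite muln0 -gE in h1 e1.
  apply: (interpolates_ends _ h0 h1) => //; last by move=> k _; lia.
  by rewrite -(leq_pmul2l (isT : 0 < 6)%N) binomial3 //; nia.
- case: gj => j gE.
  have [a0 [_ h0 e0]] := @cubic_chain 4 1 0 0 0 0 j isT (T1_check K check_T1_4)
    (good_check K check_T0_4) erefl.
  rewrite muln0 -gE in h0 e0.
  apply: (interpolates_ends _ h0 h0) => //; last by move=> k _; lia.
  by rewrite -(leq_pmul2l (isT : 0 < 6)%N) binomial3 //; nia.
- case: gj => j gE.
  have [a0 [_ h0 e0]] := @cubic_chain 8 7 0 0 0 0 j isT (T1_check K check_T1_8)
    (good_check K check_T0_8) erefl.
  rewrite muln0 -gE in h0 e0.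
  apply: (interpolates_ends _ h0 h0) => //; last by move=> k _; lia.
  by rewrite -(leq_pmul2l (isT : 0 < 6)%N) binomial3 //; nia.
Qed.

Lemma dmon1 (R : comNzRingType) g (m : mon 1 g) (x v : nat -> R) : dmon m x v = monval m v.
Proof.
elim: g m => [[]|g IH]; apply: monP => m; first by rewrite !monE IH.
by rewrite !monE mulr0 addr0.
Qed.

Lemma quadric_good g : good K 2 g g 0.
Proof.
exists (unitv K), (fun _ _ => 0) => F Fd _.
elim: g F Fd => [|g IH] F Fd; first by case.
have Fl0 : (fun m => F (monl m)) =1 (fun=> 0).
  apply: IH => i ig; have [e1 e2] := Fd i (ltnW ig).
  have ui : unitv K i g = 0 by rewrite /unitv gtn_eqF.
  split=> [|v]; first by rewrite -[RHS]e1 evS ui mul0r addr0.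
  pose v' i := if i == g then 0 else v i.
  rewrite -[RHS](e2 v') DS ui /v' eqxx !mul0r !addr0; apply: D_ext => // j jg.
  by rewrite ltn_eqF.
have Fri i : (i < g.+1)%N -> ev (fun m => F (monr m)) (unitv K i) = 0.
  move=> ig; have [_ /(_ (unitv K g))] := Fd i ig.
  rewrite DS (D_eq0 _ _ Fl0) add0r /unitv eqxx mul1r -/(unitv K i) -/(unitv K g).
  have [<-|ig'] := eqVneq g i; last by rewrite mul0r addr0.
  by rewrite D_euler !mul1r -mulr2n => /eqP; rewrite mulrn_eq0 => /eqP.
apply: monP => m; first exact: Fl0.
apply: (@ev_inj K 1 g.+1 (fun m => F (monr m))) => x.
transitivity (D (fun m => F (monr m)) x x).
  by apply: eq_bigr => m' _; rewrite dmon1.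
rewrite D_coord big1 // => j _.
have -> : D (fun m => F (monr m)) x (unitv K j) = ev (fun m => F (monr m)) (unitv K j).
  by apply: eq_bigr => m' _; rewrite dmon1.
by rewrite Fri ?mulr0.
Qed.

Lemma linear_good g : good K 1 g 1 0.
Proof.
exists (fun _ _ => 0), (fun _ _ => 0) => F /(_ 0%N isT)[_ Fd] _; apply: ev_inj => x.
by rewrite -[RHS](Fd x); apply: eq_bigr => m _; rewrite dmon1.
Qed.

End CubicMain.

(** * The Alexander-Hirschowitz theorem *)

Section Arithmetic.
Local Open Scope nat_scope.

(* Numerical conditions under which u double points can be put on the hyperplane and
   e more can be let approach it, s1 of the simple points going on the hyperplane. *)
Definition stepb (d g k s u e s1 : nat) : bool :=
  let n := g.-1 in
  [&& u + e <= k, s1 <= s, e <= n, ~~ exceptional d n u,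
      'C(n.-1 + d, d) <= n * u + (e + s1), ~~ exceptional d.-1 g (k - u),
      'C(n + d.-1, d.-1) - g * (k - u) + e <= u + (s - s1) &
      if d == 4 then g <= k - u - e else
      ~~ exceptional d.-2 g (k - u - e) && ('C(n + d.-2, d.-2) <= g * (k - u - e))].

(** The standard splitting fills the trace exactly: all simple points go on the hyperplane, u is the
    quotient of what is left by the g - 1 conditions of a double point there, and e is the
    remainder. *)
Definition formula_step (d g k s : nat) : bool :=
  let m := 'C(g.-2 + d, d) - s in stepb d g k s (m %/ g.-1) (m %% g.-1) s.

Definition end_steps (d g : nat) : bool :=
  let N := 'C(g.-1 + d, d) in
  formula_step d g (N %/ g) (N %% g) && formula_step d g (N %/ g + (N %% g != 0)) 0.

Lemma end_steps_small :
  all (end_steps 5) [:: 2; 3; 4; 5] && all (end_steps 6) [:: 2; 3; 4; 5] &&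
  all (end_steps 4) [:: 2; 7; 9; 10].
Proof. by vm_compute. Qed.

Lemma pascal n d : 'C(n.+1 + d.+1, d.+1) = 'C(n + d.+1, d.+1) + 'C(n.+1 + d, d).
Proof. by rewrite addSn binS addSnnS. Qed.

Lemma bin4 n : 24 * 'C(n + 4, 4) = n.+1 * n.+2 * n.+3 * n.+4.
Proof.
have := bin_ffact (n + 4) 4; rewrite mulnC => ->.
by rewrite addn4 !ffactnS ffactn0; lia.
Qed.

Lemma bin3 n : 6 * 'C(n + 3, 3) = n.+1 * n.+2 * n.+3.
Proof.
have := bin_ffact (n + 3) 3; rewrite mulnC => ->.
by rewrite addn3 !ffactnS ffactn0; lia.
Qed.

Lemma bin_mono n d e : d <= e -> 'C(n + d, d) <= 'C(n + e, e).
Proof.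
move=> de; rewrite -(subnK de); elim: (e - d) => // j IH.
by rewrite addSn addnS binS; exact: leq_trans IH (leq_addl _ _).
Qed.

Lemma quartic_bound n : 9 <= n -> 8 * (2 * (n * n) + 5 * n + 4) <= n.+2 * n.+3 * n.+4.
Proof. by move=> n9; have [j ->] : exists j, n = j + 9 by [exists (n - 9); lia]; nia. Qed.

Lemma quintic_bound n : 0 < n -> 30 * n.+1 <= n.+2 * n.+3 * n.+4.
Proof. by case: n => // n _; nia. Qed.

Lemma trace_bound n : 24 * n.+1 <= n.+2 * n.+3 * n.+4.
Proof. by nia. Qed.

(** Once trace and residual are counted, the condition in degree d - 2 reduces to u + n e <= B,
    where B counts the monomials of degree d - 1 in n variables. For d >= 5 this is [keyB], obtained
    from e < n and the size of B. For d = 4 the quadrics require n + 1 double points whatever their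
    dimension; this is [key4], and the reason for 10 <= n. *)
Lemma end_numerics d n k s : 4 <= d -> 1 <= n -> s <= n -> (5 <= d) || (10 <= n) ->
  'C(n + d, d) <= n.+1 * k + s ->
  (s = 0) \/ n.+1 * k + s = 'C(n + d, d) ->
  let m := 'C(n.-1 + d, d) - s in let u := m %/ n in let e := m %% n in
  [/\ u + e <= k, 'C(n.-1 + d, d) <= n * u + (e + s),
      'C(n + d.-1, d.-1) - n.+1 * (k - u) + e <= u + 0,
      5 <= d -> 'C(n + d.-2, d.-2) <= n.+1 * (k - u - e)
    & d = 4 -> n.+1 <= k - u - e].
Proof.
case: d => [|[|[|d]]] //; case: n => [//|n] d4 _ sn dn kN sN.
rewrite -[n.+1.-1]/n -[d.+3.-1]/d.+2 -[d.+3.-2]/d.+1.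
set T := 'C(n + d.+3, d.+3) => m u e.
set B := 'C(n + d.+2, d.+2).
have NE : 'C(n.+1 + d.+3, d.+3) = T + 'C(n.+1 + d.+2, d.+2) by exact: pascal.
have NE' : 'C(n.+1 + d.+2, d.+2) = B + 'C(n.+1 + d.+1, d.+1) by exact: pascal.
set N1 := 'C(n.+1 + d.+2, d.+2) in NE NE' *.
set N2 := 'C(n.+1 + d.+1, d.+1) in NE' *.
have TB : d.+3 * T = (n + d.+3) * B.
  by rewrite /T /B -mul_bin_diag addnS.
have meq : n.+1 * u + e = m by rewrite /u /e mulnC -divn_eq.
have en : e < n.+1 by rewrite ltn_mod.
have d1 : 1 <= d by lia.
have T4 : 'C(n + 4, 4) <= T by apply: bin_mono.
have t4 := bin4 n.
have Tn : n.+1 * n.+1 <= T.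
  by have := leq_mul (leqnn n.+1) (trace_bound n); lia.
have sT : s <= T by lia.
have msT : m + s = T by rewrite subnK.
have ue : e <= u.
  case: (leqP e u) => // ue.
  have : n.+1 * u.+1 <= n.+1 * n by rewrite leq_mul2l /=; lia.
  by lia.
have gk : m + N1 <= n.+2 * k by lia.
have key0 X : X = n.+1 * n.+1 -> n.+1 * (u + n.+1 * e) <= T + X * n.
  move=> ->; have : n.+1 * n.+1 * e <= n.+1 * n.+1 * n by rewrite leq_mul2l; lia.
  by lia.
have keyB : 5 <= d.+3 -> u + n.+1 * e <= B.
  move=> d5; case: (posnP n) => [n0|n0].
    have B1 : B = 1 by rewrite /B n0 add0n binn.
    have T1 : T = 1 by rewrite /T n0 add0n binn.
    have nu0 : n * u = 0 by rewrite n0.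
    have ne0 : n * e = 0 by rewrite n0.
    by lia.
  have B4 : 'C(n + 4, 4) <= B by apply: bin_mono.
  have h1 : 5 * (n.+1 * n.+1) <= 4 * B.
    by have := leq_mul (leqnn n.+1) (quintic_bound n0); lia.
  have [X XE] : {X | X = n.+1 * n.+1} by exists (n.+1 * n.+1).
  rewrite -XE in h1.
  have h2 : d.+3 * X <= d.+2 * B.
    have a1 : 4 * d.+3 * X <= 5 * d.+2 * X by rewrite leq_mul2r; lia.
    have := leq_mul (leqnn d.+2) h1; lia.
  have h3 := leq_mul (leqnn n) h2.
  have h5 : T + X * n <= n.+1 * B.
    rewrite -(leq_pmul2l (ltn0Sn d.+2)); lia.
  rewrite -(leq_pmul2l (ltn0Sn n)); apply: leq_trans h5; exact: key0.
have key4 : d.+3 = 4 -> n.+2 * n.+2 + u + n.+1 * e <= N1.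
  move=> [dE]; have n9 : 9 <= n by lia.
  have N1E : N1 = 'C(n.+1 + 3, 3) by rewrite /N1 dE.
  have t3 := bin3 n.+1; rewrite -N1E in t3.
  have TE : T = 'C(n + 4, 4) by rewrite /T dE.
  rewrite -TE in t4.
  have h := key0 _ erefl.
  have h7 := leq_mul (leqnn n.+1) (quartic_bound n9).
  have h8 := f_equal (muln n.+1) t3.
  rewrite -(leq_pmul2l (ltn0Sn n)).
  by lia.
have uek : u + e <= k.
  suff : n.+2 * (u + e) <= n.+2 * k by rewrite leq_pmul2l.
  have BN : B <= N1 by lia.
  case: (leqP 5 d.+3) => d5; first by have := keyB d5; lia.
  by have := key4 (_ : d.+3 = 4); lia.
have uk : n.+2 * (k - u) = n.+2 * k - n.+2 * u by rewrite mulnBr.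
have ruk : n.+2 * (k - u - e) = n.+2 * k - n.+2 * u - n.+2 * e by rewrite !mulnBr.
clear key0 T4 t4 TB Tn NE; split=> //.
- by clear -meq msT; lia.
- by clear -uk meq msT gk ue; lia.
- by move=> d5; have := keyB d5; clear -ruk meq msT gk NE'; lia.
- move=> dE; have h := key4 dE.
  by rewrite -(leq_pmul2l (ltn0Sn n.+1)) ruk; lia.
Qed.

Lemma not_exceptional d g k : (5 <= d) || (6 <= g) -> ~~ exceptional d g k.
Proof.
by rewrite /exceptional !inE => dg; apply/negP => /or4P[] /eqP [dE gE _];
  rewrite dE gE in dg.
Qed.

Lemma end_steps_large d g : 2 <= g ->
  (7 <= d) || (5 <= d) && (6 <= g) || (d == 4) && (11 <= g) -> end_steps d g.
Proof.
move=> g2 dg; have d4 : 4 <= d by lia.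
case: g g2 dg => // n n1 dg.
have step k s : s <= n -> 'C(n + d, d) <= n.+1 * k + s ->
    (s = 0) \/ n.+1 * k + s = 'C(n + d, d) -> formula_step d n.+1 k s.
  move=> sn kN sN; rewrite /formula_step /stepb /=.
  have [|h1 h2 h3 h4 h5] := @end_numerics d n k s d4 n1 sn _ kN sN; first by lia.
  rewrite h1 leqnn h2 subnn h3 !not_exceptional ?andbT /=; try lia.
  rewrite (ltnW (ltn_pmod _ n1)) /=; case: eqP => d4'; first exact: h5.
  by rewrite h4 ?not_exceptional //; lia.
apply/andP; set N := 'C(_, _); have NE := divn_eq N n.+1; have rn := ltn_pmod N (ltn0Sn n).
split; apply: step => //=; rewrite -/N.
- by lia.
- by right; lia.
- case: eqP => r0; first by lia.
  by rewrite addn1; nia.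
- by left.
Qed.

End Arithmetic.

Section Main.
Variable K : numFieldType.

Lemma horace_step d g k s u e s1 : (4 <= d)%N -> (2 <= g)%N -> interpolates K d g.-1 ->
  interpolates K d.-1 g -> ((5 <= d)%N -> interpolates K d.-2 g) ->
  stepb d g k s u e s1 -> good K d g k s.
Proof.
case: g => // n; case: d => [|[|d]] // d4 n1 iT iR iK.
case/and5P=> uek s1s en nxT /and4P[cT nxR cR cK].
have -> : k = (u + e + (k - u - e))%N by lia.
have -> : s = (s1 + (s - s1))%N by lia.
(* The last argument is the number of simple points that complete the k - u double points in the
   residual degree. *)
apply: (@horace K d n u e (k - u - e) s1 (s - s1)
   ('C(n + d.+1, d.+1) - n.+1 * (k - u))%N) => //=.
- exact: iT.
- have -> : (e + (k - u - e) = k - u)%N by lia.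
  by apply: iR => //=; rewrite -leq_subLR.
- move: cK; case: eqP => [[->] gk|d4' /andP[nxK cK]].
    exact: good_le gk _ (quadric_good K n.+1).
  by apply: iK => //; [lia | rewrite addn0].
Qed.

Lemma one_variable_good d k s : (0 < d)%N -> (0 < k + s)%N -> good K d 1 k s.
Proof.
move=> d0 ks; exists (fun _ _ => 1), (fun _ _ => 1) => F Fd Fs.
have : ev F (fun=> 1) = 0.
  case: k ks Fd => [|k] ks Fd; last by case: (Fd 0%N isT).
  exact: (Fs 0%N ks).
case: d d0 F {Fd Fs} => // d _ F.
have evr e (G : mon e.+1 1 -> K) : ev G (fun=> 1) = ev (fun m => G (monr m)) (fun=> 1).
  rewrite evS mul1r [X in X + _](_ : _ = 0) ?add0r //.
  by rewrite /ev big1 // => -[].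
elim: d F => [|d IH] F; rewrite evr.
  by rewrite /ev big_mon0 monE mulr1 => F0; apply: monP => -[].
by move/IH => F0; apply: monP => m; [case: m | exact: F0].
Qed.

Lemma interpolates1 d : (0 < d)%N -> interpolates K d 1.
Proof.
move=> d0 k s _; rewrite add0n binn mul1n; exact: one_variable_good.
Qed.

Lemma interpolates_steps d g : (4 <= d)%N -> (2 <= g)%N ->
  (~~ ((d == 4) && (g \in [:: 3; 4; 5]%N))) -> interpolates K d g.-1 ->
  interpolates K d.-1 g -> ((5 <= d)%N -> interpolates K d.-2 g) ->
  end_steps d g -> interpolates K d g.
Proof.
move=> d4 g2 nx iT iR iK /andP[st0 st1].
apply: interpolates_ends (horace_step d4 g2 iT iR iK st0) (horace_step d4 g2 iT iR iK st1) _ _.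
- by lia.
- by rewrite mulnC -divn_eq.
by move=> k _; case: eqP => _ /=; lia.
Qed.

(** Induction on d + g: the trace loses a variable and the residuals lose degree. The standard
    splitting covers all but the quartics in 3, 4, 5, 6 and 8 variables. *)
Theorem alexander_hirschowitz d g : (3 <= d)%N -> (1 <= g)%N -> interpolates K d g.
Proof.
have [n] := ubnP (d + g); elim: n d g => // n IH d g dgn d3 g1.
have [->|g1'] := eqVneq g 1%N; first by apply: interpolates1; lia.
have g2 : (2 <= g)%N by lia.
have [->|d3'] := eqVneq d 3; first exact: cubic_interpolates.
have d4 : (4 <= d)%N by lia.
have iT : interpolates K d g.-1 by apply: IH; lia.
have iR : interpolates K d.-1 g by apply: IH; lia.
have iK : (5 <= d)%N -> interpolates K d.-2 g by move=> d5; apply: IH; lia.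
have [large|small] := boolP ((7 <= d) || (5 <= d) && (6 <= g) || (d == 4) && (11 <= g))%N.
  by apply: interpolates_steps => //; [rewrite !inE; lia | exact: end_steps_large].
case/andP: end_steps_small => /andP[/allP s5 /allP s6] /allP s4.
have [d5|d5] := leqP 5 d.
  have gin : g \in [:: 2; 3; 4; 5]%N by rewrite !inE; lia.
  have [dE|dE] : d = 5 \/ d = 6 by lia.
    by apply: interpolates_steps => //; [rewrite dE | rewrite dE; exact: s5].
  by apply: interpolates_steps => //; [rewrite dE | rewrite dE; exact: s6].
have dE : d = 4 by lia.
subst d.
have st k s u e s1 : stepb 4 g k s u e s1 -> good K 4 g k s.
  by move=> h; apply: (@horace_step 4 g k s u e s1).
have : (g \in [:: 2; 7; 9; 10]) || (g \in [:: 3; 4; 5; 6; 8])%N by rewrite !inE; lia.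
case/orP => [gin|].
  apply: interpolates_steps => //; last exact: s4.
  by move: gin; rewrite !inE => /or4P[] /eqP ->.
have exc k b : ~~ exceptional 4 b k -> forall x, exceptional 4 b x -> k != x.
  by move=> nk x ex; apply: contraNneq nk => ->.
rewrite !inE => /or4P[/eqP gE|/eqP gE|/eqP gE|/orP[/eqP gE|/eqP gE]]; rewrite {}gE in st *.
(* For g = 3, 4, 5 the exceptional numbers 5, 9, 14 are skipped: the ends are their two
   neighbours. *)
- apply: (@interpolates_ends K 4 3 4 3 6) => //.
  + by apply: (st 4 3 1 0 3)%N; vm_compute.
  + by apply: (st 6 0 2 1 0)%N; vm_compute.
  + by move=> k /exc/(_ 5 isT); lia.
- apply: (@interpolates_ends K 4 4 8 3 10) => //.
  + by apply: (st 8 3 4 0 3)%N; vm_compute.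
  + by apply: (st 10 0 6 0 0)%N; vm_compute.
  + by move=> k /exc/(_ 9 isT); lia.
- apply: (@interpolates_ends K 4 5 13 5 15) => //.
  + by apply: (st 13 5 8 0 3)%N; vm_compute.
  + by apply: (st 15 0 10 0 0)%N; vm_compute.
  + by move=> k /exc/(_ 14 isT); lia.
(* The standard splitting would put 14 double points on a trace in 5 variables, which is
   exceptional. *)
- apply: (@interpolates_ends K 4 6 21 0 21) => //; last by move=> k _; lia.
  + exact: (good_check K check_quartic_6).
  + exact: (good_check K check_quartic_6).
(* For k = 41 the standard splitting has u = 29 and e = 5, leaving 7 double points for the quadrics
   where 8 are needed. Keeping the two simple points off the hyperplane allows u = 30 and e = 0. *)
- apply: (@interpolates_ends K 4 8 41 2 42) => //; last by move=> k _; lia.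
  + by apply: (st 41 2 30 0 0)%N; vm_compute.
  + by apply: (st 42 0 30 0 0)%N; vm_compute.
Qed.

End Main.

(** * The Waring map *)

Section Extension.
Variable K : numClosedFieldType.

Lemma closed_root (p : {poly K}) : (1 < size p)%N -> exists b, p.[b] = 0.
Proof.
by move=> sp; have [|b /eqP pb] := @closed_rootP K p _; [rewrite gtn_eqF | exists b].
Qed.

Lemma nonzero_at (p : {poly K}) : p != 0 -> exists b, p.[b] != 0.
Proof.
move=> p0; pose s : seq K := [seq i%:R | i <- iota 0 (size p)].
have us : uniq s.
  by rewrite map_inj_in_uniq ?iota_uniq // => i j _ _ /eqP; rewrite eqr_nat => /eqP.
have : ~~ all (root p) s.
  by apply: contraL (leqnn (size p)) => /(max_poly_roots p0)/(_ us);
    rewrite size_map size_iota ltnn.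
by case/allPn => t _; exists t.
Qed.

Lemma min_size (T : nzRingType) (Q : {poly T} -> Prop) : (exists p, Q p) ->
  exists p, Q p /\ forall q, Q q -> (size p <= size q)%N.
Proof.
case=> p0 Qp0; pose P n := boolp.asbool (exists2 p, Q p & size p = n).
have exP : exists n, P n by exists (size p0); apply/boolp.asboolP; exists p0.
case: (ex_minnP exP) => n /boolp.asboolP[p Qp sp] min; exists p; split=> // q Qq.
by rewrite sp; apply: min; apply/boolp.asboolP; exists q.
Qed.

Variables (P B : idomainType) (alpha : {rmorphism P -> B}).

Local Notation "p ^a" := (map_poly alpha p) (at level 2, format "p ^a").

(** Drops the top coefficients killed by [alpha], so that size and leading coefficient are those
    seen through [alpha]. *)
Definition trunc (p : {poly P}) : {poly P} := \poly_(i < size p^a) p`_i.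

Lemma truncE p : (trunc p)^a = p^a.
Proof.
apply/polyP => i; rewrite !coef_map coef_poly; case: ltnP => //= si.
by rewrite rmorph0 -coef_map nth_default.
Qed.

Lemma size_trunc p : size (trunc p) = size p^a.
Proof.
apply/eqP; rewrite eqn_leq size_poly /=.
by rewrite -{1}truncE (leq_trans (size_poly _ _)).
Qed.

Lemma lead_trunc p : p^a != 0 -> alpha (lead_coef (trunc p)) != 0.
Proof.
move=> p0; rewrite lead_coefE -coef_map size_trunc truncE.
by rewrite -[_`__]/(lead_coef _) lead_coef_eq0.
Qed.

(* If x is transcendental over the image of alpha, any value of x will do. Otherwise x
   is sent to a root of the image of a relation G of least degree; pseudo-division by G
   shows that all relations are respected, and a multiple w(x) of v(x) of least degree
   is a constant, which keeps v(x) from vanishing. *)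
Lemma extend_point (x : B) (v : {poly P}) : (v^a).[x] != 0 ->
  exists2 u : P, alpha u != 0 & forall phi : {rmorphism P -> K},
    (forall p, alpha p = 0 -> phi p = 0) -> phi u != 0 ->
    exists2 b : K, (map_poly phi v).[b] != 0 &
      forall p : {poly P}, (p^a).[x] = 0 -> (map_poly phi p).[b] = 0.
Proof.
move=> vx.
have kerM (phi : {rmorphism P -> K}) : (forall p, alpha p = 0 -> phi p = 0) ->
    forall p, p^a = 0 -> map_poly phi p = 0.
  move=> ker p p0; apply/polyP => i; rewrite coef_map coef0 /=; apply: ker.
  by rewrite -coef_map p0 coef0.
have [tr|/boolp.existsNP[G0 /boolp.not_implyP[G0x G0N]]] :=
  boolp.pselect (forall p : {poly P}, (p^a).[x] = 0 -> p^a = 0).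
  have va : v^a != 0 by apply: contraNneq vx => ->; rewrite horner0.
  exists (lead_coef (trunc v)); first exact: lead_trunc.
  move=> phi ker phiu; have : map_poly phi v != 0.
    apply: contraNneq phiu => /(congr1 (fun p : {poly K} => p`_(size v^a).-1)).
    rewrite coef_map coef0 lead_coefE size_trunc coef_poly /=.
    by case: ifP => _ phi0; rewrite ?phi0 ?rmorph0.
  case/nonzero_at => b vb; exists b => // p /tr p0.
  by rewrite (kerM phi ker p p0) horner0.
have [G1 [[G1x G1N] Gmin]] := @min_size P (fun G => (G^a).[x] = 0 /\ G^a <> 0)
  (ex_intro _ G0 (conj G0x G0N)).
pose G := trunc G1.
have Gx : (G^a).[x] = 0 by rewrite truncE.
have GN : G^a != 0 by rewrite truncE; apply/eqP.
have sG : size G = size G^a by rewrite size_trunc truncE.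
have small (r : {poly P}) : (size r < size G)%N -> (r^a).[x] = 0 -> r^a = 0.
  move=> rG rx; apply/eqP; apply: contraTT rG => /eqP r0; rewrite -leqNgt.
  by rewrite sG truncE; apply: leq_trans (size_poly _ _) (Gmin _ (conj rx r0)).
have cG : alpha (lead_coef G) != 0 by apply: lead_trunc; apply/eqP.
have G0' : G != 0 by rewrite -size_poly_eq0 sG size_poly_eq0.
pose Q (w : {poly P}) := w^a != 0 /\ exists V : {poly P}, (w^a).[x] = (V^a).[x] * (v^a).[x].
have divE (p q : {poly P}) : alpha (lead_coef q) ^+ Pdiv.Idomain.scalp p q * (p^a).[x] =
    ((Pdiv.Idomain.divp p q)^a).[x] * (q^a).[x] + ((Pdiv.Idomain.modp p q)^a).[x].
  have /(congr1 (fun r => (r^a).[x])) := Pdiv.Idomain.divp_eq p q.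
  by rewrite map_polyZ rmorphD rmorphM /= hornerZ hornerD hornerM rmorphXn.
have Qv : Q (Pdiv.Idomain.modp v G).
  have e := divE v G; rewrite Gx mulr0 add0r in e; split.
    apply: contraNneq vx => r0; move/eqP: e; rewrite r0 horner0 mulf_eq0.
    by rewrite expf_eq0 (negPf cG) andbF.
  exists (lead_coef G ^+ Pdiv.Idomain.scalp v G)%:P.
  by rewrite map_polyC hornerC /= rmorphXn e.
have [w1 [Qw1 wmin]] := min_size (ex_intro _ _ Qv).
pose w := trunc w1.
have Qw : Q w by rewrite /Q truncE.
have sw : size w = size w^a by rewrite size_trunc truncE.
have wmin' q : Q q -> (size w <= size q)%N.
  by move=> /wmin; apply: leq_trans; rewrite size_trunc size_poly.
have [wN [V wV]] := Qw.
have wG : (size w < size G)%N.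
  by apply: leq_ltn_trans (wmin' _ Qv) _; rewrite ltn_modpN0.
have wx : (w^a).[x] != 0 by apply: contraNneq wN => /(small _ wG) ->.
have cw : alpha (lead_coef w) != 0 by apply: lead_trunc; rewrite -truncE.
have w0 : w != 0 by rewrite -size_poly_eq0 sw size_poly_eq0.
(* If w had positive degree, pseudo-dividing G by w would leave either a nonzero remainder, which is
   a smaller element of [Q], or a relation q(x) w(x) = 0, whose factor q is a relation smaller than
   G. *)
have sw1 : size w = 1%N.
  have e := divE G w; rewrite Gx mulr0 in e.
  set q := Pdiv.Idomain.divp G w in e; set r := Pdiv.Idomain.modp G w in e.
  have r0 : r^a = 0.
    apply/eqP; apply: contraT => rN.
    have /wmin' : Q r.
      split=> //; exists (- q * V); rewrite rmorphM rmorphN hornerM hornerN -mulrA -wV.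
      by apply/eqP; rewrite mulNr -addr_eq0 addrC -e.
    by rewrite leqNgt ltn_modpN0.
  move/esym/eqP: e; rewrite r0 horner0 addr0 mulf_eq0 (negPf wx) orbF => /eqP qx.
  have qE : (alpha (lead_coef w) ^+ Pdiv.Idomain.scalp G w) *: G^a = q^a * w^a.
    have /(congr1 (fun r => r^a)) := Pdiv.Idomain.divp_eq G w.
    by rewrite map_polyZ rmorphD rmorphM /= r0 addr0 rmorphXn.
  have qN : q^a != 0.
    apply: contraNneq GN => q0; move/eqP: qE; rewrite q0 mul0r scale_poly_eq0 expf_eq0.
    by rewrite (negPf cw) andbF.
  apply/eqP; rewrite eqn_leq lt0n size_poly_eq0 w0 andbT leqNgt; apply/negP => w2.
  have tqx : ((trunc q)^a).[x] = 0 by rewrite truncE.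
  have /small/(_ tqx)/eqP : (size (trunc q) < size G)%N.
    have := congr1 (size : {poly B} -> nat) qE; rewrite size_scale ?expf_neq0 // size_mul //.
    rewrite size_trunc -sG -sw; move: w2; have := wN; have := qN.
    by rewrite -!size_poly_eq0 -sw; clear; lia.
  by rewrite truncE (negPf qN).
exists (lead_coef G * lead_coef w); first by rewrite rmorphM mulf_neq0.
move=> phi ker; rewrite rmorphM mulf_eq0 negb_or => /andP[phG phw].
have sphG : size (map_poly phi G) = size G by rewrite size_map_poly_id0.
have [b Gb] : exists b, (map_poly phi G).[b] = 0.
  apply: closed_root; rewrite sphG; apply: leq_trans wG.
  by rewrite ltnS lt0n size_poly_eq0.
have rel p : (p^a).[x] = 0 -> (map_poly phi p).[b] = 0.
  move=> px; have e := divE p G; rewrite px Gx !mulr0 add0r in e.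
  have r0 : (Pdiv.Idomain.modp p G)^a = 0 by apply: small (esym e); rewrite ltn_modpN0.
  have /(congr1 (fun r => (map_poly phi r).[b])) := Pdiv.Idomain.divp_eq p G.
  rewrite map_polyZ rmorphD rmorphM /= hornerZ hornerD hornerM Gb mulr0 add0r.
  rewrite (kerM phi ker _ r0) horner0 => /eqP; rewrite mulf_eq0 rmorphXn expf_eq0.
  by rewrite (negPf phG) andbF => /eqP.
exists b => //.
have wC : w = (lead_coef w)%:P by rewrite lead_coefE sw1 [LHS]size1_polyC ?sw1.
have : (map_poly phi (V * v - w)).[b] = 0.
  by apply: rel; rewrite rmorphB rmorphM hornerD hornerN hornerM wV subrr.
rewrite rmorphB rmorphM /= hornerD hornerN hornerM wC map_polyC hornerC /= => /eqP.
rewrite subr_eq0 => /eqP e; apply: contraNneq phw => v0.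
by rewrite -e v0 mulr0.
Qed.

End Extension.

Section Dominance.

Lemma rmorph_mmap n (R S T : comNzRingType) (theta : {rmorphism S -> T})
    (h : {rmorphism R -> S}) (y : 'I_n -> S) (p : mpoly n R) :
  theta (mmap h y p) = mmap (theta \o h) (theta \o y) p.
Proof.
rewrite /mmap rmorph_sum; apply: eq_bigr => m _; rewrite rmorphM; congr (_ * _).
by rewrite /mmap1 rmorph_prod; apply: eq_bigr => i _; rewrite rmorphXn.
Qed.

Lemma mmap_ext n (R S : nzRingType) (h h' : R -> S) (y y' : 'I_n -> S) (p : mpoly n R) :
  h =1 h' -> y =1 y' -> mmap h y p = mmap h' y' p.
Proof.
move=> hh yy; apply: eq_bigr => m _; rewrite hh; congr (_ * _).
by apply: eq_bigr => i _; rewrite yy.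
Qed.

Lemma deriv_mmap (K : comNzRingType) n (y : 'I_n -> {poly K}) (p : mpoly n K) :
  (mmap polyC y p)^`() = \sum_i mmap polyC y (mderiv i p) * (y i)^`().
Proof.
pose Q (q : mpoly n K) :=
  (mmap polyC y q)^`() = \sum_i mmap polyC y (mderiv i q) * (y i)^`().
have QD q r : Q q -> Q r -> Q (q + r).
  move=> hq hr; rewrite /Q mmapD derivD hq hr -big_split; apply: eq_bigr => i _.
  by rewrite mderivD mmapD mulrDl.
have QM q r : Q q -> Q r -> Q (q * r).
  move=> hq hr; rewrite /Q rmorphM /= derivM hq hr mulr_suml mulr_sumr -big_split.
  by apply: eq_bigr => i _; rewrite mderivM mmapD !rmorphM /=; ring.
have QC c : Q c%:MP_[n].
  rewrite /Q mmapC derivC big1 // => i _.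
  by rewrite mderivC mmap0 mul0r.
have QX i : Q 'X_i.
  rewrite /Q mmapX mmap1U (bigD1 i) //= mderivX mnm1E eqxx scale1r.
  have -> : (U_(i) - U_(i) = 0 :> 'X_{1..n})%MM by apply/mnmP => j; rewrite mnmBE subnn mnm0E.
  rewrite mpolyX0 rmorph1 mul1r big1 ?addr0 // => j ji.
  by rewrite mderivX mnm1E eq_sym (negPf ji) scale0r mmap0 mul0r.
have Q1 : Q 1 by rewrite -mpolyC1; exact: QC.
have Q0 : Q 0 by rewrite -mpolyC0; exact: QC.
elim/mpolyind: p => [|c m p _ _ hp]; first exact: Q0.
apply: (QD) hp; rewrite -mul_mpolyC; apply: (QM) (QC c) _.
rewrite mpolyXE_id; elim/big_ind: _ => // i _.
by elim: (m i) => [|k IH]; rewrite ?expr0 // exprS; apply: QM.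
Qed.

Lemma deriv_monval (K : comNzRingType) d g (m : mon d g) (a v : nat -> K) :
  (monval m (fun j => (a j)%:P + (v j) *: 'X))^`().[0] = dmon m a v.
Proof.
have a0 d' g' (m' : mon d' g') : (monval m' (fun j => (a j)%:P + (v j) *: 'X)).[0] = monval m' a.
  rewrite -[LHS]/(horner_eval 0 _) monval_rmorph; apply: monval_ext => j _.
  by rewrite /= /horner_eval !hornerE.
elim/mon_ind: d g / m => [g m|d g m IH|d g m IH]; rewrite !monE //.
  by rewrite -polyC1 derivC horner0.
rewrite derivM hornerD !hornerM IH a0; congr (_ * _ + _ * _).
  by rewrite derivD derivC derivZ derivX !hornerE.
by rewrite !hornerE.
Qed.

Variable K : numFieldType.

(** In characteristic 0 a polynomial all of whose derivatives vanish is constant; the induction is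
    on a bound for the degree. *)
Lemma mpoly_deriv_ind n (Z : mpoly n K -> Prop) :
  (forall p i, Z p -> Z (mderiv i p)) -> (forall c, Z c%:MP -> c = 0) -> forall p, Z p -> p = 0.
Proof.
move=> Zd Zc p; have [k sp] := ubnP (msize p).
have : forall m : 'X_{1..n}, (k <= mdeg m)%N -> p@_m = 0.
  by move=> m km; apply: memN_msupp_eq0; apply: msize_mdeg_ge; apply: leq_trans (ltnW sp) km.
elim: k p {sp} => [|k IH] p pk Zp.
  by apply/mpolyP => m; rewrite mcoeff0 pk.
have dp i : mderiv i p = 0.
  apply: IH (Zd p i Zp) => m km.
  by rewrite mcoeff_mderiv pk ?mul0rn // mdegD mdeg1 addn1.
have pC : p = (p@_0%MM)%:MP.
  apply/mpolyP => m; rewrite mcoeffC; have [->|m0] := eqVneq m 0%MM.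
    by rewrite mulr1.
  rewrite mulr0; have [i mi] : exists i, m i != 0%N.
    apply/existsP; apply: contraNT m0; rewrite negb_exists => /forallP mz.
    by apply/eqP/mnmP => i; rewrite mnm0E; apply/eqP; have := mz i; rewrite negbK.
  have mE : m = (m - U_(i) + U_(i))%MM.
    rewrite submK //; apply/mnm_lepP => j; rewrite mnm1E; case: eqP => // <-.
    by rewrite lt0n.
  have /mpolyP/(_ (m - U_(i))%MM) := dp i.
  by rewrite mcoeff_mderiv mcoeff0 -mE => /eqP; rewrite mulrn_eq0 => /eqP.
by rewrite pC (Zc p@_0%MM) ?mpolyC0 // -pC.
Qed.

Lemma meval_neq0 n (p : mpoly n K) : p != 0 -> exists y, p.@[y] != 0.
Proof.
move=> p0; apply: boolp.contrapT => h; move/eqP: p0; apply.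
have {h} : forall y, p.@[y] = 0.
  by move=> y; apply/eqP; apply: contra_notT h => py; exists y.
move: p; apply: (@mpoly_deriv_ind n (fun p => forall y, p.@[y] = 0)) =>
  [p i p0 y|c /(_ (fun=> 0))]; last by rewrite mevalC.
pose L (k : 'I_n) : {poly K} := (y k)%:P + (k == i)%:R *: 'X.
have : mmap polyC L p = 0.
  apply: poly_zero => w; rewrite -[LHS]/(horner_eval w _) rmorph_mmap.
  rewrite -[RHS](p0 (fun k => (L k).[w])); apply: mmap_ext => // c.
  by rewrite /= /horner_eval hornerC.
move/(congr1 (fun f : {poly K} => f^`().[0])).
rewrite deriv_mmap linear0 horner0 horner_sum (bigD1 i) //= big1 => [|k ki]; last first.
  by rewrite /L (negPf ki) scale0r addr0 derivC mulr0 horner0.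
rewrite /L eqxx scale1r derivD derivC derivX add0r mulr1 addr0 => e; apply: etrans e.
rewrite -[RHS]/(horner_eval 0 _) rmorph_mmap; apply: mmap_ext => [c|k].
  by rewrite /= /horner_eval hornerC.
by rewrite /= /horner_eval !hornerE.
Qed.

Definition waring_map (R : comNzRingType) d g t (A : 'I_t -> nat -> R) (m : mon d g) : R :=
  \sum_(s < t) monval m (A s).

Lemma waring_map_rmorph (R S : comNzRingType) (h : {rmorphism R -> S}) d g t
    (A : 'I_t -> nat -> R) (m : mon d g) :
  h (waring_map A m) = waring_map (fun s => h \o A s) m.
Proof. by rewrite rmorph_sum; apply: eq_bigr => s _; rewrite monval_rmorph. Qed.

Lemma waring_map_ext (R : comNzRingType) d g t (A A' : 'I_t -> nat -> R) (m : mon d g) :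
  (forall s j, (j < g)%N -> A s j = A' s j) -> waring_map A m = waring_map A' m.
Proof. by move=> AA; apply: eq_bigr => s _; apply: monval_ext => j; exact: AA. Qed.

(* In characteristic 0 a polynomial of least degree vanishing on the image of the Waring
   map has derivatives vanishing there too, since the differential is surjective almost
   everywhere on every line through a point where it is. *)
Lemma waring_independent d g t : (0 < d)%N -> (0 < g)%N -> good K d g t 0 ->
  forall G : mpoly #|mon d g| K,
    (forall A : 'I_t -> nat -> K, G.@[fun i => waring_map A (enum_val i)] = 0) -> G = 0.
Proof.
move=> d0 g0 [p [q h]] G.
pose S := Sys (enum 'I_t) [::] [::] [::].
have n0 : nondeg S d g (fun s : 'I_t => p s).
  move=> F [] Fd _ _ _; apply: h => // i it.
  by apply: (Fd (Ordinal it)); rewrite mem_enum.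
move: G; apply: (@mpoly_deriv_ind _ (fun G => forall A, G.@[_] = 0)) =>
  [G i Gv A|c /(_ (fun _ _ => 0))]; last by rewrite mevalC.
pose C (s : 'I_t) j : {poly K} := (p s j)%:P + (A s j - p s j) *: 'X.
pose Q := mmap polyC (fun k => waring_map C (enum_val k)) (mderiv i G).
have CE u s : (fun j => (C s j).[u]) =1 line (fun s : 'I_t => p s) A u s.
  by move=> j; rewrite /C /line !hornerE mulrC.
have QE u : Q.[u] = (mderiv i G).@[fun k => waring_map (line (fun s : 'I_t => p s) A u) (enum_val k)].
  rewrite -[LHS]/(horner_eval u _) rmorph_mmap; apply: mmap_ext => [c|k].
    by rewrite /= /horner_eval hornerC.
  by rewrite /= waring_map_rmorph; apply: waring_map_ext => s j _; exact: CE.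
have [r r0 rn] := nondeg_line A g0 n0.
have : Q * r = 0.
  apply: poly_zero => u; rewrite hornerM; have [->|/rn nu] := eqVneq r.[u] 0.
    by rewrite mulr0.
  rewrite QE; set A' := line _ _ _ in nu *.
  (* The gradient of G at the image point, regarded as a form. Differentiating G along the image
     when the s-th point moves in direction v shows D F (A' s) v = 0. *)
  pose F (m : mon d g) := (mderiv (enum_rank m) G).@[fun k => waring_map A' (enum_val k)].
  suff /(_ (enum_val i)) : F =1 (fun=> 0) by rewrite /F enum_valK => ->; rewrite mul0r.
  apply: nu; split=> // s _.
  have FD v : D F (A' s) v = 0.
    pose Y (s' : 'I_t) j : {poly K} := (A' s' j)%:P + (if s' == s then v j else 0) *: 'X.
    have : mmap polyC (fun k => waring_map Y (enum_val k)) G = 0.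
      apply: poly_zero => w; rewrite -[LHS]/(horner_eval w _) rmorph_mmap.
      rewrite -[RHS](Gv (fun s' j => (Y s' j).[w])); apply: mmap_ext => [c|k].
        by rewrite /= /horner_eval hornerC.
      by rewrite /= waring_map_rmorph.
    move/(congr1 (fun f : {poly K} => f^`().[0])).
    rewrite deriv_mmap linear0 horner0 horner_sum => e; apply: etrans e.
    rewrite /D (reindex (@enum_val (mon d g) predT)) /=; last first.
      by apply: onW_bij; exact: enum_val_bij.
    apply: eq_bigr => k _; rewrite hornerM; congr (_ * _).
      rewrite /F enum_valK -[RHS]/(horner_eval 0 _) rmorph_mmap; apply: mmap_ext => [c|k'].
        by rewrite /= /horner_eval hornerC.
      rewrite /= waring_map_rmorph; apply: waring_map_ext => s' j _.
      by rewrite /= /horner_eval /Y !hornerE.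
    rewrite /waring_map raddf_sum /= horner_sum (bigD1 s) //= /Y eqxx deriv_monval.
    rewrite big1 ?addr0 // => s' /negPf ss.
    transitivity (dmon (enum_val k) (A' s') (fun=> 0)).
      rewrite -deriv_monval; congr (_^`().[0]); apply: monval_ext => j _.
      by rewrite ss.
    by rewrite dmon_coord big1 // => j _; rewrite mul0r.
  split=> //; have /eqP := D_euler F (A' s).
  by rewrite FD eq_sym mulf_eq0 pnatr_eq0 eqn0Ngt d0 /= => /eqP.
move/eqP; rewrite mulf_eq0 (negPf r0) orbF => /eqP Q0.
have := QE 1; rewrite Q0 horner0 => /esym e; apply: etrans e.
apply: mmap_ext => // k; apply: waring_map_ext => s j _.
by rewrite /line mul1r addrC subrK.
Qed.

End Dominance.

Section Image.
Variable K : numClosedFieldType.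

(** Subrings of B are replaced by rings P' mapping to B, and homomorphisms on a subring by
    homomorphisms on P' that kill the kernel. Each new element x replaces P by {poly P}, evaluated
    at x. *)
Lemma extend_points (B : idomainType) (xs : seq B) :
  forall (P : idomainType) (alpha : {rmorphism P -> B}),
  exists2 u : P, alpha u != 0 & forall phi : {rmorphism P -> K},
    (forall p, alpha p = 0 -> phi p = 0) -> phi u != 0 ->
    exists (P' : idomainType) (alpha' : {rmorphism P' -> B}) (iota : {rmorphism P -> P'})
      (psi : {rmorphism P' -> K}),
      [/\ forall p, alpha' (iota p) = alpha p, forall p, psi (iota p) = phi p,
          forall p, alpha' p = 0 -> psi p = 0 & forall x, x \in xs -> exists p, alpha' p = x].
Proof.
elim: xs => [|x xs IH] P alpha.
  exists 1; first by rewrite rmorph1 oner_neq0.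
  by move=> phi ker _; exists P, alpha, idfun, phi.
pose alpha1 : {rmorphism {poly P} -> B} := horner_morph (fun a => mulrC x (alpha a)).
have [v v0 vext] := IH _ alpha1.
have [u u0 uext] := extend_point K (v0 : (map_poly alpha v).[x] != 0).
exists u => // phi ker phu; have [b vb rel] := uext phi ker phu.
pose phi1 : {rmorphism {poly P} -> K} := horner_morph (fun a => mulrC b (phi a)).
have [P' [alpha' [io [psi [aE pE ker' xsE]]]]] := vext phi1 rel vb.
pose io' : {rmorphism P -> P'} := io \o polyC.
exists P', alpha', io', psi; split=> //.
- by move=> p; rewrite /= aE /alpha1 /= /horner_morph map_polyC hornerC.
- by move=> p; rewrite /= pE /phi1 /= /horner_morph map_polyC hornerC.
move=> y; rewrite inE => /predU1P[->|/xsE//].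
by exists (io 'X); rewrite aE /alpha1 /= /horner_morph map_polyX hornerX.
Qed.

(** [alpha] is the ring map dual to the Waring map, injective by [waring_independent]. A target y is
    a homomorphism to K; extending it to the coordinates of the t points gives a preimage. *)
Theorem waring_dominant d g t : (0 < d)%N -> (0 < g)%N -> good K d g t 0 ->
  exists2 u : mpoly #|mon d g| K, u != 0 & forall y : 'I_#|mon d g| -> K, u.@[y] != 0 ->
    exists A : 'I_t -> nat -> K, forall m : mon d g, waring_map A m = y (enum_rank m).
Proof.
move=> d0 g0 /(waring_independent d0 g0) indep.
pose J := ('I_t * 'I_g)%type; pose N := #|{: J}|.
pose X (s : 'I_t) (j : nat) : mpoly N K :=
  if insub j is Some j' then 'X_(enum_rank ((s, j') : J)) else 0.
pose f (k : 'I_#|mon d g|) : mpoly N K := waring_map X (enum_val k).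
pose alpha : {rmorphism mpoly #|mon d g| K -> mpoly N K} := mmap (@mpolyC N K) f.
have alpha_inj p : alpha p = 0 -> p = 0.
  move=> p0; apply: indep => A.
  pose a (k : 'I_N) := A (enum_val k : J).1 (enum_val k : J).2.
  have := congr1 (meval a) p0; rewrite rmorph0 => e; apply: etrans e.
  rewrite [RHS](rmorph_mmap (meval a)); apply: mmap_ext => [c|k].
    by rewrite /= mevalC.
  rewrite /= /f waring_map_rmorph; apply: waring_map_ext => s j jg.
  by rewrite /= /X insubT /= mevalXU /a enum_rankK.
pose xs := [seq 'X_k : mpoly N K | k <- enum 'I_N].
have [u u0 uext] := extend_points xs alpha.
exists u; first by apply: contraNneq u0 => ->; rewrite rmorph0.
move=> y uy; pose phi : {rmorphism mpoly #|mon d g| K -> K} := meval y.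
have [|P' [alpha' [io [psi [aE pE ker xsE]]]]] := uext phi _ uy.
  by move=> p /alpha_inj ->; rewrite rmorph0.
have /fin_all_exists[p pE'] : forall k : 'I_N, exists p, alpha' p = 'X_k.
  by move=> k; apply: xsE; apply: map_f; rewrite mem_enum.
pose pX (s : 'I_t) (j : nat) : P' :=
  if insub j is Some j' then p (enum_rank ((s, j') : J)) else 0.
exists (fun s j => psi (pX s j)) => m.
have : psi (io 'X_(enum_rank m) - waring_map pX m) = 0.
  apply: ker; rewrite rmorphB aE /alpha /= mmapX mmap1U /f enum_rankK.
  rewrite waring_map_rmorph; apply/eqP; rewrite subr_eq0; apply/eqP.
  apply: waring_map_ext => s j jg; rewrite /= /X /pX insubT /=.
  by rewrite pE'.
rewrite rmorphB pE /phi /= mevalXU waring_map_rmorph => /eqP.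
by rewrite subr_eq0 => /eqP ->; apply: waring_map_ext.
Qed.

End Image.

(** * Algebraic dependence by counting monomials *)

Section Dependence.
Variable K : numFieldType.

Lemma card_bounded_mnm q L : (#|{: 'X_{1..q < L.+1}}| <= L.+1 ^ q)%N.
Proof.
pose h (m : 'X_{1..q < L.+1}) : {ffun 'I_q -> 'I_L.+1} := [ffun i => inord (bmnm m i)].
suff hinj : injective h by apply: leq_trans (leq_card h hinj) _; rewrite card_ffun !card_ord.
move=> m m' hm; apply/val_inj/mnmP => i.
have mL (k : 'X_{1..q < L.+1}) : (bmnm k i < L.+1)%N.
  apply: leq_trans (bmdeg k); rewrite ltnS mdegE (bigD1 i) //= leq_addr //.
have : h m i = h m' i by rewrite hm.
by rewrite !ffunE => /(congr1 val); rewrite /= !inordK.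
Qed.

Lemma msize_mul n (p q : mpoly n K) a b :
  (msize p <= a.+1)%N -> (msize q <= b.+1)%N -> (msize (p * q) <= (a + b).+1)%N.
Proof.
move=> pa qb; have [->|p0] := eqVneq p 0; first by rewrite mul0r msize0.
have [->|q0] := eqVneq q 0; first by rewrite mulr0 msize0.
by rewrite msizeM // -subn1 leq_subLR add1n -addnS -addSn leq_add.
Qed.

Lemma msize_prod_le n (I : Type) (r : seq I) (p : I -> mpoly n K) (a : I -> nat) :
  (forall i, msize (p i) <= (a i).+1)%N ->
  (msize (\prod_(i <- r) p i) <= (\sum_(i <- r) a i).+1)%N.
Proof.
move=> pa; elim: r => [|i r IH]; first by rewrite !big_nil msize1.
by rewrite !big_cons; apply: msize_mul.
Qed.

(* More than q polynomials in q variables are algebraically dependent: the products of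
   their powers are more numerous than the monomials occurring in them. *)
Lemma alg_dependent q M D (f : 'I_M -> mpoly q K) : (q < M)%N ->
  (forall k, msize (f k) <= D.+1)%N ->
  exists2 G : mpoly M K, G != 0 & mmap (@mpolyC q K) f G = 0.
Proof.
(* With exponents at most n there are (n+1)^M products, of degree at most L, against at most (L+1)^q
   <= (c (n+1))^q = n (n+1)^q monomials; n = c^q is chosen to make this less than (n+1)^(q+1). *)
move=> qM fD; pose c := (D * M).+1; pose n := (c ^ q)%N; pose L := (D * M * n)%N.
pose E := {ffun 'I_M -> 'I_n.+1}; pose C := 'X_{1..q < L.+1}.
pose fe (e : E) := \prod_k f k ^+ e k.
pose W := \matrix_(i < #|E|, j < #|{: C}|) (fe (enum_val i))@_(bmnm (enum_val j)).
have cardCE : (#|{: C}| < #|E|)%N.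
  apply: leq_ltn_trans (card_bounded_mnm q L) _; rewrite card_ffun !card_ord.
  apply: leq_trans (leq_pexp2l (ltn0Sn n) qM); rewrite expnS.
  have cn : (L.+1 <= c * n.+1)%N by rewrite /L /c; nia.
  apply: (@leq_ltn_trans ((c * n.+1) ^ q)%N); first by case: (q) => // q'; rewrite leq_exp2r.
  by rewrite expnMn ltn_pmul2r ?expn_gt0 // /n ltnS.
have : kermx W != 0.
  rewrite kermx_eq0 /row_free neq_ltn; apply/orP; left.
  by apply: leq_ltn_trans (rank_leq_col W) cardCE.
move=> W0; have [i0 ri0] : exists i, row i (kermx W) != 0.
  apply/existsP; apply: contraNT W0; rewrite negb_exists => /forallP H.
  by apply/eqP/row_matrixP => i; rewrite row0; apply/eqP; have := H i; rewrite negbK.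
set v := row i0 (kermx W) in ri0.
have vW : v *m W = 0 by rewrite -row_mul mulmx_ker row0.
pose me (e : E) : 'X_{1..M} := [multinom (e i : nat) | i < M].
have me_inj : injective me.
  move=> e e' /mnmP ee; apply/ffunP => k; apply/val_inj.
  by have := ee k; rewrite !mnmE.
pose G : mpoly M K := \sum_i v 0 i *: 'X_[me (enum_val i)].
exists G.
  have [j vj] : exists j, v 0 j != 0.
    apply/existsP; apply: contraNT ri0; rewrite negb_exists => /forallP H.
    apply/eqP/rowP => j; rewrite [RHS]mxE; apply/eqP; have := H j; by rewrite negbK.
  apply: contraNneq vj => /mpolyP/(_ (me (enum_val j))).
  rewrite mcoeff0 raddf_sum (bigD1 j) //= mcoeffZ mcoeffX eqxx mulr1 big1 ?addr0 => [->//|i ij].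
  by rewrite mcoeffZ mcoeffX (inj_eq me_inj) (inj_eq enum_val_inj) (negPf ij) mulr0.
have -> : mmap (@mpolyC q K) f G = \sum_i v 0 i *: fe (enum_val i).
  rewrite raddf_sum /=; apply: eq_bigr => i _.
  rewrite mmapZ mmapX mul_mpolyC; congr (_ *: _).
  by apply: eq_bigr => k _; rewrite mnmE.
apply/mpolyP => m; rewrite mcoeff0 raddf_sum /=.
have [mL|Lm] := ltnP (mdeg m) L.+1; last first.
  rewrite big1 // => i _; rewrite mcoeffZ [X in _ * X](_ : _ = 0) ?mulr0 //.
  apply: memN_msupp_eq0; apply: msize_mdeg_ge; apply: leq_trans Lm; rewrite /fe.
  have fk k (e : nat) : (msize (f k ^+ e) <= (D * e).+1)%N.
    elim: e => [|e IH]; first by rewrite expr0 muln0 msize1.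
    by rewrite exprS mulnS; apply: msize_mul.
  apply: leq_trans (msize_prod_le _ (fun k => fk k _)) _.
  rewrite ltnS /L mulnAC -big_distrr /= -mulnA leq_mul2l; apply/orP; right.
  rewrite mulnC -[X in (_ <= X * _)%N]card_ord -sum_nat_const; apply: leq_sum => k _.
  by rewrite -ltnS.
have /rowP/(_ (enum_rank (BMultinom mL))) := vW; rewrite [RHS]mxE mxE => e; apply: etrans e.
by apply: eq_bigr => i _; rewrite mcoeffZ [W _ _]mxE enum_rankK.
Qed.

Lemma msize_monval n d g (m : mon d g) (X : nat -> mpoly n K) :
  (forall j, (msize (X j) <= 2)%N) -> (msize (monval m X) <= d.+1)%N.
Proof.
move=> szX; elim/mon_ind: d g / m => [g m|d g m IH|d g m IH]; rewrite !monE ?msize1 //.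
by rewrite -[d.+1]add1n; apply: msize_mul.
Qed.

Lemma waring_dependent d g t : (t * g < #|mon d g|)%N ->
  exists2 G : mpoly #|mon d g| K, G != 0 &
    forall A : 'I_t -> nat -> K, G.@[fun i => waring_map A (enum_val i)] = 0.
Proof.
move=> tgM; pose J := ('I_t * 'I_g)%type; pose N := #|{: J}|.
pose X (s : 'I_t) (j : nat) : mpoly N K :=
  if insub j is Some j' then 'X_(enum_rank ((s, j') : J)) else 0.
have szX s j : (msize (X s j) <= 2)%N.
  by rewrite /X; case: insub => [j'|]; rewrite ?msize0 // msizeX mdeg1.
pose f (k : 'I_#|mon d g|) : mpoly N K := waring_map X (enum_val k).
have fd k : (msize (f k) <= d.+1)%N.
  rewrite /f /waring_map; apply: (big_ind (fun p : mpoly N K => (msize p <= d.+1)%N)).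
  - by rewrite msize0.
  - by move=> p q hp hq; apply: leq_trans (msizeD_le _ _) _; rewrite geq_max hp.
  by move=> s _; apply: msize_monval.
have NM : (N < #|mon d g|)%N by rewrite /N card_prod !card_ord.
have [G G0 Gf] := alg_dependent NM fd; exists G => // A.
pose a (k : 'I_N) := A (enum_val k : J).1 (enum_val k : J).2.
have := congr1 (meval a) Gf; rewrite rmorph0 => e; apply: etrans e.
rewrite [RHS](rmorph_mmap (meval a)); apply: mmap_ext => [c|k].
  by rewrite /= mevalC.
rewrite /= /f waring_map_rmorph; apply: waring_map_ext => s j jg.
by rewrite /= /X insubT /= mevalXU /a enum_rankK.
Qed.

End Dependence.

(** * Equations for sums of powers *)

Section Monomials.

Lemma mulX_mon d g j (m : mon d g) : (j < g)%N -> exists m' : mon d.+1 g,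
  forall (R : comNzRingType) (x : nat -> R), monval m' x = x j * monval m x.
Proof.
elim/mon_ind: d g / m j => [g m|d g m IH|d g m IH] j jg.
- elim: g m jg => // g IH m; rewrite ltnS leq_eqVlt => /predU1P[->|jg].
    by exists (monr (tt : mon 0 g.+1)) => R x; rewrite monE.
  by have [m' mE] := IH tt jg; exists (monl m') => R x; rewrite !monE mE.
- move: jg; rewrite ltnS leq_eqVlt => /predU1P[->|jg].
    by exists (monr (monl m)) => R x; rewrite !monE.
  by have [m' mE] := IH j jg; exists (monl m') => R x; rewrite !monE mE.
- by have [m' mE] := IH j jg; exists (monr m') => R x; rewrite !monE mE mulrCA.
Qed.

Lemma mon_of_seq g (s : seq nat) : all (fun j => j < g)%N s -> exists m : mon (size s) g,
  forall (R : comNzRingType) (x : nat -> R), monval m x = \prod_(j <- s) x j.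
Proof.
elim: s => [_|j s IH /= /andP[jg /IH[m mE]]].
  by exists (tt : mon 0 g) => R x; rewrite big_nil monE.
by have [m' mE'] := mulX_mon m jg; exists m' => R x; rewrite big_cons -mE; exact: mE'.
Qed.

(** Turns words into commutative monomials. A sequence of the wrong length or with an index out of
    range gets an arbitrary monomial, which exists because g > 0. *)
Lemma monomials d g : (0 < g)%N -> exists tau : seq nat -> mon d g,
  forall s, size s = d -> all (fun j => j < g)%N s ->
  forall (R : comNzRingType) (x : nat -> R), monval (tau s) x = \prod_(j <- s) x j.
Proof.
move=> g0; suff /boolp.choice[tau tauE] : forall s, exists m : mon d g,
    size s = d -> all (fun j => j < g)%N s ->
    forall (R : comNzRingType) (x : nat -> R), monval m x = \prod_(j <- s) x j.
  by exists tau.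
move=> s.
have [sd|sd] := eqVneq (size s) d; last first.
  have [m _] : exists m : mon (size (nseq d 0%N)) g, forall (R : comNzRingType) (x : nat -> R),
      monval m x = \prod_(j <- nseq d 0%N) x j.
    by apply: mon_of_seq; rewrite all_nseq g0 orbT.
  by rewrite size_nseq in m *; exists m => sd'; rewrite sd' eqxx in sd.
have [sg|sg] := boolP (all (fun j => j < g)%N s).
  by subst d; have [m mE] := mon_of_seq sg; exists m.
have [m _] : exists m : mon (size (nseq d 0%N)) g, forall (R : comNzRingType) (x : nat -> R),
    monval m x = \prod_(j <- nseq d 0%N) x j.
  by apply: mon_of_seq; rewrite all_nseq g0 orbT.
by rewrite size_nseq in m *; exists m.
Qed.

Lemma seq_of_mon d g (m : mon d g) : exists2 s : seq nat, size s = d /\ all (fun j => j < g)%N s &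
  forall (R : comNzRingType) (x : nat -> R), monval m x = \prod_(j <- s) x j.
Proof.
elim/mon_ind: d g / m => [g m|d g m [s [sd sg] sE]|d g m [s [sd sg] sE]].
- by exists [::] => // R x; rewrite big_nil monE.
- exists s => [|R x]; last by rewrite monE.
  by split=> //; apply: sub_all sg => j; exact: ltnW.
- exists (g :: s) => [|R x]; last by rewrite monE big_cons sE.
  by rewrite /= sd ltnSn.
Qed.

Lemma card_mon d g : (0 < g)%N -> #|mon d g| = 'C(g.-1 + d, d).
Proof.
elim: d g => [|d IHd] g g0; first by rewrite card_unit bin0.
elim: g g0 => // g IHg _.
have -> : #|mon d.+1 g.+1| = (#|mon d.+1 g| + #|mon d g.+1|)%N by exact: card_sum.
rewrite IHd //=; case: g IHg => [_|g ->] //; last by rewrite /= [in RHS]addSn binS [(g.+1 + d)%N]addSnnS.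
by rewrite card_void !add0n !binn.
Qed.

End Monomials.

(** * Rank obstructions: Gram matrices and catalecticants *)

Section Flattening.
Variable K : numFieldType.

(* If a matrix of linear forms has rank at most rho at d-th powers but some t rho + 1
   linearly independent columns at y0, a minor vanishes on sums of t powers. *)
Lemma flattening d g r c t rho (e : 'I_r -> 'I_c -> K) (idx : 'I_r -> 'I_c -> mon d g)
    (y0 : mon d g -> K) :
  row_full (\matrix_(i, j) (e i j * y0 (idx i j))) ->
  (forall x : nat -> K, (\rank (\matrix_(i, j) (e i j * monval (idx i j) x)%R) <= rho)%N) ->
  (t * rho < c)%N ->
  exists2 G : mpoly #|mon d g| K, G != 0 &
    forall A : 'I_t -> nat -> K, G.@[fun i => waring_map A (enum_val i)] = 0.
Proof.
move=> full rk tc; pose B y := \matrix_(i < r, j < c) (e i j * y (idx i j)).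
have uB := fullrowsub_unit (full : row_full (B y0)); set f := fullrankfun _ in uB.
pose M : 'M[mpoly #|mon d g| K]_c :=
  \matrix_(i, j) ((e (f i) j)%:MP * 'X_(enum_rank (idx (f i) j))).
have ME (z : 'I_#|mon d g| -> K) : (\det M).@[z] = \det (rowsub f (B (fun m => z (enum_rank m)))).
  rewrite -det_map_mx; congr (\det _); apply/matrixP => i j.
  by rewrite !mxE /= mevalM mevalC mevalXU.
exists (\det M).
  apply: contraTneq uB => M0.
  have := ME (fun k => y0 (enum_val k)); rewrite M0 meval0 => /esym d0.
  rewrite unitmxE unitfE negbK -d0; apply/eqP; congr (\det _).
  by apply/matrixP => i j; rewrite !mxE enum_rankK.
move=> A; rewrite ME; apply/eqP; apply: contraTT tc => dN.
have : rowsub f (B (fun m => waring_map A (enum_val (enum_rank m)))) \in unitmx.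
  by rewrite unitmxE unitfE.
move/mxrank_unit => rc; rewrite -leqNgt -[X in (X <= _)%N]rc.
have -> : B (fun m => waring_map A (enum_val (enum_rank m))) =
    \sum_s \matrix_(i, j) (e i j * monval (idx i j) (A s)).
  apply/matrixP => i j; rewrite summxE mxE enum_rankK /waring_map mulr_sumr.
  by apply: eq_bigr => s _; rewrite mxE.
apply: leq_trans (mxrankS (rowsub_sub _ _)) _.
rewrite -[X in (_ <= X * _)%N]card_ord -sum_nat_const.
apply: (big_ind2 (fun (X : 'M_(r, c)) n => (\rank X <= n)%N)) => //.
- by rewrite mxrank0.
- by move=> X n Y n' hX hY; apply: leq_trans (mxrank_add _ _) (leq_add hX hY).
Qed.

Lemma rank_outer r c (u : 'I_r -> K) (v : 'I_c -> K) :
  (\rank (\matrix_(i, j) (u i * v j)%R) <= 1)%N.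
Proof.
have -> : \matrix_(i, j) (u i * v j) = (\col_i u i) *m (\row_j v j).
  by apply/matrixP => i j; rewrite !mxE big_ord1 !mxE.
exact: leq_trans (mxrankM_maxl _ _) (rank_leq_col _).
Qed.

Lemma prod_seq2 (a b : nat) (x : nat -> K) : \prod_(j <- [:: a; b]) x j = x a * x b.
Proof. by rewrite big_cons big_seq1. Qed.

Lemma quadric_obstruction g t : (t < g)%N -> exists2 G : mpoly #|mon 2 g| K, G != 0 &
  forall A : 'I_t -> nat -> K, G.@[fun i => waring_map A (enum_val i)] = 0.
Proof.
move=> tg; have [|tau tauE] := @monomials 2 g; first by lia.
have tE (i j : 'I_g) x : monval (tau [:: nat_of_ord i; nat_of_ord j]) x = x i * x j :> K.
  by rewrite tauE ?prod_seq2 //= !ltn_ord.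
pose y0 := waring_map (fun s : 'I_g => unitv K s) : mon 2 g -> K.
apply: (@flattening 2 g g g t 1 (fun _ _ => 1)
  (fun i j => tau [:: nat_of_ord i; nat_of_ord j]) y0); last by rewrite muln1.
  have -> : \matrix_(i < g, j < g) (1 * y0 (tau [:: nat_of_ord i; nat_of_ord j])) = 1%:M.
    have uE (s i : 'I_g) : unitv K s i = (i == s)%:R by [].
    apply/matrixP => i j; rewrite !mxE mul1r /y0 /waring_map.
    under eq_bigr do rewrite tE !uE.
    rewrite (bigD1 i) //= eqxx mul1r big1 ?addr0 => [|s si]; first by rewrite eq_sym.
    by rewrite eq_sym (negPf si) mul0r.
  by rewrite row_full_unit unitmx1.
move=> x; under eq_mx do rewrite mul1r tE; exact: rank_outer.
Qed.

Lemma row_full_seq r c (A : 'M[K]_(r, c)) :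
  (forall v : seq K, size v = c -> (forall i, \sum_j A i j * v`_j = 0) ->
     all (fun x => x == 0) v) -> row_full A.
Proof.
move=> h; rewrite -cokermx_eq0; apply/eqP/matrixP => i j; rewrite [RHS]mxE.
pose w := [seq cokermx A k j | k <- enum 'I_c].
have sw : size w = c by rewrite size_map size_enum_ord.
have wE (k : 'I_c) : w`_k = cokermx A k j.
  by rewrite (nth_map k) ?size_enum_ord // nth_ord_enum.
have /(all_nthP 0)/(_ i) : all (fun x => x == 0) w.
  apply: h => // k; have /matrixP/(_ k j) := mulmx_coker A.
  by rewrite mxE [RHS]mxE => E; apply: etrans E; apply: eq_bigr => l _; rewrite wE.
by rewrite sw wE => /(_ (ltn_ord i))/eqP.
Qed.

Lemma eliminate101 n rows (v : seq K) : size v = n ->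
  all (fun r => size r == n) rows -> eliminate 101 101 100 n rows ->
  all (fun r => dot v r == 0) rows -> all (fun x => x == 0) v.
Proof. by apply: (@eliminate_char0 101 101 100). Qed.

Definition npower_sum (ps : seq (seq N)) (s : seq nat) : N :=
  foldr (fun p a => N.add (foldr (fun j b => N.mul (nth 0%num p j) b) 1%num s) a) 0%num ps.

Lemma npower_sumE d g (tau : seq nat -> mon d g) (ps : seq (seq N)) s :
  (forall x : nat -> K, monval (tau s) x = \prod_(j <- s) x j) ->
  waring_map (fun i : 'I_(size ps) => npt K (nth [::] ps i)) (tau s) = nbr K (npower_sum ps s).
Proof.
move=> tE; rewrite /waring_map; under eq_bigr do rewrite tE.
elim: ps => [|p ps IH]; first by rewrite big_ord0.
rewrite big_ord_recl IH /= nbrD; congr (_ + _).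
by elim: s {tE IH} => [|j s IH]; rewrite ?big_nil ?big_cons //= nbrM IH.
Qed.

Definition pairs (g : nat) : seq (nat * nat) :=
  [seq p <- [seq (i, j) | i <- iota 0 g, j <- iota 0 g] | (p.1 <= p.2)%N].

Lemma pairs_lt g p : p \in pairs g -> (p.1 < g)%N /\ (p.2 < g)%N.
Proof.
rewrite mem_filter => /andP[_ /allpairsP[[i j] /= [ig jg ->]]].
by move: ig jg; rewrite !mem_iota.
Qed.

Definition catalecticant (g : nat) (ps : seq (seq N)) : seq (seq N) :=
  [seq [seq npower_sum ps [:: p.1; p.2; q.1; q.2] | q <- pairs g] | p <- pairs g].

(** The catalecticant has rank at most 1 on a fourth power. Its size for g = 3, 4, 5 is 6, 10, 15,
    one more than the number of powers that a parameter count predicts; [ps] witnesses that its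
    determinant is not identically 0. *)
Lemma quartic_obstruction g t ps : (0 < g)%N -> (t < size (pairs g))%N ->
  eliminate 101 101 100 (size (pairs g)) (catalecticant g ps) ->
  exists2 G : mpoly #|mon 4 g| K, G != 0 &
    forall A : 'I_t -> nat -> K, G.@[fun i => waring_map A (enum_val i)] = 0.
Proof.
move=> g0 tg el; have [tau tauE] := @monomials 4 g g0.
set n := size (pairs g) in tg el.
pose pr (i : 'I_n) := nth (0, 0)%N (pairs g) i.
have pr_lt i : ((pr i).1 < g)%N /\ ((pr i).2 < g)%N by apply/pairs_lt/mem_nth.
pose sq (i j : 'I_n) := [:: (pr i).1; (pr i).2; (pr j).1; (pr j).2].
have tE i j (x : nat -> K) : monval (tau (sq i j)) x = \prod_(k <- sq i j) x k.
  by rewrite tauE //=; have [-> ->] := pr_lt i; have [-> ->] := pr_lt j.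
apply: (@flattening 4 g n n t 1 (fun _ _ => 1) (fun i j => tau (sq i j))
  (waring_map (fun i : 'I_(size ps) => npt K (nth [::] ps i)))); last by rewrite muln1.
  apply: row_full_seq => v sv Av; apply: (eliminate101 sv _ el).
    by rewrite all_map; apply/allP => p _ /=; rewrite size_map.
  apply/(all_nthP [::]) => i; rewrite size_map => ig.
  rewrite (dotE sv); last by rewrite (nth_map (0, 0)%N) // size_map.
  apply/eqP; rewrite -[RHS](Av (Ordinal ig)); apply: eq_bigr => j _.
  rewrite mxE mul1r npower_sumE // mulrC.
  by rewrite (nth_map (0, 0)%N) // (nth_map (0, 0)%N).
move=> x; under eq_mx do rewrite mul1r tE /sq !big_cons big_nil mulr1 mulrA.
exact: rank_outer.
Qed.

End Flattening.

(** * The Koszul flattening of cubics in five variables *)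

Section Koszul.
Variable K : numFieldType.

Definition spairs : seq (nat * nat) :=
  [:: (0, 1); (0, 2); (0, 3); (0, 4); (1, 2); (1, 3); (1, 4); (2, 3); (2, 4); (3, 4)]%N.
Definition striples : seq (nat * nat * nat) :=
  [:: (0, 1, 2); (0, 1, 3); (0, 1, 4); (0, 2, 3); (0, 2, 4); (0, 3, 4);
      (1, 2, 3); (1, 2, 4); (1, 3, 4); (2, 3, 4)]%N.

(* The coefficient of e_c ^ e_d ^ e_e in x ^ e_a ^ e_b is sgn (a, b) (c, d, e) times
   the coordinate of x of index rest (a, b) (c, d, e); the value 2 of sgn encodes -1. *)
Definition sgn (s : nat * nat) (t : nat * nat * nat) : nat :=
  if (s == t.1) || (s == (t.1.2, t.2)) then 1 else (s == (t.1.1, t.2)).*2.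
Definition rest (s : nat * nat) (t : nat * nat * nat) : nat :=
  if s == t.1 then t.2 else if s == (t.1.2, t.2) then t.1.1 else t.1.2.

Definition sgnr (k : nat) : K := if k == 1%N then 1 else if k == 2 then -1 else 0.

Definition sp (i : nat) := nth (0, 0)%N spairs i.
Definition st (i : nat) := nth (0, 0, 0)%N striples i.

(** Acting on row vectors, [wedge2] is exterior multiplication by x from bivectors to trivectors of
    K^5, and [wedge1], up to sign, from vectors to bivectors. *)
Definition wedge2 (x : nat -> K) : 'M[K]_10 :=
  \matrix_(i, j) (sgnr (sgn (sp i) (st j)) * x (rest (sp i) (st j))).
Definition wedge1 (x : nat -> K) : 'M[K]_(5, 10) :=
  \matrix_(i, j) ((nat_of_ord i == (sp j).1)%:R * x (sp j).2
                   - (nat_of_ord i == (sp j).2)%:R * x (sp j).1).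

Lemma wedge12 x : wedge1 x *m wedge2 x = 0.
Proof.
apply/matrixP => i j; rewrite !mxE; under eq_bigr do rewrite !mxE.
rewrite !big_ord_recl big_ord0 /=.
case: i => [[|[|[|[|[|//]]]]] hi]; case: j => [[|[|[|[|[|[|[|[|[|[|//]]]]]]]]]] hj];
  rewrite /sgnr /sgn /rest /sp /st /=; ring.
Qed.

(** For x nonzero the kernel of [wedge1] is contained in the line of x, so its rank is at least 4;
    since [wedge1 x *m wedge2 x = 0], at most 10 - 4 remains for [wedge2]. *)
Lemma rank_wedge2 x : (\rank (wedge2 x) <= 6)%N.
Proof.
have [a xa|x0] := pickP (fun a : 'I_5 => x a != 0); last first.
  have -> : wedge2 x = 0; last by rewrite mxrank0.
  have xz k : (k < 5)%N -> x k = 0.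
    by move=> k5; apply/eqP; rewrite -[_ == 0]negbK; apply/negbT; exact: (x0 (Ordinal k5)).
  apply/matrixP => i j; rewrite !mxE xz ?mulr0 //.
  have : all (fun i => all (fun j => rest (sp i) (st j) < 5)%N (iota 0 10)) (iota 0 10) by [].
  by move/allP/(_ i); rewrite mem_iota ltn_ord => /(_ isT)/allP; apply; rewrite mem_iota ltn_ord.
have := mulmx0_rank_max (wedge12 x).
suff : (\rank (kermx (wedge1 x)) <= 1)%N.
  by rewrite mxrank_ker; have := rank_leq_row (wedge1 x); lia.
apply: leq_trans (rank_leq_row (\row_(i < 5) x i)).
apply: mxrankS; apply/row_subP => k; set u := row k _.
have uU : u *m wedge1 x = 0 by rewrite -row_mul mulmx_ker row0.
clearbody u; have rel (b c : 'I_5) : u 0 b * x c = u 0 c * x b.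
  wlog bc : b c / (b < c)%N => [h|].
    by case: (ltngtP b c) => [bc|cb|/val_inj ->] //; [exact: h | exact/esym/h].
  have [j jE] : exists j : 'I_10, sp j = (nat_of_ord b, nat_of_ord c).
    have bcin : (nat_of_ord b, nat_of_ord c) \in spairs.
      by move: bc; case: b => [[|[|[|[|[|//]]]]] hb]; case: c => [[|[|[|[|[|//]]]]] hc].
    have ji : (index (nat_of_ord b, nat_of_ord c) spairs < 10)%N by rewrite index_mem.
    by exists (Ordinal ji); rewrite /sp nth_index.
  have /rowP/(_ j) := uU; rewrite mxE [RHS]mxE.
  under eq_bigr do rewrite [wedge1 _ _ _]mxE jE /= mulrBr.
  rewrite sumrB (bigD1 b) //= eqxx big1 ?addr0 => [|i ib]; last first.
    by rewrite -val_eqE /= in ib; rewrite (negPf ib) mul0r mulr0.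
  rewrite (bigD1 c) //= eqxx big1 ?addr0 => [|i ib]; last first.
    by rewrite -val_eqE /= in ib; rewrite (negPf ib) mul0r mulr0.
  by rewrite !mul1r => /eqP; rewrite subr_eq0 => /eqP.
apply/sub_rVP; exists (u 0 a / x a); apply/rowP => b.
rewrite !mxE; apply: (mulIf xa).
by rewrite mulrAC divfK //; exact: rel.
Qed.

(* The Koszul flattening has rank at most 6 at a cube, and 43 = 7 * 6 + 1 of its columns
   are independent at a sum of 8 cubes. *)
Definition kcols : seq nat :=
  [seq k <- iota 0 50 | k \notin [:: 30; 40; 41; 43; 46; 48; 49]%N].

(** Row i stands for the variable i / 10 and the bivector i mod 10, column k for the variable k / 10
    and the trivector k mod 10. [pos] selects the entries of sign +1 or those of sign -1. *)
Definition kentry (ps : seq (seq N)) (pos : bool) (i k : nat) : N :=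
  let s := sp (i %% 10) in let t := st (k %% 10) in
  if sgn s t == (if pos then 1 else 2)%N
  then npower_sum ps [:: i %/ 10; k %/ 10; rest s t]%N else 0%num.

(* Negative entries are encoded by doubling the unknowns: the unknown 43 + k stands for
   the opposite of the unknown k. *)
Definition krows (ps : seq (seq N)) : seq (seq N) :=
  [seq [seq kentry ps true i k | k <- kcols] ++ [seq kentry ps false i k | k <- kcols]
     | i <- iota 0 50] ++
  [seq (let u := mkseq (fun k => if k == l then 1%num else 0%num) 43 in u ++ u)
     | l <- iota 0 43].

End Koszul.

Section KoszulObstruction.
Variable K : numFieldType.

Lemma krows_eliminate : eliminate 101 101 100 86 (krows (pts 5 8 5 [::])).
Proof. by vm_compute. Qed.

Lemma catalecticant3 : eliminate 101 101 100 (size (pairs 3)) (catalecticant 3 (pts 5 6 3 [::])).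
Proof. by vm_compute. Qed.

Lemma catalecticant4 : eliminate 101 101 100 (size (pairs 4)) (catalecticant 4 (pts 5 10 4 [::])).
Proof. by vm_compute. Qed.

Lemma catalecticant5 : eliminate 101 101 100 (size (pairs 5)) (catalecticant 5 (pts 5 15 5 [::])).
Proof. by vm_compute. Qed.

Lemma dot_cat (v w : seq K) r s : size v = size r -> dot (v ++ w) (r ++ s) = dot v r + dot w s.
Proof.
elim: v r => [|x v IH] [|a r] //=; first by rewrite add0r.
by move=> [vr]; rewrite IH // addrA.
Qed.

Lemma dot_opp (v : seq K) r : dot [seq - x | x <- v] r = - dot v r.
Proof.
elim: v r => [|x v IH] [|a r] /=; rewrite ?oppr0 //.
by rewrite IH opprD mulNr.
Qed.

Lemma rest_lt i j : (i < 10)%N -> (j < 10)%N -> (rest (sp i) (st j) < 5)%N.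
Proof.
have : all (fun i => all (fun j => rest (sp i) (st j) < 5)%N (iota 0 10)) (iota 0 10) by [].
move/allP/(_ i); rewrite mem_iota => h i10 j10.
by move/allP: (h i10) => /(_ j); rewrite mem_iota; apply.
Qed.

Lemma sgnrE n (w : N) :
  nbr K (if n == 1%N then w else 0%num) - nbr K (if n == 2 then w else 0%num) = sgnr K n * nbr K w.
Proof.
have n0 : nbr K 0%num = 0 by [].
by case: n => [|[|[|n]]]; rewrite /sgnr /= n0 ?subr0 ?sub0r ?mul1r ?mulN1r ?mul0r.
Qed.

Lemma koszul_obstruction t ps : (t < 8)%N -> eliminate 101 101 100 86 (krows ps) ->
  exists2 G : mpoly #|mon 3 5| K, G != 0 &
  forall A : 'I_t -> nat -> K, G.@[fun i => waring_map A (enum_val i)] = 0.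
Proof.
move=> t8 el; have [tau tauE] := @monomials 3 5 isT.
have m10 k : (k %% 10 < 10)%N by rewrite ltn_mod.
pose kc (l : 'I_43) := nth 0%N kcols l.
have kc50 l : (kc l < 50)%N.
  have : kc l \in kcols by apply: mem_nth; rewrite (_ : size kcols = 43).
  by rewrite mem_filter mem_iota => /and3P[].
pose ix (i : 'I_50) (l : 'I_43) :=
  [:: i %/ 10; kc l %/ 10; rest (sp (i %% 10)) (st (kc l %% 10))]%N.
pose y0 := waring_map (fun i : 'I_(size ps) => npt K (nth [::] ps i)) : mon 3 5 -> K.
have tE i l (x : nat -> K) : monval (tau (ix i l)) x = \prod_(k <- ix i l) x k.
  by rewrite tauE //= rest_lt // !ltn_divLR // ltn_ord kc50.
pose e (i : 'I_50) (l : 'I_43) := sgnr K (sgn (sp (i %% 10)) (st (kc l %% 10))).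
apply: (@flattening K 3 5 50 43 t 6 e (fun i l => tau (ix i l)) y0); last by lia.
  apply: row_full_seq => v sv Av.
  have sw : size (v ++ [seq - x | x <- v]) = 86 by rewrite size_cat size_map sv.
  have szr : all (fun r => size r == 86) (krows ps).
    by rewrite all_cat; apply/andP; split; apply/allP => r /mapP[k _ ->];
      rewrite size_cat ?size_map ?size_mkseq.
  suff : all (fun x => x == 0) (v ++ [seq - x | x <- v]) by rewrite all_cat => /andP[].
  apply: (eliminate101 sw szr el).
  rewrite /krows all_cat; apply/andP; split; apply/allP => r /mapP[k]; rewrite mem_iota => kk ->;
    rewrite dot_cat ?size_map ?size_mkseq ?sv // dot_opp; last by rewrite subrr.
  rewrite !(dotE sv) ?size_map // -sumrB; apply/eqP.
  rewrite -[RHS](Av (Ordinal kk)); apply: eq_bigr => l _.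
  have kl : (l < size kcols)%N by rewrite (_ : size kcols = 43).
  rewrite mxE !(nth_map 0%N) // -mulrBr mulrC; congr (_ * _).
  rewrite /y0 npower_sumE // /e /kentry /=.
  exact: sgnrE.
move=> x.
(* At the cube of x the flattening is the tensor product of a matrix of rank at most 1 with
   [wedge2 x], so it factors through [wedge2 x]. *)
pose C := \matrix_(i < 50, j < 10) (x (i %/ 10)%N * (i %% 10 == j)%N%:R).
pose Rr := \matrix_(j < 10, l < 43) (x (kc l %/ 10)%N * (kc l %% 10 == j)%N%:R).
have -> : \matrix_(i, l) (e i l * monval (tau (ix i l)) x)%R = C *m wedge2 x *m Rr.
  have pick (k : nat) (f : 'I_10 -> K) (a : K) (k10 : (k < 10)%N) :
      \sum_(j < 10) a * (k == nat_of_ord j)%:R * f j = a * f (Ordinal k10).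
    rewrite (bigD1 (Ordinal k10)) //= eqxx mulr1 big1 ?addr0 // => j.
    by rewrite -val_eqE /= eq_sym => /negPf ->; rewrite mulr0 mul0r.
  apply/matrixP => i l; rewrite !mxE tE.
  transitivity (\sum_(j < 10) x (kc l %/ 10)%N * (kc l %% 10 == j)%N%:R * (C *m wedge2 x) i j).
    rewrite (pick _ _ _ (m10 (kc l))) mxE.
    transitivity (x (kc l %/ 10)%N * (\sum_(j < 10) x (i %/ 10)%N * (i %% 10 == j)%N%:R *
       wedge2 x j (Ordinal (m10 (kc l))))).
      rewrite (pick _ _ _ (m10 i)) mxE /= /ix !big_cons big_nil /e.
      by rewrite mulr1 ; ring.
    by congr (_ * _); apply: eq_bigr => j _; rewrite [C _ _]mxE.
  by apply: eq_bigr => j _; rewrite [Rr _ _]mxE mulrC.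
apply: leq_trans (mxrankM_maxl _ _) _; apply: leq_trans (mxrankM_maxr _ _) _.
exact: rank_wedge2.
Qed.

Lemma cubic_obstruction t : (t < 8)%N -> exists2 G : mpoly #|mon 3 5| K, G != 0 &
  forall A : 'I_t -> nat -> K, G.@[fun i => waring_map A (enum_val i)] = 0.
Proof. by move=> t8; exact: koszul_obstruction t8 krows_eliminate. Qed.

End KoszulObstruction.

(** * The free algebra *)

Section FreeAlgebra.
Variables (F : fieldType) (g : nat).

Lemma scale_monalgU (c : F) (k : {fmonom 'I_g}) : c *: << k >> = << c *g k >> :> ncpoly F g.
Proof. by apply/malgP => k'; rewrite monalg.mcoeffZ !monalg.mcoeffU mulr_natr. Qed.

Lemma prod_ncvar (a : 'I_g -> F) (s : seq 'I_g) :
  \prod_(j <- s) (a j *: ncvar F j) = << \prod_(j <- s) a j *g FMonom s >>.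
Proof.
elim: s => [|j s IH]; first by rewrite !big_nil -fmoneE.
rewrite !big_cons IH scale_monalgU malgM_def fgmulUU; congr (<< _ *g _ >>).
by rewrite [LHS]fmmulE fmuE.
Qed.

Lemma ncmonomE d (alpha : d.-tuple 'I_g) : ncmonom F alpha = << FMonom alpha >>.
Proof.
rewrite /ncmonom -(big_tuple _ _ alpha xpredT (@ncvar F g)).
transitivity (\prod_(j <- alpha) (1 *: ncvar F j)).
  by apply: eq_bigr => j _; rewrite scale1r.
by rewrite prod_ncvar big1.
Qed.

Lemma nchomE d (P : {ffun d.-tuple 'I_g -> F}) :
  nchom P = \sum_(alpha : d.-tuple 'I_g) << P alpha *g FMonom alpha >>.
Proof. by apply: eq_bigr => alpha _; rewrite ncmonomE scale_monalgU. Qed.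

Lemma nchom_inj d : injective (@nchom F g d).
Proof.
have coef (P : {ffun d.-tuple 'I_g -> F}) (alpha : d.-tuple 'I_g) :
    monalg.mcoeff (FMonom alpha) (nchom P) = P alpha.
  rewrite nchomE raddf_sum (bigD1 alpha) //= monalg.mcoeffUU big1 ?addr0 // => beta ne.
  rewrite monalg.mcoeffU; case: eqP => [[] /val_inj e|//].
  by rewrite e eqxx in ne.
by move=> P Q PQ; apply/ffunP => alpha; rewrite -!coef PQ.
Qed.

Lemma expr_linear_form d (a : 'I_g -> F) :
  (\sum_j a j *: ncvar F j) ^+ d = nchom [ffun alpha : d.-tuple 'I_g => \prod_(j <- alpha) a j].
Proof.
rewrite -[d in LHS]card_ord -prodr_const bigA_distr_bigA nchomE.
rewrite (reindex (fun alpha : d.-tuple 'I_g => [ffun i => tnth alpha i])) /=; last first.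
  exists (fun f : {ffun 'I_d -> 'I_g} => [tuple f i | i < d]) => [alpha|f] _.
    by apply: eq_from_tnth => i; rewrite tnth_mktuple ffunE.
  by apply/ffunP => i; rewrite ffunE tnth_mktuple.
apply: eq_bigr => alpha _; under eq_bigr do rewrite ffunE.
by rewrite ffunE -(big_tuple _ _ alpha xpredT (fun j => a j *: ncvar F j)) prod_ncvar.
Qed.

Lemma waring_decompP d (P : {ffun d.-tuple 'I_g -> F}) t :
  waring_decomp d (nchom P) t <->
  exists A : 'I_t -> 'I_g -> F, forall alpha, P alpha = \sum_s \prod_(j <- alpha) A s j.
Proof.
have E (A : 'I_t -> 'I_g -> F) : \sum_s (\sum_j A s j *: ncvar F j) ^+ d =
    nchom [ffun alpha : d.-tuple 'I_g => \sum_s \prod_(j <- alpha) A s j].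
  under eq_bigr do rewrite expr_linear_form.
  rewrite exchange_big; apply: eq_bigr => alpha _.
  by rewrite ffunE scaler_suml; apply: eq_bigr => s _; rewrite ffunE.
split=> -[A PA]; exists A.
  by move=> alpha; move: PA; rewrite E => /nchom_inj ->; rewrite ffunE.
by rewrite E; congr nchom; apply/ffunP => alpha; rewrite ffunE.
Qed.

Lemma sum_split (V : nmodType) (T : Type) t t' (A : 'I_t -> T) (B : 'I_t' -> T) (f : T -> V) :
  \sum_s f (match split s with inl s' => A s' | inr s' => B s' end) =
  \sum_s f (A s) + \sum_s f (B s).
Proof.
rewrite big_split_ord; congr (_ + _); apply: eq_bigr => s _.
  by rewrite (unsplitK (inl s)).
by rewrite (unsplitK (inr s)).
Qed.

Lemma waring_decompD d (p q : ncpoly F g) t t' :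
  waring_decomp d p t -> waring_decomp d q t' -> waring_decomp d (p + q) (t + t').
Proof.
move=> [A ->] [B ->].
exists (fun s => match split s with inl s' => A s' | inr s' => B s' end).
exact/esym/(sum_split A B (fun a => (\sum_j a j *: ncvar F j) ^+ d)).
Qed.

Lemma waring_decomp0 d t : (0 < d)%N -> waring_decomp d (0 : ncpoly F g) t.
Proof.
move=> d0; exists (fun _ _ => 0); rewrite big1 // => s _.
by rewrite big1 ?expr0n ?gtn_eqF // => j _; rewrite scale0r.
Qed.

Lemma waring_decomp_le d (p : ncpoly F g) t t' : (0 < d)%N -> (t <= t')%N ->
  waring_decomp d p t -> waring_decomp d p t'.
Proof.
move=> d0 /subnKC <- pt; rewrite -[p]addr0; apply: waring_decompD => //.
exact: waring_decomp0.
Qed.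

End FreeAlgebra.

(** * Symmetric families as functions on commutative monomials *)

Section Dictionary.
Variables (K : numFieldType) (d g : nat).
Hypothesis g_gt0 : (0 < g)%N.

Lemma monval_inj (m1 m2 : mon d g) :
  (forall x : nat -> K, monval m1 x = monval m2 x) -> m1 = m2.
Proof.
move=> e; pose F (m : mon d g) : K := (m == m1)%:R - (m == m2)%:R.
have /(_ m1)/eqP : F =1 (fun=> 0).
  apply: ev_inj => x; rewrite /ev; under eq_bigr do rewrite mulrBl.
  have pick m' : \sum_m (m == m')%:R * monval m x = monval m' x.
    rewrite (bigD1 m') //= eqxx mul1r big1 ?addr0 // => m /negPf ->.
    by rewrite mul0r.
  by rewrite sumrB !pick e subrr.
by rewrite /F eqxx subr_eq0 eqr_nat; case: (m1 =P m2).
Qed.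

(** The classes of index tuples with equal letter counts are the monomials; a symmetric family is
    thus determined by its values on the representatives [rep m], and these are arbitrary. *)
Lemma symmetric_coordinates :
  exists (rep : mon d g -> d.-tuple 'I_g) (cls : d.-tuple 'I_g -> mon d g),
  [/\ forall m (x : nat -> K), monval m x = \prod_(j <- rep m) x j,
      forall alpha (x : nat -> K), monval (cls alpha) x = \prod_(j <- alpha) x j,
      cancel rep cls &
      forall alpha beta, cls alpha = cls beta <->
        forall j, count_mem j alpha = count_mem j beta].
Proof.
have /boolp.choice[rep repE] : forall m : mon d g, exists alpha : d.-tuple 'I_g,
    forall x : nat -> K, monval m x = \prod_(j <- alpha) x j.
  move=> m; have [s [sd sg] sE] := seq_of_mon m.
  pose r := [seq insubd (Ordinal g_gt0) j | j <- s].
  have rd : size r == d by rewrite size_map sd.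
  exists (Tuple rd) => x; rewrite sE /= big_map; apply: eq_big_seq => j js.
  by rewrite insubdK //; exact: (allP sg).
have [tau tauE] := @monomials d g g_gt0.
pose cls (alpha : d.-tuple 'I_g) := tau (map val alpha).
have clsE alpha (R : comNzRingType) (x : nat -> R) :
    monval (cls alpha) x = \prod_(j <- alpha) x j.
  rewrite tauE ?big_map ?size_map ?size_tuple //.
  by apply/allP => j /mapP[i _ ->]; exact: ltn_ord.
exists rep, cls; split=> // [m|alpha beta].
  by apply: monval_inj => x; rewrite clsE repE.
split=> [e j|ab]; last first.
  apply: monval_inj => x; rewrite !clsE; apply: perm_big.
  by apply/allP => j _; rewrite /= ab.
(* Setting x_j = 2 and the other variables to 1 reads the multiplicity of j off the value of the
   monomial. *)
have E (s : seq 'I_g) : \prod_(i <- s) (if nat_of_ord i == j then 2 else 1)%:R = 2 ^+ count_mem j s :> int.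
  elim: s => [|i s IH]; rewrite ?big_nil ?big_cons //= IH exprD.
  by rewrite -val_eqE /=; case: eqP; rewrite ?mul1r.
have := congr1 (fun m => monval m (fun i => (if i == nat_of_ord j then 2 else 1)%:R : int)) e.
by rewrite !clsE !E; apply: ieexprIn.
Qed.

End Dictionary.

(** * The generic rank *)

Section GenericRank.

Lemma expected_rankP g d : (0 < g)%N ->
  exists2 e, expected_rank g d = e.+1 & (e * g < 'C(g.-1 + d, d) <= e.+1 * g)%N.
Proof.
move=> g0; rewrite /expected_rank (_ : g + d - 1 = g.-1 + d)%N; last by lia.
set C := 'C(_, _); have C0 : (0 < C)%N by rewrite bin_gt0 leq_addl.
have g0' : 0 < g%:R :> rat by rewrite ltr0n.
set x : rat := _ * _; have x0 : 0 < x by rewrite mulr_gt0 ?invr_gt0 ?ltr0n.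
have /andP[] := ceil_itv x.
have : (0 < Num.ceil x)%R.
  by rewrite lt_neqAle eq_sym ceil_neq0 x0 orbT ceil_ge0 (lt_trans _ x0) // oppr_lt0.
case: (Num.ceil x) => // -[//|e] _ lo hi; exists e => //.
apply/andP; split.
  move: lo; rewrite (_ : Posz e.+1 - 1 = Posz e); last by lia.
  by rewrite ltr_pdivlMl // -natrM ltr_nat mulnC.
by move: hi; rewrite ler_pdivrMl // -natrM ler_nat mulnC.
Qed.

Lemma generic_rank_gt0 g d : (0 < g)%N -> (0 < generic_rank g d)%N.
Proof.
by move=> g0; rewrite /generic_rank; have [e -> _] := expected_rankP d g0; case: ifP => // _; case: ifP.
Qed.

Lemma exceptional_floor d g e : (d, g) \in [:: (3, 5); (4, 3); (4, 4); (4, 5)]%N ->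
  (e * g < 'C(g.-1 + d, d) <= e.+1 * g)%N ->
  (d, g, e) \in [:: (3, 5, 6); (4, 3, 4); (4, 4, 8); (4, 5, 13)]%N.
Proof.
rewrite !inE => /or4P[] /eqP[-> ->] /=.
- by rewrite (_ : 'C(_, _) = 35)%N // !xpair_eqE /=; lia.
- by rewrite (_ : 'C(_, _) = 15)%N // !xpair_eqE /=; lia.
- by rewrite (_ : 'C(_, _) = 35)%N // !xpair_eqE /=; lia.
- by rewrite (_ : 'C(_, _) = 70)%N // !xpair_eqE /=; lia.
Qed.

Variable K : numFieldType.

Lemma generic_rank_good g d : (0 < g)%N -> (0 < d)%N -> good K d g (generic_rank g d) 0.
Proof.
move=> g0 d0; rewrite /generic_rank; case: eqP => [->|d2]; first exact: quadric_good.
have [e eE /andP[lo hi]] := expected_rankP d g0; rewrite eE.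
have [d1|d1] := eqVneq d 1%N.
  rewrite d1 addn1 bin1 prednK // in lo hi.
  have -> : e = 0%N by case: e lo {eE hi} => // e; rewrite mulSn; lia.
  by rewrite d1 /=; exact: linear_good.
have d3 : (3 <= d)%N by lia.
have AH := @alexander_hirschowitz K d g d3 g0.
case: ifP => [dg|/negbT dg]; apply: AH; rewrite ?addn0 1?mulnC //.
- have := @exceptional_floor d g e dg; rewrite lo hi => /(_ isT).
  by rewrite !inE => /or4P[] /eqP[-> -> ->].
- by rewrite (leq_trans hi) // leq_mul2r leqnSn orbT.
- by apply: contra dg; rewrite /exceptional !inE !xpair_eqE => /or4P[] /andP[-> _]; rewrite ?orbT.
Qed.

Lemma generic_rank_obstruction g d : (0 < g)%N -> exists2 G : mpoly #|mon d g| K, G != 0 &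
  forall A : 'I_(generic_rank g d).-1 -> nat -> K,
    G.@[fun i => waring_map A (enum_val i)] = 0.
Proof.
move=> g0; have [d2|d2] := eqVneq d 2.
  by rewrite d2 /generic_rank /=; apply: quadric_obstruction; rewrite prednK.
have [e eE /andP[lo hi]] := expected_rankP d g0; rewrite /generic_rank (negPf d2) eE.
case: ifP => [dg|_]; last by apply: waring_dependent; rewrite card_mon.
have := @exceptional_floor d g e dg; rewrite lo hi => /(_ isT).
rewrite !inE /= => /or4P[] /eqP[-> -> ->].
- exact: cubic_obstruction.
- exact: (@quartic_obstruction K 3 5 _ isT isT catalecticant3).
- exact: (@quartic_obstruction K 4 9 _ isT isT catalecticant4).
- exact: (@quartic_obstruction K 5 14 _ isT isT catalecticant5).
Qed.

End GenericRank.

Section Generic.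
Variable K : numClosedFieldType.

Lemma meval_line n (u : mpoly n K) (a b : 'I_n -> K) :
  exists p : {poly K}, forall t, p.[t] = u.@[fun k => a k + t * b k].
Proof.
exists (mmap polyC (fun k => (a k)%:P + (b k) *: 'X) u) => t.
rewrite -[LHS]/(horner_eval t _) rmorph_mmap; apply: mmap_ext => [c|k].
  by rewrite /= /horner_eval hornerC.
by rewrite /= /horner_eval !hornerE mulrC.
Qed.

(* Both u at a + t b and u at z - (a + t b) are nonzero polynomials in t for
   b = z - 2 a: evaluate them at t = 0 and t = 1. *)
Lemma sum_of_two_generic n (u : mpoly n K) (z : 'I_n -> K) : u != 0 ->
  exists y, u.@[y] != 0 /\ u.@[fun k => z k - y k] != 0.
Proof.
move=> /meval_neq0[a ua]; pose b k := z k - a k *+ 2.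
have [p pE] := meval_line u a b.
have [q qE] := meval_line u (fun k => z k - a k) (fun k => - b k).
have p0 : p != 0.
  apply: contraNneq ua => p0; rewrite -(horner0 0) -p0 pE; apply/eqP.
  by apply: mmap_ext => // k; rewrite mul0r addr0.
have q0 : q != 0.
  apply: contraNneq ua => q0; rewrite -(horner0 1) -q0 qE; apply/eqP.
  by apply: mmap_ext => // k; rewrite /b; ring.
have [t] := poly_nonroot (mulf_neq0 p0 q0).
rewrite hornerM mulf_eq0 negb_or pE qE => /andP[pt qt].
exists (fun k => a k + t * b k); split=> //; apply: contraNneq qt => qt.
by rewrite -qt; apply/eqP; apply: mmap_ext => // k; ring.
Qed.

Variables g d : nat.
Hypotheses (g0 : (0 < g)%N) (d0 : (0 < d)%N).

Lemma waring_decomp_sym (rep : mon d g -> d.-tuple 'I_g) (cls : d.-tuple 'I_g -> mon d g)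
    (P : {ffun d.-tuple 'I_g -> K}) t :
  (forall (m : mon d g) (x : nat -> K), monval m x = \prod_(j <- rep m) x j) ->
  (forall alpha (x : nat -> K), monval (cls alpha) x = \prod_(j <- alpha) x j) ->
  (forall alpha : d.-tuple 'I_g, P (rep (cls alpha)) = P alpha) ->
  waring_decomp d (nchom P) t <->
  exists A : 'I_t -> nat -> K, forall m : mon d g, waring_map A m = P (rep m).
Proof.
move=> repE clsE PE; split=> [/waring_decompP[A PA]|[A PA]].
  exists (fun s j => if insub j is Some i then A s i else 0) => m.
  rewrite PA; apply: eq_bigr => s _; rewrite repE; apply: eq_bigr => j _.
  by rewrite valK.
apply/waring_decompP; exists (fun s j => A s j) => alpha.
by rewrite -PE -PA; apply: eq_bigr => s _; rewrite clsE.
Qed.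

Theorem waring_generic :
  (forall P : {ffun d.-tuple 'I_g -> K}, sym_coef P -> exists t, waring_decomp d (nchom P) t) /\
  generic_sym (fun P : {ffun d.-tuple 'I_g -> K} =>
    waring_rank_is d (nchom P) (generic_rank g d)).
Proof.
have [rep [cls [repE clsE repK clsP]]] := @symmetric_coordinates K d g g0.
have symE (P : {ffun d.-tuple 'I_g -> K}) : sym_coef P ->
    forall alpha, P (rep (cls alpha)) = P alpha.
  by move=> sP alpha; apply: sP; apply/clsP; rewrite repK.
have [u u0 uP] := waring_dominant d0 g0 (generic_rank_good K g0 d0).
have [G G0 GP] := generic_rank_obstruction K d g0.
have decomp P t : sym_coef P -> waring_decomp d (nchom P) t <->
    exists A : 'I_t -> nat -> K, forall m, waring_map A m = P (rep m).
  by move=> /symE; exact: waring_decomp_sym.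
have sym_of (y : 'I_#|mon d g| -> K) :
    sym_coef [ffun alpha : d.-tuple 'I_g => y (enum_rank (cls alpha))].
  by move=> alpha beta /clsP; rewrite !ffunE => ->.
split=> [P sP|].
  have [y [uy uzy]] := sum_of_two_generic (fun k => P (rep (enum_val k))) u0.
  exists (generic_rank g d + generic_rank g d)%N.
  pose P1 := [ffun alpha : d.-tuple 'I_g => y (enum_rank (cls alpha))].
  pose P2 := [ffun alpha : d.-tuple 'I_g =>
    P (rep (cls alpha)) - y (enum_rank (cls alpha))].
  have -> : nchom P = nchom P1 + nchom P2.
    rewrite /nchom -big_split; apply: eq_bigr => alpha _.
    by rewrite /= -scalerDl !ffunE addrC subrK symE.
  apply: waring_decompD; apply/decomp.
  - exact: sym_of.
  - by have [A AE] := uP _ uy; exists A => m; rewrite AE ffunE repK.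
  - by move=> alpha beta /clsP; rewrite !ffunE => ->.
  - by have [A AE] := uP _ uzy; exists A => m; rewrite AE ffunE repK enum_rankK.
pose q := u * G; have q0 : q != 0 by rewrite mulf_neq0.
(* The exceptions lie where u or G vanishes. Reading a family only at the tuples [rep m] pulls u G
   back to a polynomial in all coefficients that does not vanish identically on the symmetric
   ones. *)
pose f : mpoly #|{: d.-tuple 'I_g}| K :=
  q \mPo [tuple 'X_(enum_rank (rep (enum_val k))) | k < #|mon d g|].
have fE P : eval_coef f P = q.@[fun k => P (rep (enum_val k))].
  rewrite /eval_coef comp_mpoly_meval; apply: mmap_ext => // k.
  by rewrite tnth_mktuple mevalXU enum_rankK.
exists [:: f]; split.
  have [y qy] := meval_neq0 q0.
  exists [ffun alpha : d.-tuple 'I_g => y (enum_rank (cls alpha))]; first exact: sym_of.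
  exists f; rewrite ?mem_head // fE; apply: contraNneq qy => e.
  by rewrite -e; apply/eqP; apply: mmap_ext => // k; rewrite ffunE repK enum_valK.
move=> P sP nP _ /[!inE] /eqP ->; apply/eqP; apply: contra_notT nP.
rewrite fE /q rmorphM mulf_eq0 negb_or => /andP[uPn GPn]; split.
  by apply/decomp => //; have [A AE] := uP _ uPn; exists A => m; rewrite AE enum_rankK.
(* A shorter decomposition, padded with zero powers, has exactly [(generic_rank g d).-1] terms, and
   G vanishes on such sums. *)
move=> t' Pt'; rewrite leqNgt; apply: contra GPn => tt'.
have [A AE] : exists A : 'I_(generic_rank g d).-1 -> nat -> K,
    forall m, waring_map A m = P (rep m).
  apply/decomp => //; apply: waring_decomp_le Pt' => //.
  by rewrite -ltnS prednK // generic_rank_gt0.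
by rewrite -[X in _ == X](GP A); apply/eqP; apply: mmap_ext => // k.
Qed.

End Generic.

Theorem corollary1p1 (R : realType) (g d : nat)
    (hg : (1 <= g)%N) (hd : (1 <= d)%N) :
  (forall P : {ffun d.-tuple 'I_g -> R[i]},
     sym_coef P -> exists t : nat, waring_decomp d (nchom P) t) /\
  generic_sym (fun P : {ffun d.-tuple 'I_g -> R[i]} =>
    waring_rank_is d (nchom P) (generic_rank g d)).
Proof. exact: waring_generic. Qed.
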